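(* Let $\mathbb{K}$ be a perfect field and $F\in\mathbb{K}[[x]][y]$ monic and square-free of degree $d$ in $y$, where the characteristic of $\mathbb{K}$ is $0$ or greater than $d$. Then $F$ is balanced if and only if it is pseudo-irreducible. In such a case, $F$ has $f$ irreducible factors in $\overline{\mathbb{K}}[[x]][y]$, each of degree $e$, and (1) every irreducible factor has characteristic exponents $(B_0;\ B_k\ \text{for}\ k=1,\dots,g\ \text{with}\ q_k>1)$ (listed in increasing $k$); (2) every irreducible factor has intersection set consisting of the values $M_k$ for $k=1,\dots,g$ with $\ell_k>1$, where $M_k$ appears $\hat f_{k-1}-\hat f_k$ times.
   Context: Pseudo-irreducibility (algorithmic definition). Let $\mathbb{A}$ be a finite direct product of perfect fields; a polynomial over $\mathbb{A}$ is square-free if all its projections to the field factors are square-free. For $H=\sum_i h_i(x)y^i\in\mathbb{A}[[x]][y]$ monic of degree $N$, its Newton polygon is the lower convex hull of the points $(i,\mathrm{val}_x(h_i))$ (valuation given by the smallest exponent with nonzero coefficient); its lower edge is the edge having $(N,0)$ as right endpoint, of slope $-m/q$ with $\gcd(q,m)=1$, $q>0$ (convention $(q,m)=(1,0)$ if the polygon is a point); the lower boundary polynomial $\bar H$ is the sum of the terms $h_{ij}x^jy^i$ of $H$ with $(i,j)$ on that edge. $H$ is pseudo-degenerated if $\bar H=(P(y^q/x^m)x^{m\deg P})^N$ with $P\in\mathbb{A}[Z]$ monic square-free, $P(0)$ invertible when $q>1$; $(q,m,P,N)$ is its edge data. Procedure: $\mathbb{K}_0=\mathbb{K}$, $N_0=d$,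 $H_0=F(x,y-a_{d-1}/d)$ where $a_{d-1}$ is the coefficient of $y^{d-1}$ in $F$. For $k\ge0$, if $N_k=1$ stop with $g=k$; if $H_k$ is not pseudo-degenerated, stop with $g=k$. Otherwise let $(q_{k+1},m_{k+1},P_{k+1},N_{k+1})$ be its edge data, $\ell_{k+1}=\deg P_{k+1}$, $\mathbb{K}_{k+1}=\mathbb{K}_k[Z]/(P_{k+1})$, $z_{k+1}$ the class of $Z$, $s,t$ integers with $q_{k+1}s-m_{k+1}t=1$, $0\le t<q_{k+1}$; write $H_k(z_{k+1}^tx^{q_{k+1}},x^{m_{k+1}}(y+z_{k+1}^s))=x^aUG$ with $U(0,0)$ invertible and $G$ Weierstrass of degree $N_{k+1}$, and set $H_{k+1}=G(x,y-c/N_{k+1})$ where $c$ is the coefficient of $y^{N_{k+1}-1}$ in $G$. $F$ is pseudo-irreducible if the procedure stops with $N_g=1$. With the resulting data set $e_k=q_1\cdots q_k$, $e=e_g$, $\hat e_k=e/e_k$, $f_k=\ell_1\cdots\ell_k$, $f=f_g$, $\hat f_k=f/f_k$, $B_0=e$, $B_k=\sum_{i=1}^k m_i\hat e_i$, $M_k=\sum_{i=1}^k m_i\hat e_{i-1}\hat e_i$. Balanced: let $F_1,\dots,F_r$ be the distinct irreducible factors of $F$ in $\overline{\mathbb{K}}[[x]][y]$; $F$ is balanced if all $F_i$ have the same characteristic exponents and the same intersection sets $\Gamma_i(F)=((F_i,F_j)_0,\ j\ne i)$ (unordered lists with repetition), with $(G,H)_0=\mathrm{val}_x\mathrm{Res}_y(G,H)$.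 Characteristic exponents of irreducible $G$ of degree $e'$ centered at the origin with Puiseux parametrization $(T^{e'},\sum a_iT^i)$: $\beta_0=e'$, $\beta_k=\min\{i:a_i\neq0,\ \gcd(\beta_0,\dots,\beta_{k-1})\nmid i\}$ until the gcd equals $1$; branches centered at $(0,c)$ are translated by $c$, or replaced by the reciprocal polynomial if $c=\infty$. *)

(* Defs.v *)
From HB Require Import structures.
From mathcomp Require Import boolp.
From mathcomp Require Import all_boot all_order all_algebra.
From Stdlib Require Import ClassicalEpsilon.

Set Implicit Arguments.
Unset Strict Implicit.
Unset Printing Implicit Defensive.

Import GRing.Theory.
Local Open Scope ring_scope.

Record fps (R : Type) := Fps { fcoef : nat -> R }.
Arguments Fps {R}.
Arguments fcoef {R}.

HB.instance Definition _ (R : Type) := gen_eqMixin (fps R).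
HB.instance Definition _ (R : Type) := gen_choiceMixin (fps R).

Lemma fps_ext (R : Type) (f g : fps R) : (forall n, fcoef f n = fcoef g n) -> f = g.
Proof.
case: f => f; case: g => g /= H.
by rewrite (funext H).
Qed.

Section FpsRing.
Variable R : comNzRingType.

Definition fps0 : fps R := Fps (fun _ => 0).
Definition fps_add (f g : fps R) : fps R := Fps (fun n => fcoef f n + fcoef g n).
Definition fps_opp (f : fps R) : fps R := Fps (fun n => - fcoef f n).
Definition fps1 : fps R := Fps (fun n => (n == 0)%:R).
Definition fps_mul (f g : fps R) : fps R :=
  Fps (fun n => \sum_(j < n.+1) fcoef f j * fcoef g (n - j)).

Fact fps_addA : associative fps_add.
Proof. by move=> f g h; apply: fps_ext => n /=; rewrite addrA. Qed.
Fact fps_addC : commutative fps_add.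
Proof. by move=> f g; apply: fps_ext => n /=; rewrite addrC. Qed.
Fact fps_add0 : left_id fps0 fps_add.
Proof. by move=> f; apply: fps_ext => n /=; rewrite add0r. Qed.
Fact fps_addN : left_inverse fps0 fps_opp fps_add.
Proof. by move=> f; apply: fps_ext => n /=; rewrite addNr. Qed.

HB.instance Definition _ :=
  GRing.isZmodule.Build (fps R) fps_addA fps_addC fps_add0 fps_addN.

Definition ftrunc (n : nat) (f : fps R) : {poly R} := \poly_(i < n.+1) fcoef f i.

Lemma fps_mulE (f g : fps R) n :
  fcoef (fps_mul f g) n = (ftrunc n f * ftrunc n g)`_n.
Proof.
rewrite coefM /=; apply: eq_bigr => -[j hj] _ /=.
by rewrite !coef_poly hj ltnS leq_subr.
Qed.

Lemma coefM_eqr (p u v : {poly R}) n :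
  (forall i, (i <= n)%N -> u`_i = v`_i) -> (p * u)`_n = (p * v)`_n.
Proof.
move=> H; rewrite !coefM; apply: eq_bigr => -[j hj] _ /=.
by rewrite H // leq_subr.
Qed.

Lemma coefM_eql (p u v : {poly R}) n :
  (forall i, (i <= n)%N -> u`_i = v`_i) -> (u * p)`_n = (v * p)`_n.
Proof. by move=> H; rewrite ![_ * p]mulrC; apply: coefM_eqr. Qed.

Lemma ftrunc_mul (a b : fps R) n i : (i <= n)%N ->
  (ftrunc n (fps_mul a b))`_i = (ftrunc n a * ftrunc n b)`_i.
Proof.
move=> hi; rewrite coef_poly ltnS hi fps_mulE !coefM.
apply: eq_bigr => -[j hj] _ /=.
rewrite !coef_poly !ltnS.
have hji : (j <= i)%N by rewrite -ltnS.
rewrite hji leq_subr (leq_trans hji hi) (leq_trans (leq_subr j i) hi).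
done.
Qed.

Fact fps_mulA : associative fps_mul.
Proof.
move=> f g h; apply: fps_ext => n.
rewrite fps_mulE (coefM_eqr _ (ftrunc_mul g h (n:=n))).
rewrite [in RHS]fps_mulE mulrA; apply: esym; apply: coefM_eql => i hi.
exact: ftrunc_mul.
Qed.

Fact fps_mulC : commutative fps_mul.
Proof. by move=> f g; apply: fps_ext => n; rewrite !fps_mulE mulrC. Qed.

Lemma ftrunc1 n : ftrunc n fps1 = 1.
Proof.
apply/polyP => i; rewrite coef_poly coefC /=.
by case: i => [|i] /=; last case: ifP.
Qed.

Fact fps_mul1 : left_id fps1 fps_mul.
Proof.
by move=> f; apply: fps_ext => n; rewrite fps_mulE ftrunc1 mul1r coef_poly ltnSn.
Qed.

Fact fps_mulDl : left_distributive fps_mul fps_add.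
Proof.
move=> f g h; apply: fps_ext => n /=; rewrite -big_split /=.
by apply: eq_bigr => j _; rewrite mulrDl.
Qed.

Fact fps_nonzero1 : fps1 != 0 :> fps R.
Proof.
apply/eqP => /(congr1 (fun f => fcoef f 0)) /= /eqP.
by rewrite oner_eq0.
Qed.

HB.instance Definition _ :=
  GRing.Zmodule_isComNzRing.Build (fps R) fps_mulA fps_mulC fps_mul1 fps_mulDl
    fps_nonzero1.

End FpsRing.

Section FpsOps.
Variable R : comNzRingType.

Definition fpsC (c : R) : fps R := Fps (fun n => if n == 0%N then c else 0).
Definition fpsX : fps R := Fps (fun n => (n == 1%N)%:R).

(* val_x: the smallest exponent with nonzero coefficient (0 for the zero   *)
(* series, a value that is never used below).                              *)
Definition fps_val (f : fps R) : nat :=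
  match excluded_middle_informative (exists n, fcoef f n != 0) with
  | left h => @ex_minn (fun n => fcoef f n != 0) h
  | right _ => 0%N
  end.

End FpsOps.
Arguments fpsX {R}.

Definition is_unit (R : comNzRingType) (a : R) : Prop := exists b, a * b = 1.

Definition square_free (R : comNzRingType) (a : R) : Prop :=
  forall b c : R, ~ is_unit b -> a <> b * b * c.

Definition irreducible_elt (R : comNzRingType) (a : R) : Prop :=
  a <> 0 /\ ~ is_unit a /\ forall b c : R, a = b * c -> is_unit b \/ is_unit c.

Definition fps_map (R S : Type) (phi : R -> S) (f : fps R) : fps S :=
  Fps (fun n => phi (fcoef f n)).

(* f |-> f^phi (a x^q) = sum_j phi(f_j) a^j x^(q j)   (used with q > 0) *)
Definition fps_subst (R : Type) (S : comNzRingType) (phi : R -> S) (a : S)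
  (q : nat) (f : fps R) : fps S :=
  Fps (fun n => if (q %| n)%N then phi (fcoef f (n %/ q)) * a ^+ (n %/ q) else 0).

(* Finite products of perfect fields: a polynomial P over A is square-free  *)
(* if its images under all projections of A onto its field factors are      *)
(* square-free.  The projections onto the field factors are exactly the     *)
(* surjective ring morphisms from A onto fields.                            *)

Definition sqfree_over (A : comNzRingType) (P : {poly A}) : Prop :=
  forall (L : fieldType) (pi : {rmorphism A -> L}),
    (forall y : L, exists x : A, pi x = y) -> square_free (map_poly pi P).

(* H = sum_i h_i(x) y^i, h_ij = fcoef H`_i j, N = deg_y H.                  *)

Section Newton.
Variable A : comNzRingType.
Implicit Types (H : {poly fps A}) (P : {poly A}).

(* (q, m) describes the lower edge (the edge of the lower convex hull of    *)
(* the points (i, val h_i) having (N, 0) as right endpoint), of slope -m/q  *)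
(* with gcd(q,m) = 1, q > 0; convention (1, 0) if the polygon is a point.  *)
Definition lower_edge H (q m : nat) : Prop :=
  let N := (size H).-1 in
  let v i := fps_val H`_i in
  (0 < q)%N /\ coprime q m /\
  ( ((forall i, (i < N)%N -> H`_i = 0) /\ q = 1%N /\ m = 0%N)
  \/ ((exists i, [/\ (i < N)%N, H`_i != 0 & (v i * q = m * (N - i))%N])
      /\ (forall i, (i < N)%N -> H`_i != 0 -> (m * (N - i) <= v i * q)%N))).

(* lower boundary polynomial: the terms h_ij x^j y^i with (i,j) on the line *)
(* of the lower edge, i.e. q j + m i = m N.                                 *)
Definition boundary_poly H (q m : nat) : {poly fps A} :=
  let N := (size H).-1 in
  \poly_(i < N.+1)
     Fps (fun j => if (q * j + m * i == m * N)%N then fcoef H`_i j else 0).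

(* P(y^q / x^m) x^(m deg P) *)
Definition edge_poly P (q m : nat) : {poly fps A} :=
  \sum_(k < size P)
     (fpsC P`_k * fpsX ^+ (m * ((size P).-1 - k)))%:P * 'X^(q * k).

Definition pseudo_degenerated H (q m : nat) P (N' : nat) : Prop :=
  [/\ lower_edge H q m, P \is monic, sqfree_over P,
      ((1 < q)%N -> is_unit P`_0) & boundary_poly H q m = edge_poly P q m ^+ N'].

Definition weierstrass (G : {poly fps A}) (N : nat) : Prop :=
  [/\ G \is monic, size G = N.+1 & forall i, (i < N)%N -> fcoef G`_i 0 = 0].

End Newton.

(* A' together with iota : A -> A' and z : A' is (a copy of) A[Z]/(P), z     *)
(* being the class of Z: every element of A' is uniquely the value at z of  *)
(* a polynomial of degree < deg P, and P(z) = 0.                            *)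
Definition is_quotient_by (A A' : comNzRingType) (iota : {rmorphism A -> A'})
    (z : A') (P : {poly A}) : Prop :=
  [/\ (map_poly iota P).[z] = 0,
      (forall w : A', exists r : {poly A}, (size r < size P)%N /\ w = (map_poly iota r).[z])
    & (forall r1 r2 : {poly A}, (size r1 < size P)%N -> (size r2 < size P)%N ->
         (map_poly iota r1).[z] = (map_poly iota r2).[z] -> r1 = r2)].

Definition tschirnhausen (K : fieldType) (A : comNzRingType) (kappa : K -> A)
    (G : {poly fps A}) : {poly fps A} :=
  let N := (size G).-1 in
  G \Po ('X - (fpsC (kappa (N%:R)^-1) * G`_N.-1)%:P).

(* The pseudo-irreducibility procedure, as a relation.                      *)
(* pi_run kappa H ds Ng : starting from H_k = H over A = K_k (kappa : K ->   *)
(* K_k being the structural embedding), the procedure produces the edge    *)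
(* data ds = [:: (q_{k+1}, m_{k+1}, l_{k+1}, N_{k+1}); ...; (q_g,m_g,l_g,N_g)]*)
(* and stops with N_g = Ng.                                                  *)
Inductive pi_run (K : fieldType) :
    forall A : comNzRingType, (K -> A) -> {poly fps A} ->
      seq (nat * nat * nat * nat) -> nat -> Prop :=
| pi_stop_one (A : comNzRingType) (kappa : K -> A) (H : {poly fps A}) :
    size H = 2%N -> @pi_run K A kappa H [::] 1%N
| pi_stop_nondeg (A : comNzRingType) (kappa : K -> A) (H : {poly fps A}) :
    size H != 2%N ->
    ~ (exists q m (P : {poly A}) N', pseudo_degenerated H q m P N') ->
    @pi_run K A kappa H [::] (size H).-1
| pi_step (A : comNzRingType) (kappa : K -> A) (H : {poly fps A})
    (q m : nat) (P : {poly A}) (N' : nat)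
    (A' : comNzRingType) (iota : {rmorphism A -> A'}) (z : A')
    (s t a : nat) (U G : {poly fps A'}) rest Ng :
    size H != 2%N ->
    pseudo_degenerated H q m P N' ->
    is_quotient_by iota z P ->
    (q * s = m * t + 1)%N -> (t < q)%N ->
    (map_poly (fps_subst iota (z ^+ t) q) H)
        \Po ((fpsX ^+ m)%:P * ('X + (fpsC (z ^+ s))%:P))
      = (fpsX ^+ a)%:P * U * G ->
    is_unit (fcoef U`_0 0) ->
    weierstrass G N' ->
    @pi_run K A' (iota \o kappa) (tschirnhausen (iota \o kappa) G) rest Ng ->
    @pi_run K A kappa H ((q, m, (size P).-1, N') :: rest) Ng.

Definition pi_success (K : fieldType) (F : {poly fps K}) ds : Prop :=
  @pi_run K K (fun x => x) (tschirnhausen (fun x : K => x) F) ds 1%N.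

Definition pseudo_irreducible (K : fieldType) (F : {poly fps K}) : Prop :=
  exists ds, pi_success F ds.

(* Data attached to ds (1-indexed: k = 1..g, g = size ds) *)
Section Data.
Variable ds : seq (nat * nat * nat * nat).
Definition dat k := nth (0, 0, 0, 0)%N ds k.-1.
Definition q_ k := (dat k).1.1.1.
Definition m_ k := (dat k).1.1.2.
Definition l_ k := (dat k).1.2.
Definition g_ := size ds.
Definition e_ k := (\prod_(i < k) q_ i.+1)%N.
Definition e_tot := e_ g_.
Definition ehat k := (e_tot %/ e_ k)%N.
Definition f_ k := (\prod_(i < k) l_ i.+1)%N.
Definition f_tot := f_ g_.
Definition fhat k := (f_tot %/ f_ k)%N.
Definition B_ k := (\sum_(i < k) m_ i.+1 * ehat i.+1)%N.
Definition M_ k := (\sum_(i < k) m_ i.+1 * ehat i * ehat i.+1)%N.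
Definition char_exps_list : seq nat :=
  e_tot :: [seq B_ k | k <- iota 1 g_ & (1 < q_ k)%N].
Definition inter_list : seq nat :=
  flatten [seq nseq (fhat k.-1 - fhat k) (M_ k) | k <- iota 1 g_ & (1 < l_ k)%N].
End Data.

Section Branches.
Variable L : fieldType.

(* Puiseux parametrization (T^e', S(T)) of G of degree e': G(T^e', S(T)) = 0 *)
Definition puiseux_param (G : {poly fps L}) (S : fps L) : Prop :=
  (map_poly (fps_subst (fun c : L => c) 1 (size G).-1) G).[S] = 0.

Definition is_char_exps (e' : nat) (a : nat -> L) (s : seq nat) : Prop :=
  exists bs : seq nat,
    [/\ s = e' :: bs,
        (forall k, (k < size bs)%N ->
           let gk := foldl gcdn 0%N (take k.+1 s) in
           let b := nth 0%N bs k in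
           [/\ a b != 0, ~~ (gk %| b)%N &
               forall i, (i < b)%N -> a i != 0 -> (gk %| i)%N])
      & foldl gcdn 0%N s = 1%N].

Definition has_char_exps (G : {poly fps L}) (s : seq nat) : Prop :=
  (exists S, puiseux_param G S) /\
  (forall S, puiseux_param G S -> is_char_exps (size G).-1 (fcoef S) s).

Definition inter_mult (G H : {poly fps L}) : nat := fps_val (resultant G H).

Definition inter_set (Fs : seq {poly fps L}) (i : nat) : seq nat :=
  [seq inter_mult (nth 0 Fs i) (nth 0 Fs j) | j <- iota 0 (size Fs) & j != i].

Definition irr_factors (F' : {poly fps L}) (Fs : seq {poly fps L}) : Prop :=
  [/\ uniq Fs, all (fun G => G \is monic) Fs,
      (forall G, G \in Fs -> irreducible_elt G)
    & \prod_(G <- Fs) G = F'].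

Definition balanced (Fs : seq {poly fps L}) : Prop :=
  (exists s, forall G, G \in Fs -> has_char_exps G s) /\
  (forall i j, (i < size Fs)%N -> (j < size Fs)%N ->
     perm_eq (inter_set Fs i) (inter_set Fs j)).

End Branches.

Definition perfect_field (K : fieldType) : Prop :=
  forall p, p \in [pchar K] -> forall a : K, exists b : K, b ^+ p = a.

Definition algebraic_over (K L : fieldType) (iota : {rmorphism K -> L}) : Prop :=
  forall y : L, exists p : {poly K}, p != 0 /\ root (map_poly iota p) y.

(* Main.v *)
(* Write H_k for the polynomial reached after k steps, over the ring K_k, and put x = T^e with e the
   product of the remaining q's.  The ring K_k is only seen through its morphisms phi to the
   algebraic closure L.

   Procedure to branches.  A root r of H_{k+1} over a root rho of P_{k+1} gives the root
   (T/lam)^(m e') (r(T/lam) + rho^s) of H_k, where lam^e = rho^t; here r is first shifted by the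
   Tschirnhausen term, a series in T^(e').  Such roots over different rho, or over the same rho with
   T replaced by wT, already differ in their leading coefficient unless q divides the exponent of
   the root of unity w.  By induction from the last step, this yields e f distinct roots, their
   characteristic exponents and their mutual distances; no Newton-Puiseux theorem is needed.  The
   valuation of a resultant is a sum of distances between roots.

   Balanced to procedure.  Being balanced forces the multiset of distances from a root of F(T^e, y)
   to the other roots not to depend on the root: the intersection multiplicity of two factors is a
   strictly increasing function of their largest contact.  This property, together with the
   independence of the first exponent not divisible by a given divisor of e, passes from H_k to
   H_{k+1}.  It makes all roots of the boundary polynomial have the same multiplicity N', so that this
   polynomial is an N'-th power over K_k (its approximate N'-th root is exact), and Hensel's lemma
   gives the next Weierstrass factor. *)

(* Towards the procedure, the obstacle is that K_k is a product of fields: polynomials found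
   separately under each phi need not come from one polynomial over K_k, and their degrees could
   vary with phi. So the invariant uses one distance function [D] and one relation [M] for all phi
   at once, which makes q, m, l and N' common to them; and P is computed inside K_k, dividing only
   by N', before its images are identified.

   Distances alone would be too weak an invariant. With x = T^2 the roots 0, T, -T of y(y^2 - x) are
   pairwise at distance 1, yet its boundary polynomial is not a power of some P(y^2/x). The relation
   [M], which records the first exponent not divisible by dd, rules this out.

   In the other direction K_(k+1), U and G are arbitrary objects meeting the specification, so the
   induction on the run uses only the identities they satisfy.

   The bound on the characteristic is used to invert degrees: N' in the Tschirnhausen shift and in
   approximate roots, e to have a primitive root of unity w whose powers yield all conjugates, and
   degrees of factors of P to pass from square-free to separable. *)
From HB Require Import structures.
Require Import Defs.
From mathcomp Require Import boolp.
From mathcomp Require Import all_boot all_order all_algebra.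
From mathcomp Require Import cyclic separable cyclotomic.
From mathcomp Require Import zify ring.
Set Implicit Arguments.
Unset Strict Implicit.
Unset Printing Implicit Defensive.
Import GRing.Theory.
Local Open Scope ring_scope.

(** * Power series *)

Section FpsBasic.
Variable R : comNzRingType.
Implicit Types (f g : fps R) (n k : nat).

Lemma fcoefD f g n : fcoef (f + g) n = fcoef f n + fcoef g n.
Proof. by []. Qed.

Lemma fcoefN f n : fcoef (- f) n = - fcoef f n.
Proof. by []. Qed.

Lemma fcoefB f g n : fcoef (f - g) n = fcoef f n - fcoef g n.
Proof. by []. Qed.

Lemma fcoef0 n : fcoef (0 : fps R) n = 0.
Proof. by []. Qed.

Lemma fcoef1 n : fcoef (1 : fps R) n = (n == 0)%:R.
Proof. by []. Qed.

Lemma fcoefM f g n : fcoef (f * g) n = \sum_(j < n.+1) fcoef f j * fcoef g (n - j).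
Proof. by []. Qed.

Lemma fcoef_sum (I : Type) (r : seq I) (P : pred I) (F : I -> fps R) n :
  fcoef (\sum_(i <- r | P i) F i) n = \sum_(i <- r | P i) fcoef (F i) n.
Proof. exact: (big_morph (fun f => fcoef f n) (fun f g => fcoefD f g n) (fcoef0 n)). Qed.

Lemma fps_nz f n : fcoef f n != 0 -> f != 0.
Proof. by apply: contra_neq => ->. Qed.

Lemma fpsC_additive : zmod_morphism (@fpsC R).
Proof. by move=> a b; apply: fps_ext => -[|n] //=; rewrite subr0. Qed.

Lemma fpsC_multiplicative : monoid_morphism (@fpsC R).
Proof.
split=> [|a b]; apply: fps_ext => -[|n] //=.
  by rewrite big_ord_recl big_ord0 addr0.
by rewrite big1 // => -[[|j] hj] _ //=; rewrite ?mulr0 ?mul0r.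
Qed.

HB.instance Definition _ := GRing.isZmodMorphism.Build R (fps R) (@fpsC R) fpsC_additive.
HB.instance Definition _ := GRing.isMonoidMorphism.Build R (fps R) (@fpsC R) fpsC_multiplicative.

Definition ev0 f : R := fcoef f 0.

Lemma ev0_additive : zmod_morphism ev0.
Proof. by []. Qed.

Lemma ev0_multiplicative : monoid_morphism ev0.
Proof. by split=> // f g; rewrite /ev0 fcoefM big_ord_recl big_ord0 addr0. Qed.

HB.instance Definition _ := GRing.isZmodMorphism.Build (fps R) R ev0 ev0_additive.
HB.instance Definition _ := GRing.isMonoidMorphism.Build (fps R) R ev0 ev0_multiplicative.

Lemma fcoef_fpsX_mul f k : fcoef (fpsX * f) k = if k is k'.+1 then fcoef f k' else 0.
Proof.
rewrite fcoefM; case: k => [|k]; first by rewrite big_ord_recl big_ord0 mul0r addr0.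
rewrite big_ord_recl mul0r add0r big_ord_recl /= mul1r /bump /= subSS subn0.
by rewrite big1 ?addr0 // => i _; rewrite mul0r.
Qed.

Lemma fcoef_Xn_mul n f k :
  fcoef (fpsX ^+ n * f) k = if (k < n)%N then 0 else fcoef f (k - n).
Proof.
elim: n k => [|n IH] k; first by rewrite expr0 mul1r ltn0 subn0.
by rewrite exprS -mulrA fcoef_fpsX_mul; case: k => [|k] //; rewrite IH ltnS subSS.
Qed.

Lemma fcoefCM (c : R) f n : fcoef (fpsC c * f) n = c * fcoef f n.
Proof.
rewrite fcoefM big_ord_recl /= subn0 big1 ?addr0 // => -[j hj] _ /=.
by rewrite mul0r.
Qed.

Definition fshift n f : fps R := Fps (fun k => fcoef f (k + n)%N).

Lemma fshiftK n f : (forall i, (i < n)%N -> fcoef f i = 0) -> fpsX ^+ n * fshift n f = f.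
Proof.
move=> h; apply: fps_ext => k; rewrite fcoef_Xn_mul.
by case: ltnP => [/h|hk] //=; rewrite subnK.
Qed.

Lemma fpsXn_inj n : injective (fun f => fpsX ^+ n * f).
Proof.
move=> f g /(congr1 fcoef) h; apply: fps_ext => k.
have := congr1 (fun u => u (k + n)%N) h.
by rewrite !fcoef_Xn_mul ltnNge leq_addl /= addnK.
Qed.

Lemma fps_val_eq f n :
  (forall i, (i < n)%N -> fcoef f i = 0) -> fcoef f n != 0 -> fps_val f = n.
Proof.
move=> lo nz; rewrite /fps_val; case: ClassicalEpsilon.excluded_middle_informative => [h|[]]; last by exists n.
case: ex_minnP => m nzm /(_ _ nz) le_mn; apply/eqP; rewrite eqn_leq le_mn leqNgt.
by apply: contra nzm => /lo ->.
Qed.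

Lemma fps_val_nz f : f != 0 -> fcoef f (fps_val f) != 0.
Proof.
move=> nz; rewrite /fps_val; case: ClassicalEpsilon.excluded_middle_informative => [h|h].
  by case: ex_minnP.
case/eqP: nz; apply: fps_ext => n; rewrite fcoef0.
by apply/eqP/negPn/negP => hn; apply: h; exists n.
Qed.

Lemma fps_val_lt f i : (i < fps_val f)%N -> fcoef f i = 0.
Proof.
rewrite /fps_val; case: ClassicalEpsilon.excluded_middle_informative => [h|h] //.
case: ex_minnP => m nzm min lt_im; apply/eqP; apply: contraLR lt_im => /min.
by rewrite -leqNgt.
Qed.

Lemma fps_val_ge f n : f != 0 -> (forall i, (i < n)%N -> fcoef f i = 0) -> (n <= fps_val f)%N.
Proof.
by move=> nz lo; rewrite leqNgt; apply/negP => /lo h; move: (fps_val_nz nz); rewrite h eqxx.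
Qed.

Lemma fps_val_le f n : fcoef f n != 0 -> (fps_val f <= n)%N.
Proof. by move=> nz; rewrite leqNgt; apply: contra nz => /fps_val_lt ->. Qed.

Lemma fps_valN f : fps_val (- f) = fps_val f.
Proof.
case: (eqVneq f 0) => [->|nz]; first by rewrite oppr0.
apply: fps_val_eq => [i /fps_val_lt h|]; first by rewrite fcoefN h oppr0.
by rewrite fcoefN oppr_eq0 fps_val_nz.
Qed.

Lemma fps_valBC f g : fps_val (f - g) = fps_val (g - f).
Proof. by rewrite -fps_valN opprB. Qed.

Lemma fps_val_Xn n f : f != 0 -> fps_val (fpsX ^+ n * f) = (n + fps_val f)%N.
Proof.
move=> nz; apply: fps_val_eq => [i hi|].
  rewrite fcoef_Xn_mul; case: ltnP => // hn; apply: fps_val_lt; lia.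
by rewrite fcoef_Xn_mul ltnNge leq_addr /= addKn fps_val_nz.
Qed.

Lemma fps_val_min (a b c : fps R) : a != b -> b != c -> a != c ->
  fps_val (a - b) != fps_val (b - c) ->
  fps_val (a - c) = minn (fps_val (a - b)) (fps_val (b - c)).
Proof.
move=> ab bc ac; have -> : a - c = (a - b) + (b - c) by rewrite addrA subrK.
have nab : a - b != 0 by rewrite subr_eq0.
have nbc : b - c != 0 by rewrite subr_eq0.
set u := a - b in nab *; set v := b - c in nbc *.
case: ltngtP => // lt _; apply: fps_val_eq => [i hi|]; rewrite fcoefD.
- by rewrite (fps_val_lt hi) add0r fps_val_lt // (ltn_trans hi).
- by rewrite (fps_val_lt lt) addr0 fps_val_nz.
- by rewrite (fps_val_lt hi) addr0 fps_val_lt // (ltn_trans hi).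
- by rewrite (fps_val_lt lt) add0r fps_val_nz.
Qed.

Lemma fps_val_minle (a b c : fps R) : a != c ->
  (minn (fps_val (a - b)%R) (fps_val (b - c)%R) <= fps_val (a - c)%R)%N.
Proof.
move=> ac; apply: fps_val_ge; first by rewrite subr_eq0.
move=> i; rewrite leq_min => /andP[h1 h2].
have -> : a - c = (a - b) + (b - c) by rewrite addrA subrK.
by rewrite fcoefD (fps_val_lt h1) (fps_val_lt h2) addr0.
Qed.

End FpsBasic.

Lemma sum_dvdn (V : nmodType) (q k : nat) (g : nat -> V) : (0 < q)%N ->
  \sum_(j < (q * k).+1 | (q %| j)%N) g j = \sum_(i < k.+1) g (q * i)%N.
Proof.
move=> q0; rewrite -(big_mkord (fun j => (q %| j)%N) g) -(big_mkord xpredT (fun i => g (q * i)%N)).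
elim: k => [|k IH]; first by rewrite muln0 big_nat1 big_mkcond /= big_nat1 dvdn0 muln0.
rewrite [RHS]big_nat_recr //= -IH mulnS addnC.
rewrite (@big_cat_nat _ _ _ (q * k).+1) //=; last by rewrite ltnS leq_addr.
congr (_ + _).
rewrite big_mkcond /= big_nat_recr /=; last by rewrite -[X in (X < _)%N]addn0 ltn_add2l.
rewrite dvdn_addr ?dvdn_mulr // dvdnn big_nat_cond big1 ?add0r // => i.
rewrite andbT => /andP[h1 h2]; case: ifP => // /dvdnP[c hc]; exfalso.
have hkc : (k < c)%N by rewrite -(ltn_pmul2l q0) [X in (_ < X)%N]mulnC -hc.
have : (c < k.+1)%N by rewrite -(ltn_pmul2l q0) [X in (X < _)%N]mulnC -hc mulnS addnC.
by rewrite ltnS leqNgt hkc.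
Qed.

(** Writing the exponent as [q.-1.+1] makes it positive, so that the ring morphism instances below
    hold without a side condition on q. *)
Definition fsub (R : Type) (S : comNzRingType) (phi : R -> S) (a : S) (q : nat) (f : fps R) : fps S :=
  fps_subst phi a q.-1.+1 f.

Lemma fsubE (R : Type) (S : comNzRingType) (phi : R -> S) a q : (0 < q)%N ->
  fps_subst phi a q = fsub phi a q.
Proof. by move=> q0; apply: funext => f; rewrite /fsub prednK. Qed.

Lemma fcoef_fsub (R : Type) (S : comNzRingType) (phi : R -> S) a q f n : (0 < q)%N ->
  fcoef (fsub phi a q f) n = if (q %| n)%N then phi (fcoef f (n %/ q)) * a ^+ (n %/ q) else 0.
Proof. by move=> q0; rewrite -fsubE. Qed.

Section Fsub.
Variables (R S : comNzRingType) (phi : {rmorphism R -> S}) (a : S) (q : nat).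

Let fcoefS f n : fcoef (fsub phi a q f) n =
  if (q.-1.+1 %| n)%N then phi (fcoef f (n %/ q.-1.+1)) * a ^+ (n %/ q.-1.+1) else 0.
Proof. by []. Qed.

Lemma fsub_additive : zmod_morphism (fsub phi a q).
Proof.
move=> f g; apply: fps_ext => n; rewrite fcoefB /=.
by case: ifP => _; rewrite ?subr0 // rmorphB mulrBl.
Qed.

Lemma fsub_multiplicative : monoid_morphism (fsub phi a q).
Proof.
split=> [|f g]; apply: fps_ext => n; rewrite fcoefS.
  case: n => [|n]; first by rewrite dvdn0 div0n expr0 mulr1 rmorph1.
  rewrite !fcoef1.
  case: ifP => // /dvdnP[k hk].
  have k0 : k == 0%N = false by case: k hk.
  by rewrite hk mulnK // muln_eq0 k0 rmorph0 mul0r.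
rewrite fcoefM; case: ifP => [/dvdnP[k ->]|ndv].
  rewrite mulnK // mulnC [in LHS]fcoefM rmorph_sum mulr_suml.
  have -> : forall r, \sum_(j < (q.-1.+1 * k).+1) fcoef (fsub phi a q f) j * r j
     = \sum_(j < (q.-1.+1 * k).+1 | (q.-1.+1 %| j)%N) fcoef (fsub phi a q f) j * r j.
    move=> r; rewrite [RHS]big_mkcond; apply: eq_bigr => j _.
    by case: ifP => // h; rewrite fcoefS ifF ?mul0r.
  rewrite (sum_dvdn k (fun j => fcoef (fsub phi a q f) j * fcoef (fsub phi a q g) (q.-1.+1 * k - j))) //.
  apply: eq_bigr => -[i hi] _; rewrite !fcoefS -mulnBr !dvdn_mulr // !mulKn // rmorphM mulrACA -exprD subnKC //.
rewrite big1 // => -[j hj] _; rewrite !fcoefS /=; case: ifP => h1; last by rewrite mul0r.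
case: ifP => h2; last by rewrite mulr0.
by rewrite -(subnKC (n:=n) (m:=j)) // dvdn_addr ?h2 // in ndv.
Qed.

HB.instance Definition _ := GRing.isZmodMorphism.Build (fps R) (fps S) (fsub phi a q) fsub_additive.
HB.instance Definition _ := GRing.isMonoidMorphism.Build (fps R) (fps S) (fsub phi a q) fsub_multiplicative.

Lemma fsubC c : fsub phi a q (fpsC c) = fpsC (phi c).
Proof.
apply: fps_ext => -[|n]; rewrite fcoefS; first by rewrite dvdn0 div0n expr0 mulr1.
case: ifP => // /dvdnP[[|k] hk] //.
by rewrite hk mulnK //= rmorph0 mul0r.
Qed.

Lemma fsubX : (0 < q)%N -> fsub phi a q fpsX = fpsC a * fpsX ^+ q.
Proof.
move=> q0; apply: fps_ext => n; rewrite fcoef_fsub // fcoefCM -[fpsX ^+ q]mulr1 fcoef_Xn_mul fcoef1 /=.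
case: ifP => [/dvdnP[k ->]|ndv].
  rewrite mulnK //; case: k => [|[|k]] /=.
  - by rewrite mul0n q0 rmorph0 mul0r mulr0.
  - by rewrite mul1n ltnn subnn eqxx rmorph1 mul1r mulr1.
  rewrite rmorph0 mul0r ltnNge leq_pmull //= mulSn addKn.
  by rewrite muln_eq0 /= eqn0Ngt q0 mulr0.
case: ltnP => [|le]; rewrite ?mulr0 //.
case: eqP => [h|]; rewrite ?mulr0 //.
by move: ndv; rewrite (_ : n = q) ?dvdnn //; lia.
Qed.

End Fsub.

Lemma fsub_comp (R S T : comNzRingType) (phi : R -> S) (psi : {rmorphism S -> T})
    (a : S) (b : T) q r f : (0 < q)%N -> (0 < r)%N ->
  fsub psi b r (fsub phi a q f) = fsub (psi \o phi) (psi a * b ^+ q) (q * r) f.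
Proof.
move=> q0 r0; apply: fps_ext => n; rewrite !fcoef_fsub ?muln_gt0 ?q0 //.
case: (boolP (r %| n)%N) => [/dvdnP[k ->]|ndv].
  rewrite mulnK // dvdn_pmul2r //; case: ifP => [/dvdnP[l ->]|_]; last by rewrite rmorph0 mul0r.
  rewrite -mulnA !mulnK ?muln_gt0 ?q0 // rmorphM rmorphXn exprMn -!mulrA; congr (_ * (_ * _)).
  by rewrite -exprM mulnC.
case: ifP => // h; case/negP: ndv; exact: dvdn_trans (dvdn_mull _ _) h.
Qed.

Lemma fsub_id (R : comNzRingType) (f : fps R) : fsub idfun 1 1 f = f.
Proof. by apply: fps_ext => n; rewrite fcoef_fsub // dvd1n divn1 expr1n mulr1. Qed.

Lemma fps_map_fsub (R : Type) (S : comNzRingType) (phi : R -> S) : fps_map phi = fsub phi 1 1.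
Proof.
by apply: funext => f; apply: fps_ext => n; rewrite fcoef_fsub // dvd1n divn1 expr1n mulr1.
Qed.

Lemma fsub_inj (R : comNzRingType) (S : idomainType) (phi : {rmorphism R -> S}) a q : (0 < q)%N ->
  injective phi -> a != 0 -> injective (fsub phi a q).
Proof.
move=> q0 inj nz f g h; apply: fps_ext => n.
have := congr1 (fun u => fcoef u (n * q)%N) h.
rewrite !fcoef_fsub // dvdn_mull // mulnK // => /mulIf h1.
by apply/inj/h1; rewrite expf_neq0.
Qed.

Section FpsIdomain.
Variable R : idomainType.
Implicit Types f g : fps R.

Lemma fps_valM f g : f != 0 -> g != 0 ->
  fcoef (f * g) (fps_val f + fps_val g)%N != 0 /\ fps_val (f * g) = (fps_val f + fps_val g)%N.
Proof.
move=> nf ng.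
have E : fcoef (f * g) (fps_val f + fps_val g)%N = fcoef f (fps_val f) * fcoef g (fps_val g).
  have hf : (fps_val f < (fps_val f + fps_val g).+1)%N by rewrite ltnS leq_addr.
  rewrite fcoefM (bigD1 (Ordinal hf)) //= addKn big1 ?addr0 // => -[j hj].
  rewrite -val_eqE /= => ne; case: (ltngtP j (fps_val f)) ne => // h _.
    by rewrite (fps_val_lt h) mul0r.
  by rewrite (@fps_val_lt _ g) ?mulr0 //; lia.
have nz : fcoef (f * g) (fps_val f + fps_val g)%N != 0.
  by rewrite E mulf_neq0 // fps_val_nz.
split=> //; apply: fps_val_eq => // i hi; rewrite fcoefM big1 // => -[j hj] _ /=.
case: (ltnP j (fps_val f)) => h; first by rewrite (fps_val_lt h) mul0r.
by rewrite (@fps_val_lt _ g) ?mulr0 //; lia.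
Qed.

(** Inverses are picked by choice; this supplies the unit structure that an integral domain instance
    requires, and over an integral domain polynomials can be factored by their roots. *)
Definition fps_unit : pred (fps R) := fun f => `[< exists g, g * f = 1 >].
Definition fps_inv f : fps R :=
  if pselect (exists g, g * f = 1) is left h then projT1 (cid h) else f.

Lemma fps_mulVx : {in fps_unit, left_inverse 1 fps_inv *%R}.
Proof.
move=> f /asboolP h; rewrite /fps_inv; case: pselect => // h'.
exact: (projT2 (cid h')).
Qed.

Lemma fps_unitPl f g : g * f = 1 -> f \in fps_unit.
Proof. by move=> h; apply/asboolP; exists g. Qed.

Lemma fps_inv_out : {in [predC fps_unit], fps_inv =1 id}.
Proof. by move=> f /asboolPn h; rewrite /fps_inv; case: pselect. Qed.

HB.instance Definition _ :=
  GRing.ComNzRing_hasMulInverse.Build (fps R) fps_mulVx fps_unitPl fps_inv_out.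

Lemma fps_integral f g : f * g = 0 -> (f == 0) || (g == 0).
Proof.
move=> h; case: (eqVneq f 0) => //= nf; apply/negPn/negP => ng.
by case: (fps_valM nf ng); rewrite h fcoef0 eqxx.
Qed.

HB.instance Definition _ := GRing.ComUnitRing_isIntegral.Build (fps R) fps_integral.

Lemma fps_val_prod (I : Type) (r : seq I) (F : I -> fps R) :
  (forall i, F i != 0) -> fps_val (\prod_(i <- r) F i) = (\sum_(i <- r) fps_val (F i))%N.
Proof.
move=> nz; elim: r => [|i r IH].
  by rewrite !big_nil; apply: fps_val_eq; rewrite // fcoef1 oner_neq0.
rewrite !big_cons -IH; apply: (fps_valM _ _).2 => //.
by elim: r {IH} => [|j r IH]; rewrite ?big_nil ?oner_neq0 // big_cons mulf_neq0.
Qed.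

Lemma fps_val_scale (c : R) f : c != 0 -> fps_val (fsub idfun c 1 f) = fps_val f.
Proof.
move=> nc; case: (eqVneq f 0) => [->|nz]; first by rewrite rmorph0.
apply: fps_val_eq => [i /fps_val_lt h|]; rewrite fcoef_fsub // dvd1n divn1 /=.
  by rewrite h mul0r.
by rewrite mulf_neq0 ?fps_val_nz ?expf_neq0.
Qed.

Lemma fps_val_pow q f : (0 < q)%N -> fps_val (fsub idfun 1 q f) = (q * fps_val f)%N.
Proof.
move=> q0; case: (eqVneq f 0) => [->|nz].
  rewrite rmorph0 (_ : fps_val 0 = 0%N) ?muln0 //.
  by rewrite /fps_val; case: ClassicalEpsilon.excluded_middle_informative => // -[n]; rewrite eqxx.
apply: fps_val_eq => [i h|]; rewrite fcoef_fsub // expr1n mulr1 /=.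
  by case: ifP => // hq; rewrite fps_val_lt // ltn_divLR // mulnC.
by rewrite dvdn_mulr // mulKn // fps_val_nz.
Qed.

End FpsIdomain.

Arguments fcoef : simpl never.

Lemma fcoefE (R : Type) (g : nat -> R) n : fcoef (Fps g) n = g n.
Proof. by []. Qed.

(** * Polynomials and quotient rings *)

Lemma monic_size1 (A : comNzRingType) (p : {poly A}) : p \is monic -> size p = 1%N -> p = 1.
Proof.
move=> mp sp; have /size1_polyC E : (size p <= 1)%N by rewrite sp.
by move: mp; rewrite E monicE lead_coefC => /eqP ->.
Qed.

Lemma size_map_monic (A : nzRingType) (B : nzRingType) (f : {rmorphism A -> B}) (p : {poly A}) :
  p \is monic -> size (map_poly f p) = size p.
Proof. by move=> /monicP mp; rewrite size_map_poly_id0 // mp rmorph1 oner_neq0. Qed.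

Section Roots.
Variable R : idomainType.
Implicit Types (p : {poly R}) (rs : seq R).

Lemma roots_factor p rs : uniq rs -> all (root p) rs ->
  exists q, p = q * \prod_(r <- rs) ('X - r%:P).
Proof.
elim: rs => [|r rs IH] /=; first by exists p; rewrite big_nil mulr1.
case/andP=> nr /IH{}IH /andP[pr /IH[q Ep]].
have : root q r.
  move: pr; rewrite Ep rootM => /orP[] //.
  by rewrite root_prod_XsubC (negPf nr).
by case/factor_theorem=> q' Eq; exists q'; rewrite Ep Eq big_cons mulrA.
Qed.

Lemma monic_mul_inv p q : q \is monic -> p * q \is monic -> p \is monic.
Proof. by move=> mq; rewrite monicMr. Qed.

Lemma monic_roots p rs : p \is monic -> uniq rs -> all (root p) rs ->
  size p = (size rs).+1 -> p = \prod_(r <- rs) ('X - r%:P).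
Proof.
move=> mp /roots_factor/[apply] -[q Ep] sp.
have mq : q \is monic.
  by apply: (@monic_mul_inv _ (\prod_(r <- rs) ('X - r%:P))); rewrite ?monic_prod_XsubC -?Ep.
have : size p = (size q + size rs)%N.
  by rewrite Ep size_Mmonic ?monic_neq0 ?monic_prod_XsubC // size_prod_XsubC addnS.
rewrite sp => /eqP; rewrite -add1n eqn_add2r => /eqP sq.
rewrite {1}Ep (monic_size1 mq) //.
by rewrite mul1r.
Qed.

Lemma dvd_unit_monic p q : p \is monic -> p * q = 1 -> p = 1.
Proof.
move=> mp pq; have nq : q != 0 by apply: contra_eq_neq pq => ->; rewrite mulr0 eq_sym oner_neq0.
have := congr1 (fun u : {poly R} => size u) pq.
rewrite size_monicM // size_poly1 => h.
have sp : size p = 1%N by have := monic_neq0 mp; rewrite -size_poly_gt0; move: nq; rewrite -size_poly_gt0; lia.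
exact: monic_size1.
Qed.

End Roots.

(** The ring may have zero divisors, so the degree of the composite is read off from its leading
    term and not from the degrees of its parts. *)
Lemma monic_comp_XaddC (A : comNzRingType) (p : {poly A}) (c : A) : p \is monic ->
  p \Po ('X + c%:P) \is monic /\ size (p \Po ('X + c%:P)) = size p.
Proof.
move=> mp; set n := (size p).-1.
have sp : size p = n.+1 by rewrite prednK // size_poly_gt0 monic_neq0.
pose r := p - 'X^n.
have sr : (size r <= n)%N.
  apply/leq_sizeP => j; rewrite leq_eqVlt coefB coefXn => /predU1P[<-|lt].
    by rewrite eqxx -/n -lead_coefE (monicP mp) subrr.
  by rewrite (gtn_eqF lt) subr0 nth_default // sp.
have -> : p = 'X^n + r by rewrite addrC subrK.
have mX : ('X + c%:P) \is monic by rewrite monicXaddC.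
have mXn : ('X + c%:P) ^+ n \is monic by rewrite monic_exp.
have sXn : size (('X + c%:P) ^+ n) = n.+1.
  elim: n {sp r sr mXn} => [|k IH]; first by rewrite expr0 size_poly1.
  by rewrite exprSr size_Mmonic ?monic_exp // -?size_poly_gt0 IH ?size_XaddC // addn2.
have src : (size (r \Po ('X + c%:P)) <= n)%N.
  case: (eqVneq r 0) => [->|nr]; first by rewrite comp_poly0 size_poly0.
  apply: leq_trans (size_comp_poly_leq _ _) _; rewrite size_XaddC /= muln1.
  by rewrite prednK // size_poly_gt0.
rewrite comp_polyD comp_Xn_poly.
have lt1 : (size (r \Po ('X + c%:P))%R < size (('X + c%:P) ^+ n)%R)%N by rewrite sXn.
have lt2 : (size r < size ('X^n : {poly A}))%N by rewrite size_polyXn.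
split; first by rewrite monicE lead_coefDl // -monicE.
by rewrite (size_polyDl lt1) (size_polyDl lt2) sXn size_polyXn.
Qed.

(** * The image of a morphism to L, as a field *)

Section ImageField.

(* rtf_inv makes the image of rtf_map a field; packing it in a record lets the type of the image
   carry a canonical field structure. *)
Record ring_to_field := RingToField {
  rtf_dom : comNzRingType;
  rtf_cod : fieldType;
  rtf_map : {rmorphism rtf_dom -> rtf_cod};
  rtf_inv : forall a, exists b, rtf_map b = (rtf_map a)^-1 }.
Variable D : ring_to_field.

Definition in_image : pred (rtf_cod D) := fun x => `[< exists a, rtf_map D a = x >].

Lemma in_image_divring : divring_closed in_image.
Proof.
split=> [|_ _ /asboolP[a <-] /asboolP[b <-]|_ _ /asboolP[a <-] /asboolP[b <-]]; apply/asboolP.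
- by exists 1; rewrite rmorph1.
- by exists (a - b); rewrite rmorphB.
by case: (rtf_inv b) => c <-; exists (a * c); rewrite rmorphM.
Qed.

HB.instance Definition _ := GRing.isDivringClosed.Build (rtf_cod D) in_image in_image_divring.

Record image_field := ImageField { image_val : rtf_cod D; _ : image_val \in in_image }.
HB.instance Definition _ := [isSub for image_val].
HB.instance Definition _ := [Choice of image_field by <:].
HB.instance Definition _ := [SubChoice_isSubIntegralDomain of image_field by <:].

Lemma image_field_unit : {mono (val : image_field -> rtf_cod D) : u / u \in GRing.unit}.
Proof.
move=> u; apply/idP/idP => [|/rmorph_unit //].
move=> hu; apply/unitrP.
have [a Ea] : exists a, rtf_map D a = (val u)^-1.
  by have /asboolP[a <-] := valP u; apply: rtf_inv.
have hin : (val u)^-1 \in in_image by apply/asboolP; exists a.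
exists (ImageField hin); split; apply: val_inj; rewrite rmorphM rmorph1 /=.
  by rewrite mulVr.
by rewrite mulrV.
Qed.

HB.instance Definition _ :=
  GRing.SubIntegralDomain_isSubField.Build _ _ image_field image_field_unit.

Lemma image_corestr_subproof a : rtf_map D a \in in_image.
Proof. by apply/asboolP; exists a. Qed.
Definition image_corestr a : image_field := ImageField (image_corestr_subproof a).

Lemma image_corestr_additive : zmod_morphism image_corestr.
Proof. by move=> a b; apply: val_inj; rewrite /= rmorphB. Qed.
Lemma image_corestr_multiplicative : monoid_morphism image_corestr.
Proof. by split=> [|a b]; apply: val_inj; rewrite ?rmorph1 ?rmorphM /= ?rmorph1 ?rmorphM. Qed.
HB.instance Definition _ :=
  GRing.isZmodMorphism.Build _ _ image_corestr image_corestr_additive.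
HB.instance Definition _ :=
  GRing.isMonoidMorphism.Build _ _ image_corestr image_corestr_multiplicative.

(** [sqfree_over] speaks of morphisms onto fields. A morphism to L becomes one when its codomain is
    restricted to its image. *)
Lemma image_corestr_surj (y : image_field) : exists a, image_corestr a = y.
Proof. by have /asboolP[a Ea] := valP y; exists a; apply: val_inj. Qed.

End ImageField.

(** A polynomial over K that vanishes at phi a and has a non-zero constant term writes the inverse
    of phi a as a polynomial in phi a over K, so the inverse stays in the image. *)
Lemma algebraic_inv (K L : fieldType) (iota : {rmorphism K -> L}) (A : comNzRingType)
    (kappa : K -> A) (phi : {rmorphism A -> L}) : algebraic_over iota ->
  (forall x, phi (kappa x) = iota x) -> forall a, exists b, phi b = (phi a)^-1.
Proof.
move=> alg hk a; case: (eqVneq (phi a) 0) => [->|nz].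
  by exists 0; rewrite rmorph0 invr0.
have [p [np rp]] := alg (phi a).
(* Factors X are divided out of p; this keeps the root phi a, which is not zero. *)
have [q [q0 rq]] : exists q : {poly K}, q`_0 != 0 /\ root (map_poly iota q) (phi a).
  elim: {p}(size p) {-2}p (leqnn (size p)) np rp => [|n IH] p.
    by rewrite leqn0 size_poly_eq0 => ->.
  move=> sp np rp; case: (eqVneq p`_0 0) => [p0|]; last by exists p.
  have /factor_theorem[q Eq] : root p 0 by rewrite rootE horner_coef0 p0.
  rewrite subr0 in Eq.
  have nq : q != 0 by apply: contra_neq np => q0; rewrite Eq q0 mul0r.
  apply: (IH q) => //; first by move: sp; rewrite Eq size_mulX.
  by move: rp; rewrite Eq rmorphM /= map_polyX rootM rootX (negPf nz) orbF.
pose r := \poly_(i < (size q).-1) q`_i.+1.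
have Dq : q = r * 'X + (q`_0)%:P.
  apply/polyP => i; rewrite coefD coefMX coefC; case: i => [|i] /=; first by rewrite add0r.
  by rewrite addr0 coef_poly; case: ltnP => // h; rewrite nth_default //; move: h; case: (size q).
have : (map_poly iota q).[phi a] = 0 by apply/rootP.
rewrite {1}Dq rmorphD rmorphM /= map_polyX map_polyC hornerD hornerMX hornerC.
pose b := \sum_(i < size r) kappa r`_i * a ^+ i.
have -> : (map_poly iota r).[phi a] = phi b.
  rewrite (@horner_coef_wide _ (size r)) ?size_map_poly // rmorph_sum.
  by apply: eq_bigr => i _; rewrite rmorphM rmorphXn hk coef_map.
move=> /eqP; rewrite addr_eq0 => /eqP E.
have nq : iota q`_0 != 0 by rewrite fmorph_eq0.
exists (- b * kappa (q`_0)^-1); rewrite rmorphM rmorphN hk fmorphV.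
apply: (mulIf nz); rewrite mulVf // mulrAC mulNr E opprK mulfV //.
Qed.

(** A factor u of positive degree with zero derivative would satisfy deg u * lead_coef u = 0, which
    the bound on the degree of p excludes. *)
Lemma square_free_separable (k : fieldType) (p : {poly k}) :
  (forall n, (0 < n < size p)%N -> n%:R != 0 :> k) -> p != 0 ->
  square_free p -> separable_poly p.
Proof.
move=> char np sq; apply/separable_polyP; split.
  apply/poly_square_freeP => u su; apply/negP => /dvdpP[c Ec].
  apply: (sq u c); last by rewrite Ec mulrC expr2.
  case=> v /(congr1 (fun p : {poly k} => size p)); rewrite size_poly1 => suv.
  have : u * v != 0 by rewrite -size_poly_eq0 suv.
  rewrite mulf_eq0 negb_or => /andP[nu nv].
  move: suv su; rewrite size_mul //; move: nu nv; rewrite -!size_poly_gt0.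
  by move: (size u) (size v) => [|[|a]] [|[|b]] //; rewrite !addSn !addnS.
move=> u up su; apply/eqP => u'0.
have su_le : (size u <= size p)%N by rewrite dvdp_leq.
have := congr1 (fun p : {poly k} => p`_(size u).-2) u'0.
rewrite coef_deriv coef0 => /eqP; rewrite -mulr_natr mulf_eq0.
have -> : (size u).-2.+1 = (size u).-1 by lia.
rewrite -lead_coefE lead_coef_eq0 -size_poly_eq0 gtn_eqF ?(ltnW su) //=.
apply/negP/char; move: su su_le; case: (size u) => [|[|j]] //= _.
Qed.

(* A square-free polynomial over the image field becomes separable because its
   degree is smaller than the characteristic. *)
Lemma sqfree_over_separable (D : ring_to_field) (P : {poly rtf_dom D}) :
  (forall n, (0 < n < size P)%N -> n%:R != 0 :> rtf_cod D) ->
  P \is monic -> sqfree_over P -> separable_poly (map_poly (rtf_map D) P).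
Proof.
move=> char mP sq.
have mP' : map_poly (@image_corestr D) P \is monic by apply: monic_map.
have -> : map_poly (rtf_map D) P
    = map_poly (val : image_field D -> rtf_cod D) (map_poly (@image_corestr D) P).
  by rewrite -map_poly_comp; apply: eq_map_poly.
rewrite separable_map; apply: square_free_separable.
- move=> n; rewrite size_map_monic // => hn; apply: contra (char n hn) => /eqP h.
  by rewrite -(rmorph_nat (val : image_field D -> rtf_cod D)) h rmorph0.
- exact: monic_neq0.
exact: (sq _ (@image_corestr D) (@image_corestr_surj D)).
Qed.

Lemma sqfree_over_roots (K : fieldType) (L : closedFieldType) (iota : {rmorphism K -> L})
    (A : comNzRingType) (kappa : K -> A) (phi : {rmorphism A -> L}) (P : {poly A}) :
  algebraic_over iota -> (forall x, phi (kappa x) = iota x) ->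
  (forall n, (0 < n < size P)%N -> n%:R != 0 :> L) ->
  P \is monic -> sqfree_over P ->
  exists rs, uniq rs /\ map_poly phi P = \prod_(r <- rs) ('X - r%:P).
Proof.
move=> alg hk char mP sq.
have sep := @sqfree_over_separable (RingToField (algebraic_inv alg hk)) P char mP sq.
have [rs Ers] := closed_field_poly_normal (map_poly phi P).
have Ers' : map_poly phi P = \prod_(r <- rs) ('X - r%:P).
  by rewrite Ers (monicP (monic_map _ mP)) scale1r.
by exists rs; split=> //; rewrite -separable_prod_XsubC -Ers'.
Qed.

(** * Morphisms out of A[Z]/(P) *)

Section Quotient.
Variables (A A' : comNzRingType) (iota : {rmorphism A -> A'}) (z : A') (P : {poly A}).
Hypotheses (mP : P \is monic) (hq : is_quotient_by iota z P).
Variables (L : fieldType) (phi : {rmorphism A -> L}) (rho : L).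
Hypothesis (hrho : root (map_poly phi P) rho).

Lemma quotient_repr w : exists r : {poly A}, (size r < size P)%N /\ w = (map_poly iota r).[z].
Proof. by case: hq. Qed.

Definition quotient_eval (w : A') : L :=
  (map_poly phi (projT1 (cid (quotient_repr w)))).[rho].

(** Division by the monic P reduces any representative to the chosen one, and the discarded multiple
    of P vanishes at rho. *)
Lemma quotient_evalE (r : {poly A}) :
  quotient_eval (map_poly iota r).[z] = (map_poly phi r).[rho].
Proof.
rewrite /quotient_eval; case: cid => r' /= [sr' Er'].
have [hz _ huniq] := hq.
have Er := Pdiv.RingMonic.rdivp_eq mP r.
have sr : (size (Pdiv.CommonRing.rmodp r P) < size P)%N.
  by rewrite Pdiv.CommonRing.ltn_rmodpN0 // monic_neq0.
have -> : r' = Pdiv.CommonRing.rmodp r P.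
  apply: huniq => //; rewrite -Er' {1}Er rmorphD rmorphM hornerD hornerM hz.
  by rewrite mulr0 add0r.
by rewrite [in RHS]Er rmorphD rmorphM hornerD hornerM (rootP hrho) mulr0 add0r.
Qed.

Lemma quotient_eval_additive : zmod_morphism quotient_eval.
Proof.
move=> a b; have [r [_ ->]] := quotient_repr a; have [s [_ ->]] := quotient_repr b.
by rewrite -hornerN -hornerD -!rmorphN -rmorphD !quotient_evalE rmorphB hornerD hornerN.
Qed.

Lemma quotient_eval_multiplicative : monoid_morphism quotient_eval.
Proof.
split=> [|a b].
  have -> : 1 = (map_poly iota 1).[z] by rewrite rmorph1 hornerC.
  by rewrite quotient_evalE rmorph1 hornerC.
have [r [_ ->]] := quotient_repr a; have [s [_ ->]] := quotient_repr b.
by rewrite -hornerM -rmorphM !quotient_evalE rmorphM hornerM.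
Qed.

(** Each root rho of P thus yields its own extension of phi; this is how the next ring of the
    procedure is reached. *)
Lemma quotient_morphism : exists psi : {rmorphism A' -> L},
  (forall a, psi (iota a) = phi a) /\ psi z = rho.
Proof.
pose m1 := GRing.isZmodMorphism.Build A' L quotient_eval quotient_eval_additive.
pose m2 := GRing.isMonoidMorphism.Build A' L quotient_eval quotient_eval_multiplicative.
pose psi : {rmorphism A' -> L} := HB.pack quotient_eval m1 m2.
exists psi; split=> [a|].
  have -> : iota a = (map_poly iota a%:P).[z] by rewrite map_polyC hornerC.
  by rewrite [LHS]quotient_evalE map_polyC hornerC.
have -> : z = (map_poly iota 'X).[z] by rewrite map_polyX hornerX.
by rewrite [LHS]quotient_evalE map_polyX hornerX.
Qed.

End Quotient.

Notation fscale c := (fsub idfun c 1).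

Lemma fcoef_scale (R : comNzRingType) (c : R) f n : fcoef (fscale c f) n = fcoef f n * c ^+ n.
Proof. by rewrite fcoef_fsub // dvd1n divn1. Qed.

Lemma fscale1 (R : comNzRingType) (f : fps R) : fscale 1 f = f.
Proof. exact: fsub_id. Qed.

Lemma fscale_comp (R : comNzRingType) (a b : R) f : fscale a (fscale b f) = fscale (a * b) f.
Proof. by apply: fps_ext => n; rewrite !fcoef_scale exprMn mulrA mulrAC. Qed.

Lemma fscale_fsub (R S : comNzRingType) (phi : R -> S) (a c : S) e f : (0 < e)%N ->
  fscale c (fsub phi a e f) = fsub phi (a * c ^+ e) e f.
Proof. by move=> e0; rewrite fsub_comp // muln1. Qed.

Lemma map_fsub_comp (R S T : comNzRingType) (phi : {rmorphism R -> S})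
    (psi : {rmorphism S -> T}) (a : S) (b : T) q r (H : {poly fps R}) : (0 < q)%N -> (0 < r)%N ->
  map_poly (fsub psi b r) (map_poly (fsub phi a q) H)
    = map_poly (fsub (psi \o phi) (psi a * b ^+ q) (q * r)) H.
Proof. by move=> q0 r0; apply/polyP => i; rewrite !coef_map /= fsub_comp. Qed.

Lemma map_fscale_fsub (R S : comNzRingType) (phi : {rmorphism R -> S}) (a c : S) e
    (H : {poly fps R}) : (0 < e)%N ->
  map_poly (fscale c) (map_poly (fsub phi a e) H) = map_poly (fsub phi (a * c ^+ e) e) H.
Proof. by move=> e0; apply/polyP => i; rewrite !coef_map /= fscale_fsub. Qed.

(* What the Tschirnhausen step adds to every root of G, seen after phi and x = T^e. *)
Definition tsch_shift (K : fieldType) (A L : comNzRingType) (kappa : K -> A) (phi : A -> L) e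
    (G : {poly fps A}) : fps L :=
  fsub phi 1 e (fpsC (kappa ((size G).-1)%:R^-1) * G`_(size G).-2).

Lemma map_tschirnhausen (K : fieldType) (A L : comNzRingType) (kappa : K -> A)
    (phi : {rmorphism A -> L}) e (G : {poly fps A}) :
  map_poly (fsub phi 1 e) (tschirnhausen kappa G)
    = map_poly (fsub phi 1 e) G \Po ('X - (tsch_shift kappa phi e G)%:P).
Proof.
rewrite /tschirnhausen map_comp_poly; congr (_ \Po _).
by rewrite rmorphB /= map_polyX map_polyC.
Qed.

Lemma tschirnhausen_monic (K : fieldType) (A : comNzRingType) (kappa : K -> A)
    (G : {poly fps A}) : G \is monic ->
  tschirnhausen kappa G \is monic /\ size (tschirnhausen kappa G) = size G.
Proof. by move=> mG; rewrite /tschirnhausen -polyCN; apply: monic_comp_XaddC. Qed.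

(** * Data of a run and characteristic exponents *)

Section DataRec.
Implicit Types (ds : seq (nat * nat * nat * nat)).

Definition pos_data ds := all (fun x : nat * nat * nat * nat => (0 < x.1.1.1) && (0 < x.1.2))%N ds.

(** These recursive forms of the two lists follow one step of the procedure. Going up a step
    multiplies the branches by T^(m e') with e' = [e_tot r]: this adds m e' to every exponent, and q
    e' times m e' to every intersection multiplicity, a sum of q e' distances. *)
Fixpoint char_exps_rec ds : seq nat :=
  if ds is (q, m, l, N) :: r then
    let b := (m * e_tot r)%N in
    (if (1 < q)%N then [:: b] else [::]) ++ map (addn b) (char_exps_rec r)
  else [::].

Fixpoint inter_rec ds : seq nat :=
  if ds is (q, m, l, N) :: r then
    let b := (m * (q * e_tot r) * e_tot r)%N in
    nseq (l * f_tot r - f_tot r) b ++ map (addn b) (inter_rec r)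
  else [::].

Lemma e_cons x r k : e_ (x :: r) k.+1 = (x.1.1.1 * e_ r k)%N.
Proof. by rewrite /e_ big_ord_recl. Qed.

Lemma f_cons x r k : f_ (x :: r) k.+1 = (x.1.2 * f_ r k)%N.
Proof. by rewrite /f_ big_ord_recl. Qed.

Lemma e_tot_cons x r : e_tot (x :: r) = (x.1.1.1 * e_tot r)%N.
Proof. exact: e_cons. Qed.

Lemma f_tot_cons x r : f_tot (x :: r) = (x.1.2 * f_tot r)%N.
Proof. exact: f_cons. Qed.

Lemma e_tot_nil : e_tot [::] = 1%N.
Proof. by rewrite /e_tot /e_ big_ord0. Qed.

Lemma f_tot_nil : f_tot [::] = 1%N.
Proof. by rewrite /f_tot /f_ big_ord0. Qed.

Lemma e_tot_gt0 ds : pos_data ds -> (0 < e_tot ds)%N.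
Proof.
elim: ds => [|x r IH]; first by rewrite e_tot_nil.
by rewrite e_tot_cons muln_gt0 => /andP[/andP[-> _] /IH].
Qed.

Lemma f_tot_gt0 ds : pos_data ds -> (0 < f_tot ds)%N.
Proof.
elim: ds => [|x r IH]; first by rewrite f_tot_nil.
by rewrite f_tot_cons muln_gt0 => /andP[/andP[_ ->] /IH].
Qed.

Lemma ehat0 ds : ehat ds 0 = e_tot ds.
Proof. by rewrite /ehat /e_ big_ord0 divn1. Qed.

Lemma fhat0 ds : fhat ds 0 = f_tot ds.
Proof. by rewrite /fhat /f_ big_ord0 divn1. Qed.

Lemma ehat_cons x r k : (0 < x.1.1.1)%N -> ehat (x :: r) k.+1 = ehat r k.
Proof. by move=> q0; rewrite /ehat e_tot_cons e_cons divnMl. Qed.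

Lemma fhat_cons x r k : (0 < x.1.2)%N -> fhat (x :: r) k.+1 = fhat r k.
Proof. by move=> q0; rewrite /fhat f_tot_cons f_cons divnMl. Qed.

Lemma B_cons x r k : (0 < x.1.1.1)%N ->
  B_ (x :: r) k.+1 = (x.1.1.2 * e_tot r + B_ r k)%N.
Proof.
move=> q0; rewrite /B_ big_ord_recl /= ehat_cons // ehat0; congr (_ + _)%N.
by apply: eq_bigr => i _; rewrite ehat_cons.
Qed.

Lemma M_cons x r k : (0 < x.1.1.1)%N ->
  M_ (x :: r) k.+1 = (x.1.1.2 * (x.1.1.1 * e_tot r) * e_tot r + M_ r k)%N.
Proof.
move=> q0; rewrite /M_ big_ord_recl /= ehat_cons // !ehat0 e_tot_cons; congr (_ + _)%N.
by apply: eq_bigr => i _; rewrite /= !ehat_cons.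
Qed.

Lemma iota1S n : iota 1 n.+1 = 1%N :: map succn (iota 1 n).
Proof. by rewrite /= -(eq_map (add1n)) -iotaDl. Qed.

Lemma char_exps_listE ds : pos_data ds -> char_exps_list ds = e_tot ds :: char_exps_rec ds.
Proof.
rewrite /char_exps_list => pos; congr (_ :: _).
elim: ds pos => [|[[[q m] l] N] r IH] //= /andP[/andP[q0 _] /IH{}IH].
rewrite -IH /g_ -[iota 2 _]/(behead (iota 1 (size r).+1)) iota1S /=.
have E : [seq B_ ((q, m, l, N) :: r) k | k <- map succn (iota 1 (size r)) & (1 < q_ ((q, m, l, N) :: r) k)%N]
   = [seq (m * e_tot r + i)%N | i <- [seq B_ r k | k <- iota 1 (size r) & (1 < q_ r k)%N]].
  rewrite filter_map -!map_comp (eq_in_filter (a2 := fun k => (1 < q_ r k)%N)).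
    by apply: eq_map => k /=; rewrite B_cons.
  by move=> [|k] //; rewrite mem_iota.
rewrite {1}/q_ /=; case: ifP => _ /=; rewrite E // B_cons //=.
by rewrite /B_ big_ord0 addn0.
Qed.

Lemma inter_listE ds : pos_data ds -> inter_list ds = inter_rec ds.
Proof.
rewrite /inter_list; elim: ds => [|[[[q m] l] N] r IH] //= /andP[/andP[q0 l0] /IH{}IH].
rewrite -IH /g_ -[iota 2 _]/(behead (iota 1 (size r).+1)) iota1S /=.
set ds := (q, m, l, N) :: r.
have E : [seq nseq (fhat ds k.-1 - fhat ds k) (M_ ds k) | k <- map succn (iota 1 (size r)) & (1 < l_ ds k)%N]
   = [seq map (addn (m * (q * e_tot r) * e_tot r)) u | u <- 
       [seq nseq (fhat r k.-1 - fhat r k) (M_ r k) | k <- iota 1 (size r) & (1 < l_ r k)%N]].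
  rewrite filter_map -!map_comp (eq_in_filter (a2 := fun k => (1 < l_ r k)%N)); last first.
    by move=> [|k] //; rewrite mem_iota.
  apply/eq_in_map => -[|k]; rewrite mem_filter mem_iota ?andbF // => _ /=.
  by rewrite map_nseq M_cons // !fhat_cons.
have -> : l_ ds 1 = l by [].
have M1 : M_ ds 1 = (m * (q * e_tot r) * e_tot r)%N by rewrite M_cons //= /M_ big_ord0 addn0.
case: ltnP => hl /=; rewrite E map_flatten.
  by rewrite M1 fhat_cons // !fhat0 f_tot_cons.
have -> : l = 1%N by apply/eqP; rewrite eqn_leq hl.
by rewrite mul1n subnn.
Qed.

End DataRec.

Section CharExps.
Variable L : nmodType.
Implicit Types (a : nat -> L) (bs : seq nat).

(** The running gcd is an argument, so that the exponents of a branch and of the branch one step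
    below can be compared from the same gcd on. *)
Fixpoint char_exps_from (g : nat) a bs : Prop :=
  if bs is b :: bs' then
    [/\ a b != 0, ~~ (g %| b)%N, forall i, (i < b)%N -> a i != 0 -> (g %| i)%N
      & char_exps_from (gcdn g b) a bs']
  else g = 1%N.

Lemma char_exps_fromP g a bs : char_exps_from g a bs <->
  (forall k, (k < size bs)%N -> let gk := foldl gcdn g (take k bs) in
     let b := nth 0%N bs k in
     [/\ a b != 0, ~~ (gk %| b)%N & forall i, (i < b)%N -> a i != 0 -> (gk %| i)%N])
  /\ foldl gcdn g bs = 1%N.
Proof.
elim: bs g => [|b bs IH] g /=; first by split=> [->|[]].
split=> [[h1 h2 h3 /IH[h4 h5]]|[h1 h2]].
  by split=> // -[|k] //= /h4.
have [h3 h4 h5] := h1 0%N isT; split=> //; apply/IH; split=> // k; exact: (h1 k.+1).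
Qed.

Definition first_not_div (dd n : nat) a : Prop :=
  [/\ a n != 0, ~~ (dd %| n)%N & forall i, (i < n)%N -> a i != 0 -> (dd %| i)%N].

Lemma first_not_div_uniq dd n1 n2 a : first_not_div dd n1 a -> first_not_div dd n2 a -> n1 = n2.
Proof.
move=> [a1 d1 h1] [a2 d2 h2]; case: (ltngtP n1 n2) => // h.
  by rewrite (h2 _ h a1) in d1.
by rewrite (h1 _ h a2) in d2.
Qed.

(** As long as dd divides the characteristic exponents met, it divides the running gcd, hence every
    exponent of the support before the next one. So the first exponent outside the multiples of dd
    is a characteristic one. *)
Lemma char_exps_first g dd a bs : char_exps_from g a bs -> (dd %| g)%N -> dd != 1%N ->
  has (fun b => ~~ (dd %| b)%N) bs /\
  first_not_div dd (nth 0%N bs (find (fun b => ~~ (dd %| b)%N) bs)) a.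
Proof.
elim: bs g => [|b bs IH] g /=; first by move=> ->; rewrite dvdn1 => /eqP -> /eqP.
case=> ab gb hb /IH{}IH ddg dd1; case: (boolP (dd %| b)%N) => hd /=.
  by apply: IH => //; rewrite dvdn_gcd ddg.
by split=> //; split=> // i ib ai; apply: dvdn_trans ddg (hb i ib ai).
Qed.

End CharExps.

Lemma is_char_expsP (L : fieldType) e (a : nat -> L) bs :
  is_char_exps e a (e :: bs) <-> char_exps_from e a bs.
Proof.
split=> [[bs' [[<-] h1 h2]]|/char_exps_fromP[h1 h2]].
  apply/char_exps_fromP; split=> [k /h1|]; first by rewrite /= gcd0n.
  by move: h2; rewrite /= gcd0n.
exists bs; split=> // [k /h1|]; first by rewrite /= gcd0n.
by rewrite /= gcd0n.
Qed.

(** * From a run to branches *)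

Lemma size_monic_exp (A : nzRingType) (p : {poly A}) n : p \is monic ->
  size (p ^+ n) = ((size p).-1 * n).+1.
Proof.
move=> mp; elim: n => [|n IH]; first by rewrite expr0 size_poly1 muln0.
have sp : (0 < size p)%N by rewrite size_poly_gt0 monic_neq0.
rewrite exprSr size_monicM ?monic_exp ?monic_neq0 // IH mulnS; lia.
Qed.

Section EdgePoly.
Variable A : comNzRingType.
Implicit Types (P : {poly A}) (H : {poly fps A}).

Lemma edge_poly_monic P q m : (0 < q)%N -> P \is monic ->
  edge_poly P q m \is monic /\ size (edge_poly P q m) = (q * (size P).-1).+1.
Proof.
move=> q0 mP; rewrite /edge_poly.
have -> : size P = (size P).-1.+1 by rewrite prednK // size_poly_gt0 monic_neq0.
rewrite big_ord_recr /= subnn muln0 expr0 mulr1 -lead_coefE (monicP mP) rmorph1 mul1r.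
set r := \sum_(_ < _) _; set n := (q * _)%N.
have lt : (size r < size ('X^n : {poly fps A}))%N.
  rewrite size_polyXn ltnS; apply: leq_trans (size_sum _ _ _) _.
  apply/bigmax_leqP => -[k hk] _ /=; rewrite mul_polyC.
  apply: leq_trans (size_scale_leq _ _) _; rewrite size_polyXn.
  by rewrite ltn_pmul2l.
by rewrite monicE addrC lead_coefDl // lead_coefXn eqxx size_polyDl // size_polyXn.
Qed.

Lemma boundary_poly_size H q m : (0 < q)%N -> H \is monic -> size (boundary_poly H q m) = size H.
Proof.
move=> q0 mH; rewrite /boundary_poly.
have sH : (size H).-1.+1 = size H by rewrite prednK // size_poly_gt0 monic_neq0.
rewrite -[RHS]sH; apply: size_poly_eq; apply: (@fps_nz _ _ 0).
by rewrite fcoefE muln0 add0n mulnC eqxx -lead_coefE (monicP mH) fcoef1 oner_neq0.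
Qed.

Lemma pseudo_degenerated_size H q m P N' : H \is monic -> pseudo_degenerated H q m P N' ->
  (0 < q)%N /\ (size H).-1 = (q * (size P).-1 * N')%N.
Proof.
move=> mH [[q0 _] mP _ _ E]; split=> //.
have [mE sE] := edge_poly_monic m q0 mP.
by rewrite -(boundary_poly_size m q0 mH) E size_monic_exp // sE.
Qed.

End EdgePoly.

Lemma closed_nth_root (L : closedFieldType) (x : L) n : (0 < n)%N -> exists y, y ^+ n = x.
Proof.
move=> n0; have /closed_rootP[y] : size ('X^n - x%:P : {poly L}) != 1%N.
  by rewrite size_XnsubC // eqSS -lt0n.
by rewrite rootE !hornerE subr_eq0 => /eqP <-; exists y.
Qed.

(** The intersection multiplicity of the branches of s and t. The valuation in T of their resultant
    is a sum over all pairs of conjugates, in which each of the e conjugates of s contributes this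
    amount; dividing by e gives the valuation in x. *)
Definition conj_contact (L : comNzRingType) e (w : L) (s t : fps L) : nat :=
  (\sum_(i < e) fps_val (s - fscale (w ^+ i) t)%R)%N.

(* Rep contains one Puiseux series per branch, the others being its conjugates. *)
Definition branches (L : comNzRingType) e (w : L) (H : {poly fps L}) (bs ks : seq nat)
    (Rep : seq (fps L)) : Prop :=
  [/\ uniq Rep, {in Rep, forall s, root H s},
      {in Rep &, forall s t i, s = fscale (w ^+ i) t -> s = t /\ (e %| i)%N},
      {in Rep, forall s, char_exps_from e (fcoef s) bs}
    & {in Rep, forall s, perm_eq [seq conj_contact e w s t | t <- Rep & t != s] ks}].

Lemma sumn_dvdn q n (g : nat -> nat) : (0 < q)%N ->
  (\sum_(i < q * n | q %| i) g i = \sum_(k < n) g (q * k))%N.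
Proof.
move=> q0; have := sum_dvdn n g q0.
rewrite !big_ord_recr /= big_mkcond /= big_ord_recr /= dvdn_mulr // -big_mkcond /=.
exact: addIn.
Qed.

(** Only exponents not divisible by g matter. Multiplying by T^m0 with g dividing m0, or altering
    terms whose exponent is divisible by g, therefore does no more than shift the list. *)
Lemma char_exps_shift (L : nmodType) g m0 (a a' : nat -> L) bs :
  (g %| m0)%N -> (forall i, (i < m0)%N -> a i = 0) ->
  (forall j, ~~ (g %| j)%N -> (a (m0 + j)%N != 0) = (a' j != 0)) ->
  char_exps_from g a' bs -> char_exps_from g a (map (addn m0) bs).
Proof.
move=> gm lo; elim: bs g gm => [|b bs IH] g gm hi //= [h1 h2 h3 h4]; split.
- by rewrite hi.
- by rewrite dvdn_addr.
- move=> i ib; case: (ltnP i m0) => [/lo ->|le]; first by rewrite eqxx.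
  have -> : i = (m0 + (i - m0))%N by rewrite subnKC.
  rewrite dvdn_addr //; case: (boolP (g %| i - m0)%N) => // ndv.
  by rewrite hi // => h; case/negP: ndv; apply: (h3 _ _ h); rewrite ltn_subLR.
have -> : gcdn g (m0 + b) = gcdn g b by case/dvdnP: gm => c ->; rewrite gcdnMDl.
apply: IH => //; first exact: dvdn_trans (dvdn_gcdl _ _) gm.
by move=> j ndv; apply: hi; apply: contra ndv; apply: dvdn_trans (dvdn_gcdl _ _).
Qed.

(** If q = 1, the bound t < q forces t = 0, so the power of rho is 1 even when rho = 0. *)
Lemma bezout_root_neq0 (L : fieldType) (rho lam : L) q t n : (0 < n)%N -> (t < q)%N ->
  lam ^+ n = rho ^+ t -> ((1 < q)%N -> rho != 0) -> lam != 0.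
Proof.
move=> n0 ltq hlam hrho; have : rho ^+ t != 0.
  by case: t ltq {hlam} => [|t'] h; rewrite ?expr0 ?oner_neq0 // expf_neq0 // hrho //; lia.
by apply: contra_neq => lam0; rewrite -hlam lam0 expr0n gtn_eqF.
Qed.

Section Lift.
Variables (L : fieldType) (q m e' : nat) (w rho lam : L) (s t : nat) (c' : fps L).
Hypotheses (q0 : (0 < q)%N) (e'0 : (0 < e')%N) (cop : coprime q m).
Hypotheses (prw : (q * e').-primitive_root w) (bez : (q * s = m * t + 1)%N) (ltq : (t < q)%N).
Hypotheses (hlam : lam ^+ (q * e') = rho ^+ t) (hrho : (1 < q)%N -> rho != 0).
Hypothesis (hc' : forall n, ~~ (e' %| n)%N -> fcoef c' n = 0).

(* The root of H_k above a root r of H_{k+1}: in x = rho^t T^e, y = T^(m e') (r - c' + rho^s), the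
   parameter is rescaled by lam so that x becomes T^e. *)
Definition lift_branch (r : fps L) : fps L :=
  fscale lam^-1 (fpsX ^+ (m * e') * (r - c' + fpsC (rho ^+ s))).

Let lam0 : lam != 0.
Proof. by apply: (bezout_root_neq0 _ ltq hlam hrho); rewrite muln_gt0 q0. Qed.

Lemma fcoef_lift r n : fcoef (lift_branch r) n =
  (if (n < m * e')%N then 0 else fcoef (r - c') (n - m * e') +
    (if (n - m * e' == 0)%N then rho ^+ s else 0)) * lam^-1 ^+ n.
Proof. by rewrite fcoef_scale fcoef_Xn_mul. Qed.

Lemma lift_low r i : (i < m * e')%N -> fcoef (lift_branch r) i = 0.
Proof. by move=> h; rewrite fcoef_lift h mul0r. Qed.

Lemma lift_lead r : fcoef (r - c') 0 = 0 ->
  fcoef (lift_branch r) (m * e') = rho ^+ s * lam^-1 ^+ (m * e').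
Proof. by move=> h; rewrite fcoef_lift ltnn subnn h add0r. Qed.

(** Bezout: the q-th power is rho^(q s) / rho^(m t) = rho. The leading coefficient of a lifted
    branch thus remembers the root of P it lies over. *)
Lemma lift_lead_pow r : fcoef (r - c') 0 = 0 -> fcoef (lift_branch r) (m * e') ^+ q = rho.
Proof.
have nz : rho ^+ t ^+ m != 0 by rewrite -hlam expf_neq0 ?expf_neq0.
have E : rho ^+ (s * q) = rho ^+ t ^+ m * rho by rewrite mulnC bez addn1 exprSr mulnC exprM.
move=> /lift_lead ->; rewrite exprMn -!exprM E exprVn.
have -> : (m * e' * q = (q * e') * m)%N by lia.
by rewrite (exprM lam) hlam mulrAC mulfV ?mul1r.
Qed.

Lemma fscale_c' k : fscale ((w ^+ q) ^+ k) c' = c'.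
Proof.
apply: fps_ext => n; rewrite fcoef_scale.
case: (boolP (e' %| n)%N) => [/dvdnP[j ->]|/hc' ->]; last by rewrite mul0r.
have -> : ((w ^+ q) ^+ k) ^+ (j * e') = (w ^+ (q * e')) ^+ (k * j).
  by rewrite -!exprM; congr (_ ^+ _); lia.
by rewrite (prim_expr_order prw) expr1n mulr1.
Qed.

(** The conjugation by w^(q k) fixes T^(m e'), c' and constants, so on lifted roots it induces the
    conjugation by (w^q)^k of the roots below. *)
Lemma lift_diff r1 r2 k :
  lift_branch r1 - fscale (w ^+ (q * k)) (lift_branch r2)
    = fscale lam^-1 (fpsX ^+ (m * e') * (r1 - fscale ((w ^+ q) ^+ k) r2)).
Proof.
rewrite /lift_branch fscale_comp [w ^+ _ * _]mulrC -fscale_comp -rmorphB; congr (fsub _ _ _ _).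
rewrite [fscale (w ^+ (q * k)) _]rmorphM rmorphXn /= fsubX // expr1 exprMn -rmorphXn /=.
have -> : (w ^+ (q * k)) ^+ (m * e') = 1.
  have -> : (w ^+ (q * k)) ^+ (m * e') = (w ^+ (q * e')) ^+ (k * m).
    by rewrite -!exprM; congr (_ ^+ _); lia.
  by rewrite (prim_expr_order prw) expr1n.
rewrite rmorph1 mul1r -mulrBr; congr (_ * _).
by rewrite exprM rmorphD rmorphB /= fsubC fscale_c' /=; ring.
Qed.

(** For q > 1, equal leading coefficients force w^(i m e') = 1, so q divides i m, and q is coprime
    to m. *)
Lemma lift_dvd r1 r2 i : fcoef (r1 - c') 0 = 0 -> fcoef (r2 - c') 0 = 0 ->
  fcoef (lift_branch r1) (m * e') = fcoef (fscale (w ^+ i) (lift_branch r2)) (m * e') ->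
  (q %| i)%N.
Proof.
move=> h1 h2; rewrite fcoef_scale !lift_lead //.
move: (hrho); case: (ltngtP q 1) q0 => [|q1 _ /(_ isT) nrho|-> _ _ _]; [lia| |exact: dvd1n].
have nz : rho ^+ s * lam^-1 ^+ (m * e') != 0 by rewrite mulf_neq0 ?expf_neq0 ?invr_neq0.
rewrite -[LHS]mulr1 => /(mulfI nz) /esym/eqP.
rewrite -exprM -(prim_order_dvd prw) mulnA dvdn_pmul2r //.
by rewrite Gauss_dvdl.
Qed.

Lemma lift_val r1 r2 i : fcoef (r1 - c') 0 = 0 -> fcoef (r2 - c') 0 = 0 ->
  (forall k, r1 != fscale ((w ^+ q) ^+ k) r2) ->
  fps_val (lift_branch r1 - fscale (w ^+ i) (lift_branch r2)) =
  (m * e' + (if (q %| i) then fps_val (r1 - fscale ((w ^+ q) ^+ (i %/ q)) r2)%R else 0))%N.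
Proof.
move=> h1 h2 ne; case: (boolP (q %| i)%N) => [/dvdnP[k ->]|ndv].
  rewrite mulnK // [(k * q)%N]mulnC lift_diff fps_val_scale ?invr_neq0 // fps_val_Xn //.
  by rewrite subr_eq0 ne.
rewrite addn0; apply: fps_val_eq => [j hj|].
  by rewrite fcoefB fcoef_scale !lift_low // mul0r subrr.
by rewrite fcoefB subr_eq0; apply: contra ndv => /eqP; apply: lift_dvd.
Qed.

Lemma branches_lift (H' He : {poly fps L}) bs ks Rep :
  branches e' (w ^+ q) H' bs ks Rep ->
  {in Rep, forall r, fcoef (r - c') 0 = 0} ->
  {in Rep, forall r, root He (lift_branch r)} ->
  branches (q * e') w He ((if (1 < q)%N then [:: (m * e')%N] else [::]) ++ map (addn (m * e')) bs)
    (map (addn (m * (q * e') * e')) ks) (map lift_branch Rep).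
Proof.
move=> [uR _ sep cexp hk] h0 hroot.
have sep' : {in Rep &, forall r1 r2 i, lift_branch r1 = fscale (w ^+ i) (lift_branch r2) ->
    r1 = r2 /\ (q * e' %| i)%N}.
  move=> r1 r2 R1 R2 i E.
  have /dvdnP[k ik] : (q %| i)%N by apply: (@lift_dvd r1 r2); rewrite ?h0 // -E.
  have : fscale lam^-1 (fpsX ^+ (m * e') * (r1 - fscale ((w ^+ q) ^+ k) r2)) = 0.
    by rewrite -lift_diff mulnC -ik E subrr.
  have inj : injective (fscale lam^-1) by apply: fsub_inj; rewrite ?invr_neq0.
  rewrite -(rmorph0 (fscale lam^-1)) => /inj; rewrite -(mulr0 (fpsX ^+ (m * e'))) => /fpsXn_inj.
  move=> /eqP; rewrite subr_eq0 => /eqP /(sep _ _ R1 R2)[-> dv].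
  by split=> //; rewrite ik [(k * q)%N]mulnC dvdn_pmul2l.
have injR : {in Rep &, injective lift_branch}.
  by move=> r1 r2 R1 R2 E; have [] := sep' r1 r2 R1 R2 0%N _; rewrite ?expr0 ?fscale1.
split.
- by rewrite map_inj_in_uniq.
- by move=> _ /mapP[r Rr ->]; apply: hroot.
- by move=> _ _ /mapP[r1 R1 ->] /mapP[r2 R2 ->] i /(sep' _ _ R1 R2)[-> ].
- move=> _ /mapP[r Rr ->].
  (* Starting from the gcd e', the lift merely shifts the exponents: c' and the constant rho^s only
     touch multiples of e'. *)
  have E : char_exps_from e' (fcoef (lift_branch r)) (map (addn (m * e')) bs).
    apply: char_exps_shift (cexp r Rr); first exact: dvdn_mull.
      exact: lift_low.
    move=> j ndv; rewrite fcoef_lift ifF ?(ltnNge, leq_addr) // addKn fcoefB (hc' ndv) subr0.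
    rewrite ifF ?addr0; last by case: j ndv => //; rewrite dvdn0.
    by rewrite mulf_eq0 expf_eq0 invr_eq0 (negPf lam0) andbF orbF.
  case: ltnP => hq /=; last first.
    by have -> : (q * e')%N = e' by rewrite (_ : q = 1%N) ?mul1n //; lia.
  (* For q > 1 the exponent m e' comes first and brings the gcd from q e' down to e'. *)
  have gcdE : gcdn (q * e') (m * e') = e' by rewrite -muln_gcdl (eqP cop) mul1n.
  split; rewrite ?gcdE //.
  + have := lift_lead_pow (h0 r Rr); apply: contra_eq_neq => ->.
    by rewrite expr0n gtn_eqF // eq_sym hrho.
  + rewrite dvdn_pmul2r //; apply/negP => qm; move: cop; rewrite /coprime.
    by rewrite (gcdn_idPl qm) => /eqP q1; rewrite q1 in hq.
  + by move=> i /lift_low ->; rewrite eqxx.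
move=> _ /mapP[r Rr ->].
have -> : [seq conj_contact (q * e') w (lift_branch r) u | u <- map lift_branch Rep & u != lift_branch r]
   = map (addn (m * (q * e') * e')) [seq conj_contact e' (w ^+ q) r u | u <- Rep & u != r].
  rewrite filter_map -!map_comp.
  have -> : [seq x <- Rep | preim lift_branch (fun u => u != lift_branch r) x] = [seq x <- Rep | x != r].
    by apply: eq_in_filter => u Ru /=; rewrite (inj_in_eq injR).
  apply/eq_in_map => u; rewrite mem_filter => /andP[ur Ru] /=.
  rewrite /conj_contact; have E i : fps_val (lift_branch r - fscale (w ^+ i) (lift_branch u)) =
      (m * e' + (if (q %| i) then fps_val (r - fscale ((w ^+ q) ^+ (i %/ q)) u)%R else 0))%N.
    rewrite lift_val ?h0 // => k; apply: contra_neq ur => /(sep _ _ Rr Ru)[] //.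
  under eq_bigr => i _ do rewrite E.
  (* Each of the q e' distances contains m e'; only the indices divisible by q add a distance
     between roots below. *)
  rewrite big_split /= sum_nat_const card_ord -big_mkcond /=.
  rewrite (sumn_dvdn e' (fun i => fps_val (r - fscale ((w ^+ q) ^+ (i %/ q)) u)) q0).
  congr (_ + _)%N; first by lia.
  by apply: eq_bigr => k _; rewrite mulKn.
by apply: perm_map; apply: hk.
Qed.

End Lift.

Lemma uniq_flatten_map (T S : eqType) (rs : seq S) (RS : S -> seq T) :
  uniq rs -> {in rs, forall x, uniq (RS x)} ->
  {in rs &, forall x y t, t \in RS x -> t \in RS y -> x = y} -> uniq (flatten (map RS rs)).
Proof.
elim: rs => //= x rs IH /andP[nx ur] h1 h2; rewrite cat_uniq h1 ?mem_head //=.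
have sub y : y \in rs -> y \in x :: rs by move=> yr; rewrite inE yr orbT.
rewrite IH // => [|y /sub|y y' /sub yr /sub]; [|exact: h1|exact: h2].
rewrite andbT; apply/hasPn => t /flatten_mapP[y yr ty]; apply/negP => tx.
by move: nx; rewrite (h2 x y _ _ t tx ty) ?mem_head ?sub // yr.
Qed.

(** Since e divides m0 q, conjugation does not change the q-th power of the coefficient of T^m0. For
    branches over distinct x and y these powers differ, so all their conjugates are at distance
    exactly m0 and the contact is e m0. *)
Lemma branches_glue (L : fieldType) e (w : L) (He : {poly fps L}) bs ks q m0 f' (rs : seq L)
    (RS : L -> seq (fps L)) :
  e.-primitive_root w -> (e %| m0 * q)%N -> uniq rs ->
  {in rs, forall x, [/\ size (RS x) = f', branches e w He bs ks (RS x) &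
     {in RS x, forall r, (forall i, (i < m0)%N -> fcoef r i = 0) /\ fcoef r m0 ^+ q = x}]} ->
  size (flatten (map RS rs)) = (size rs * f')%N /\
  branches e w He bs (nseq (size rs * f' - f') (e * m0)%N ++ ks) (flatten (map RS rs)).
Proof.
move=> prw em ur hRS.
have sz (rs' : seq L) : {subset rs' <= rs} -> size (flatten (map RS rs')) = (size rs' * f')%N.
  move=> sub; rewrite size_flatten /shape -map_comp.
  elim: rs' sub => //= x rs' IH sub; have [-> _ _] := hRS x (sub x (mem_head _ _)).
  by rewrite mulSn IH // => y yr; apply: sub; rewrite inE yr orbT.
have cross x y r u i : x \in rs -> y \in rs -> r \in RS x -> u \in RS y -> x != y ->
    r != fscale (w ^+ i) u /\ fps_val (r - fscale (w ^+ i) u) = m0.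
  move=> xr yr rx uy xy.
  have [_ _ /(_ _ rx) [lr cr]] := hRS x xr; have [_ _ /(_ _ uy) [lu cu]] := hRS y yr.
  have ne : fcoef r m0 != fcoef (fscale (w ^+ i) u) m0.
    apply: contra_neq xy => E; rewrite -cr E fcoef_scale exprMn cu.
    case/dvdnP: em => k Ek; rewrite -!exprM ?mulnA -?mulnA Ek mulnA mulnC exprM (prim_expr_order prw).
    by rewrite expr1n mulr1.
  split; first by apply: contra_neq ne => ->.
  apply: fps_val_eq => [j hj|]; first by rewrite fcoefB fcoef_scale lr // lu // mul0r subrr.
  by rewrite fcoefB subr_eq0.
split; first exact: sz.
split.
- apply: uniq_flatten_map => // [x xr|x y xr yr t tx ty]; first by have [_ []] := hRS x xr.
  have [_ _ /(_ _ tx)[_ <-]] := hRS x xr.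
  by have [_ _ /(_ _ ty)[_ <-]] := hRS y yr.
- by move=> s /flatten_mapP[x xr sx]; have [_ [_ h _ _ _] _] := hRS x xr; apply: h.
- move=> s t /flatten_mapP[x xr sx] /flatten_mapP[y yr ty] i E.
  case: (eqVneq x y) => [xy|/(cross _ _ _ _ i xr yr sx ty)[]]; last by rewrite -E eqxx.
  by subst y; have [_ [_ _ h _ _] _] := hRS x xr; apply: h.
- by move=> s /flatten_mapP[x xr sx]; have [_ [_ _ _ h _] _] := hRS x xr; apply: h.
move=> s /flatten_mapP[x xr sx].
have pm : perm_eq (flatten (map RS rs)) (RS x ++ flatten (map RS (rem x rs))).
  by apply/(perm_flatten (ss2 := map RS (x :: rem x rs)))/perm_map/perm_to_rem.
apply: perm_trans (perm_map _ (perm_filter _ pm)) _.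
rewrite filter_cat map_cat perm_catC; apply: perm_cat; last first.
  by have [_ [_ _ _ _ h] _] := hRS x xr; apply: h.
have sub : {subset rem x rs <= rs} by apply: mem_rem.
have ncross t : t \in flatten (map RS (rem x rs)) ->
    t != s /\ conj_contact e w s t = (e * m0)%N.
  case/flatten_mapP => y yr ty.
  have xy : x != y by apply: contraTneq yr => <-; rewrite mem_rem_uniqF.
  split.
    have [h _] := cross x y s t 0%N xr (sub y yr) sx ty xy.
    by move: h; rewrite expr0 fscale1 eq_sym.
  rewrite /conj_contact (eq_bigr (fun=> m0)); first by rewrite sum_nat_const card_ord.
  by move=> i _; case: (cross x y s t i xr (sub y yr) sx ty xy).
have -> : [seq t <- flatten (map RS (rem x rs)) | t != s] = flatten (map RS (rem x rs)).
  by apply/all_filterP/allP => t /ncross[].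
have -> : (size rs * f' - f' = size [seq conj_contact e w s t | t <- flatten (map RS (rem x rs))])%N.
  rewrite size_map sz // size_rem //.
  by case: (size rs) => [|n] //=; rewrite mulSn addKn.
rewrite (_ : map _ _ = nseq (size (map (conj_contact e w s) (flatten (map RS (rem x rs))))) (e * m0)%N) ?size_nseq //.
by apply/all_pred1P/allP => _ /mapP[t /ncross[_ ->] ->] /=.
Qed.

(** Evaluating the identity at a root of G gives a root of H for x = (lam T)^(q e'); rescaling T by
    il, the inverse of lam, restores x = T^(q e'). *)
Lemma step_root (A A' L : comNzRingType) (iota : {rmorphism A -> A'}) (phi : {rmorphism A' -> L})
    (z : A') (H : {poly fps A}) (U G : {poly fps A'}) q m s t a e' (lam il : L) (r : fps L) :
  (0 < q)%N -> (0 < e')%N ->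
  (map_poly (fsub iota (z ^+ t) q) H) \Po ((fpsX ^+ m)%:P * ('X + (fpsC (z ^+ s))%:P))
    = (fpsX ^+ a)%:P * U * G ->
  il * lam = 1 -> lam ^+ (q * e') = phi z ^+ t ->
  root (map_poly (fsub phi 1 e') G) r ->
  root (map_poly (fsub (phi \o iota) 1 (q * e')) H)
    (fscale il (fpsX ^+ (m * e') * (r + fpsC (phi z ^+ s)))).
Proof.
move=> q0 e0 E ill hlam /rootP rG.
have := congr1 (fun p => (map_poly (fsub phi 1 e') p).[r]) E.
rewrite [map_poly _ (_ * G)]rmorphM hornerM rG mulr0 map_comp_poly horner_comp.
rewrite map_fsub_comp // expr1n mulr1.
rewrite rmorphM rmorphD /= map_polyX !map_polyC /= hornerM hornerD hornerX !hornerC.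
rewrite fsubC (rmorphXn (fsub phi 1 e')) /= fsubX // rmorph1 mul1r -exprM !(rmorphXn phi) /= -hlam [(e' * m)%N]mulnC => /rootP.
move=> /(rmorph_root (fscale il)); rewrite map_fscale_fsub ?muln_gt0 ?q0 //.
by rewrite -exprMn [lam * il]mulrC ill expr1n.
Qed.

Lemma weierstrass_root0 (A L : comNzRingType) (phi : {rmorphism A -> L}) (G : {poly fps A}) N e
    (r : fps L) : weierstrass G N -> (0 < e)%N -> root (map_poly (fsub phi 1 e) G) r ->
  fcoef r 0 ^+ N = 0.
Proof.
move=> [mG sG G0] e0 /(rmorph_root (@ev0 L)); rewrite -map_poly_comp => /rootP.
have -> : map_poly (@ev0 L \o fsub phi 1 e) G = 'X^N.
  apply/polyP => i; rewrite coef_map coefXn /= /ev0 fcoef_fsub // dvdn0 div0n expr0 mulr1.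
  case: (ltngtP i N) => [/G0 ->|h|->]; first by rewrite rmorph0.
    by rewrite nth_default ?sG // fcoef0 rmorph0.
  have -> : N = (size G).-1 by rewrite sG.
  by rewrite -lead_coefE (monicP mG) fcoef1 rmorph1.
by rewrite hornerXn.
Qed.

Lemma root_tschirnhausen (K : fieldType) (A L : comNzRingType) (kappa : K -> A)
    (phi : {rmorphism A -> L}) e (G : {poly fps A}) r :
  root (map_poly (fsub phi 1 e) (tschirnhausen kappa G)) r =
  root (map_poly (fsub phi 1 e) G) (r - tsch_shift kappa phi e G).
Proof. by rewrite map_tschirnhausen /root horner_comp !hornerE. Qed.

Lemma tsch_shift_coef (K : fieldType) (A L : comNzRingType) (kappa : K -> A)
    (phi : {rmorphism A -> L}) e (G : {poly fps A}) n : (0 < e)%N -> ~~ (e %| n)%N ->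
  fcoef (tsch_shift kappa phi e G) n = 0.
Proof. by move=> e0 ndv; rewrite fcoef_fsub // (negPf ndv). Qed.

(** phi is quantified inside the induction, because the roots of P under one phi require as many
    different morphisms on the next ring. *)
Lemma run_branches (K : fieldType) (L : closedFieldType) (iotaL : {rmorphism K -> L}) :
  algebraic_over iotaL ->
  forall (A : comNzRingType) (kappa : K -> A) (H : {poly fps A}) ds Ng,
  pi_run kappa H ds Ng -> Ng = 1%N ->
  (forall n, (0 < n < size H)%N -> n%:R != 0 :> L) -> H \is monic -> (1 < size H)%N ->
  forall phi : {rmorphism A -> L}, (forall x, phi (kappa x) = iotaL x) ->
  [/\ pos_data ds, size H = (e_tot ds * f_tot ds).+1 &
    forall w, (e_tot ds).-primitive_root w -> exists Rep, size Rep = f_tot ds /\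
      branches (e_tot ds) w (map_poly (fsub phi 1 (e_tot ds)) H) (char_exps_rec ds) (inter_rec ds) Rep].
Proof.
move=> alg A kappa H ds Ng; elim=> {A kappa H ds Ng}.
- move=> A kappa H sH _ char mH _ phi _; rewrite e_tot_nil f_tot_nil; split=> // w prw.
  set He := map_poly _ _.
  have mHe : He \is monic by apply: monic_map.
  have sHe : size He = 2%N by rewrite size_map_monic.
  have EHe : He = 'X + (He`_0)%:P.
    have h1 : He`_1 = 1 by rewrite -(monicP mHe) lead_coefE sHe.
    apply/polyP => -[|[|i]]; rewrite coefD coefX coefC.
    - by rewrite add0r.
    - by rewrite h1 addr0.
    by rewrite addr0 nth_default ?sHe.
  exists [:: - He`_0]; split=> //; split=> // [r|s t|s].
  + by rewrite inE => /eqP ->; rewrite {1}EHe /root !hornerE addNr.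
  + by rewrite !inE => /eqP -> /eqP -> i _; rewrite dvd1n.
  + by rewrite inE => /eqP -> /=; rewrite eqxx.
(* This rule stops with N_g = deg H, which is 1 only when size H = 2, the case of the other stopping
   rule. *)
- by move=> A kappa H sH _ N1 _ _ s1; move: sH; rewrite -(prednK (ltnW s1)) N1.
move=> A kappa H q m P N' A' iota z s t a U G rest Ng sH pd hq bez ltq eqn _ weier _ IH.
move=> N1 char mH s1 phi hk.
have [q0 sizeN] := pseudo_degenerated_size mH pd.
have [[_ [cop _]] mP sq P0 _] := pd.
have [mG sG G0] := weier.
have sH' : size H = (q * (size P).-1 * N').+1 by rewrite -sizeN prednK // ltnW.
have [l0 N'0] : (0 < (size P).-1 /\ 0 < N')%N.
  by move: s1; rewrite sH' ltnS !muln_gt0 => /andP[/andP[]].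
have sP : (size P).-1.+1 = size P by rewrite prednK // size_poly_gt0 monic_neq0.
set l := (size P).-1 in l0 sP sH' *.
have [mT sT] := tschirnhausen_monic (iota \o kappa) mG.
have charP n : (0 < n < size P)%N -> n%:R != 0 :> L.
  case/andP=> n0; rewrite -sP ltnS => nl; apply: char; rewrite n0 sH' ltnS.
  by rewrite (leq_trans nl) // -mulnA mulnCA leq_pmulr // muln_gt0 q0.
have [rs [urs Ers]] := sqfree_over_roots alg hk charP mP sq.
have srs : size rs = l.
  have := congr1 (fun p : {poly L} => size p) Ers.
  by rewrite size_map_monic // size_prod_XsubC -sP => -[].
have charG n : (0 < n < size (tschirnhausen (iota \o kappa) G))%N -> n%:R != 0 :> L.
  rewrite sT sG ltnS => /andP[n0 nl]; apply: char; rewrite n0 sH' ltnS.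
  by rewrite (leq_trans nl) // leq_pmull // muln_gt0 q0.
have sT1 : (1 < size (tschirnhausen (iota \o kappa) G))%N by rewrite sT sG.
have IHr rho : rho \in rs -> exists phi' : {rmorphism A' -> L},
    [/\ forall x, phi' (iota x) = phi x, phi' z = rho,
      pos_data rest, N' = (e_tot rest * f_tot rest)%N &
    forall w, (e_tot rest).-primitive_root w -> exists Rep, size Rep = f_tot rest /\
      branches (e_tot rest) w (map_poly (fsub phi' 1 (e_tot rest)) (tschirnhausen (iota \o kappa) G))
        (char_exps_rec rest) (inter_rec rest) Rep].
  move=> hr; have hroot : root (map_poly phi P) rho by rewrite Ers root_prod_XsubC.
  have [phi' [h1 h2]] := quotient_morphism mP hq hroot; exists phi'.
  have hk' x : phi' ((iota \o kappa) x) = iotaL x by rewrite /= h1 hk.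
  have [p1 p2 p3] := IH N1 charG mT sT1 phi' hk'.
  by split=> //; move: p2; rewrite sT sG => -[].
(* These facts do not mention rho, so any root of P provides them; there is one because l > 0. *)
have [pos EN'] : pos_data rest /\ N' = (e_tot rest * f_tot rest)%N.
  have hr : nth 0 rs 0 \in rs by rewrite mem_nth // srs.
  by have [phi' []] := IHr _ hr.
have e'0 := e_tot_gt0 pos.
rewrite e_tot_cons f_tot_cons -[_.1.1.1]/q -[_.1.2]/l; split.
- by rewrite /pos_data /= q0 l0.
- by rewrite sH' EN'; congr _.+1; lia.
move=> w prw; set e' := e_tot rest in e'0 EN' IHr prw *.
have prw' : e'.-primitive_root (w ^+ q).
  have := exp_prim_root prw q; rewrite gcdnMr mulKn //.
have /choice[RS hRS] : forall rho, exists RS, rho \in rs ->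
    [/\ size RS = f_tot rest, branches (q * e') w (map_poly (fsub phi 1 (q * e')) H)
        (char_exps_rec ((q, m, l, N') :: rest))
        (map (addn (m * (q * e') * e')) (inter_rec rest)) RS &
     {in RS, forall r, (forall i, (i < m * e')%N -> fcoef r i = 0) /\ fcoef r (m * e') ^+ q = rho}].
  move=> rho; case: (boolP (rho \in rs)) => [hr|]; last by exists [::].
  have [phi' [h1 h2 _ _ /(_ _ prw')[Rep [sR bR]]]] := IHr rho hr.
  have [lam hlam] := closed_nth_root (rho ^+ t) (n := (q * e')%N) ltac:(by rewrite muln_gt0 q0).
  pose c' := tsch_shift (iota \o kappa) phi' e' G.
  have hc' n : ~~ (e' %| n)%N -> fcoef c' n = 0 by apply: tsch_shift_coef.
  have hrho : (1 < q)%N -> rho != 0.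
    move=> /P0[b Eb]; apply: contraTneq hr => ->; rewrite -root_prod_XsubC -Ers.
    rewrite rootE horner_coef0 coef_map; apply: contraTneq isT => h.
    by have := congr1 phi Eb; rewrite rmorphM h mul0r rmorph1 => /eqP; rewrite eq_sym oner_eq0.
  have lam0 : lam != 0 by apply: (bezout_root_neq0 _ ltq hlam hrho); rewrite muln_gt0 q0.
  have hroot r : r \in Rep -> root (map_poly (fsub phi' 1 e') G) (r - c').
    by case: bR => _ h _ _ _ /h; rewrite root_tschirnhausen.
  have h0 : {in Rep, forall r, fcoef (r - c') 0 = 0}.
    by move=> r /hroot /(weierstrass_root0 weier e'0) /eqP; rewrite expf_eq0 => /andP[_ /eqP].
  exists (map (lift_branch m e' rho lam s c') Rep) => _; split.
  + by rewrite size_map.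
  + apply: (branches_lift q0 e'0 cop prw bez ltq hlam hrho hc' bR) => // r Rr.
    have -> : map_poly (fsub phi 1 (q * e')) H = map_poly (fsub (phi' \o iota) 1 (q * e')) H.
      by congr (map_poly (fsub _ _ _) _); apply: funext => x /=.
    rewrite /lift_branch -h2; move: eqn; rewrite fsubE // => eqn.
    by apply: (step_root q0 e'0 eqn (mulVf lam0) _ (hroot _ Rr)); rewrite h2.
  move=> _ /mapP[r Rr ->]; split; first exact: lift_low.
  exact: (lift_lead_pow q0 e'0 cop prw bez ltq hlam hrho (h0 _ Rr)).
have em : (q * e' %| m * e' * q)%N by rewrite -mulnA [(e' * q)%N]mulnC dvdn_mull.
have [sz br] := branches_glue prw em urs hRS.
exists (flatten (map RS rs)); split; first by rewrite sz srs.
move: br; rewrite srs /= -/e'; have -> : (m * (q * e') * e' = q * e' * (m * e'))%N by rewrite -mulnA mulnCA.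
by [].
Qed.

(** * Resultants and irreducible factors *)

Section Resultant.
Variable R : idomainType.

Lemma det_Vandermonde_row_mx m n (b : 'rV[R]_m) (a : 'rV[R]_n) :
  \det (Vandermonde (m + n) (row_mx b a)) =
  \det (Vandermonde m b) * \det (Vandermonde n a) * \prod_(j < m) \prod_(i < n) (a 0 i - b 0 j).
Proof.
rewrite !det_Vandermonde big_split_ord [RHS]mulrAC -big_split /=; congr (_ * _).
  apply: eq_bigr => j _; rewrite big_split_ord /=; congr (_ * _).
    by apply: eq_bigr => i _; rewrite !row_mxEl.
  rewrite big_mkcond /=; apply: eq_bigr => i _.
  by rewrite row_mxEl row_mxEr /= ltn_addr.
apply: eq_bigr => j _; rewrite big_split_ord /= big_pred0 ?mul1r.
  by apply: eq_big => i; rewrite ?ltn_add2l ?row_mxEr.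
by move=> i /=; apply/negbTE; rewrite -leqNgt (leq_trans (ltnW (ltn_ord i))) // leq_addr.
Qed.

Lemma det_Vandermonde_neq0 n (a : 'rV[R]_n) : injective (a 0) -> \det (Vandermonde n a) != 0.
Proof.
move=> inj; rewrite det_Vandermonde; apply/prodf_neq0 => i _; apply/prodf_neq0 => j ij.
rewrite subr_eq0; apply: contraTneq ij => /inj ->; by rewrite ltnn.
Qed.

Lemma Sylvester_Vandermonde (p q : {poly R}) (v : 'rV[R]_((size q).-1 + (size p).-1)) i k :
  p != 0 -> q != 0 ->
  (Sylvester_mx p q *m Vandermonde _ v) i k =
  match split i with inl j => p.[v 0 k] * v 0 k ^+ j | inr j => q.[v 0 k] * v 0 k ^+ j end.
Proof.
rewrite -!size_poly_gt0 => p0 q0.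
rewrite mxE; under eq_bigr do rewrite Sylvester_mxE mxE.
case: splitP => j _.
  rewrite -[v 0 k ^+ j]hornerXn -hornerM (@horner_coef_wide _ ((size q).-1 + (size p).-1)).
    by apply: eq_bigr => l _; rewrite coefMXn; case: ltnP => _; rewrite ?mulr0n ?mulr1n.
  rewrite size_Mmonic ?monicXn -?size_poly_gt0 // size_polyXn addnS /=; have := ltn_ord j; case: (size p) p0 => //= a _ hj; by rewrite addSn addnC ltn_add2r.
rewrite -[v 0 k ^+ j]hornerXn -hornerM (@horner_coef_wide _ ((size q).-1 + (size p).-1)).
  by apply: eq_bigr => l _; rewrite coefMXn; case: ltnP => _; rewrite ?mulr0n ?mulr1n.
rewrite size_Mmonic ?monicXn -?size_poly_gt0 // size_polyXn addnS /=; have := ltn_ord j; case: (size q) q0 => //= a _ hj; by rewrite addSn ltn_add2l.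
Qed.

(** Multiply the Sylvester matrix by the Vandermonde matrix of all the roots. As the roots are
    distinct, the Vandermonde determinants on both sides are non-zero and cancel. *)
Lemma resultant_prod n m (a b : nat -> R) (p q : {poly R}) :
  {in gtn n &, injective a} -> {in gtn m &, injective b} ->
  (forall i j, (i < n)%N -> (j < m)%N -> a i != b j) ->
  p = \prod_(i < n) ('X - (a i)%:P) -> q = \prod_(j < m) ('X - (b j)%:P) ->
  resultant p q = \prod_(j < m) \prod_(i < n) (b j - a i).
Proof.
move=> inja injb ab Ep Eq.
have En : n = (size p).-1 by rewrite Ep size_prod_XsubC /index_enum -enumT size_enum_ord.
have Em : m = (size q).-1 by rewrite Eq size_prod_XsubC /index_enum -enumT size_enum_ord.
have np : p != 0 by rewrite Ep monic_neq0 ?monic_prod_XsubC.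
have nq : q != 0 by rewrite Eq monic_neq0 ?monic_prod_XsubC.
subst n m.
pose av : 'rV[R]_(size p).-1 := \row_i a i; pose bv : 'rV[R]_(size q).-1 := \row_j b j.
pose dp := \row_(j < (size q).-1) p.[b j]; pose dq := \row_(i < (size p).-1) q.[a i].
have pa i : (i < (size p).-1)%N -> p.[a i] = 0.
  by move=> hi; rewrite Ep horner_prod (bigD1 (Ordinal hi)) //= hornerXsubC subrr mul0r.
have qb i : (i < (size q).-1)%N -> q.[b i] = 0.
  by move=> hi; rewrite Eq horner_prod (bigD1 (Ordinal hi)) //= hornerXsubC subrr mul0r.
(* The Sylvester matrix evaluated at all the roots is block diagonal. *)
have SV : Sylvester_mx p q *m Vandermonde _ (row_mx bv av)
    = block_mx (Vandermonde _ bv *m diag_mx dp) 0 0 (Vandermonde _ av *m diag_mx dq).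
  apply/matrixP => i k; rewrite Sylvester_Vandermonde //.
  rewrite -[i]splitK -[k]splitK; case: (split i) => i'; case: (split k) => k'; rewrite unsplitK /=.
  - by rewrite block_mxEul row_mxEl mul_mx_diag !mxE mulrC.
  - by rewrite block_mxEur row_mxEr !mxE pa // mul0r.
  - by rewrite block_mxEdl row_mxEl !mxE qb // mul0r.
  by rewrite block_mxEdr row_mxEr mul_mx_diag !mxE mulrC.
have := congr1 determinant SV; rewrite det_mulmx det_ublock !det_mulmx !det_diag.
rewrite det_Vandermonde_row_mx -/(resultant p q).
have nza : \det (Vandermonde _ av) != 0.
  by apply: det_Vandermonde_neq0 => i j; rewrite !mxE => /inja E; apply/val_inj/E; rewrite !inE ltn_ord.
have nzb : \det (Vandermonde _ bv) != 0.
  by apply: det_Vandermonde_neq0 => i j; rewrite !mxE => /injb E; apply/val_inj/E; rewrite !inE ltn_ord.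
pose X := \prod_(j < (size q).-1) \prod_(i < (size p).-1) (av 0 i - bv 0 j).
rewrite -/X; have nzX : X != 0.
  apply/prodf_neq0 => j _; apply/prodf_neq0 => i _; rewrite !mxE subr_eq0; exact: ab.
have hp x : p.[x] = \prod_(i < (size p).-1) (x - a i).
  by rewrite {1}Ep horner_prod; apply: eq_bigr => i _; rewrite hornerXsubC.
have hq x : q.[x] = \prod_(i < (size q).-1) (x - b i).
  by rewrite {1}Eq horner_prod; apply: eq_bigr => i _; rewrite hornerXsubC.
(* The product of the values of q at the roots of p is the cross factor of the large Vandermonde
   determinant; it cancels too, leaving the values of p at the roots of q. *)
have -> : \prod_i dq 0 i = X.
  rewrite /X exchange_big /=; apply: eq_bigr => i _; rewrite mxE hq.
  by apply: eq_bigr => j _; rewrite !mxE.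
have -> : \prod_j dp 0 j = \prod_(j < (size q).-1) \prod_(i < (size p).-1) (b j - a i).
  by apply: eq_bigr => j _; rewrite mxE hp.
move=> E; apply: (mulIf (mulf_neq0 (mulf_neq0 nzb nza) nzX)); rewrite E.
by rewrite mulrACA mulrCA.
Qed.

End Resultant.

Lemma resultant_map (A B : nzRingType) (f : {rmorphism A -> B}) (p q : {poly A}) :
  f (lead_coef p) != 0 -> f (lead_coef q) != 0 ->
  f (resultant p q) = resultant (map_poly f p) (map_poly f q).
Proof.
move=> nz_fp nz_fq; rewrite /resultant /Sylvester_mx !size_map_poly_id0 //.
rewrite -det_map_mx /= map_col_mx; congr (\det (col_mx _ _));
  by apply: map_lin1_mx => v; rewrite map_poly_rV rmorphM /= map_rVpoly.
Qed.

Lemma sum_periodic e (F : nat -> nat) c : (forall n, F (n + e)%N = F n) ->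
  (\sum_(j < e) F (j + c) = \sum_(j < e) F j)%N.
Proof.
move=> per; elim: c => [|c IH]; first by apply: eq_bigr => j _; rewrite addn0.
rewrite -IH; case: e per {IH} => [|n] per; first by rewrite !big_ord0.
rewrite big_ord_recr [RHS]big_ord_recl [LHS]addnC /= add0n; congr (_ + _)%N.
  by rewrite -[RHS]per; congr F; lia.
by apply: eq_bigr => j _; congr F; rewrite /bump /=; lia.
Qed.

(** * Conjugates under T to w T and descent to x = T^e *)

Section Conjugates.
Variables (L : fieldType) (e : nat) (w : L).
Hypotheses (prw : e.-primitive_root w).
Let e0 : (0 < e)%N := prim_order_gt0 prw.
Let w_neq0 : w != 0.
Proof.
by apply: contra_eq_neq (prim_expr_order prw) => ->; rewrite expr0n gtn_eqF // eq_sym oner_neq0.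
Qed.
Notation pw := (map_poly (fsub idfun 1 e)).
Implicit Types (G H Q : {poly fps L}) (s t : fps L).

Lemma fsub_pow_inj : injective (fsub (idfun : L -> L) 1 e).
Proof. by apply: fsub_inj; rewrite ?oner_neq0. Qed.

Lemma pw_inj : injective (pw : {poly fps L} -> {poly fps L}).
Proof. by apply: map_inj_poly; [apply: fsub_pow_inj | rewrite rmorph0]. Qed.

Lemma conj_pw G k : map_poly (fscale (w ^+ k)) (pw G) = pw G.
Proof. by rewrite map_fscale_fsub // mul1r exprAC (prim_expr_order prw) expr1n. Qed.

(** Invariance under T to w T kills the coefficient of T^n whenever w^n differs from 1, that is,
    unless e divides n. *)
Lemma conj_invariant_pw Q : map_poly (fscale w) Q = Q -> exists G, Q = pw G.
Proof.
move=> hQ; exists (map_poly (fun f : fps L => Fps (fun n => fcoef f (n * e)%N)) Q).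
apply/polyP => i; rewrite coef_map coef_map_id0 /=; last by apply: fps_ext.
apply: fps_ext => n; rewrite fcoef_fsub // fcoefE.
case: (boolP (e %| n)%N) => [dv|ndv]; first by rewrite divnK // expr1n mulr1.
have := congr1 (fun p : {poly fps L} => fcoef p`_i n) hQ; rewrite coef_map /= fcoef_scale => /eqP.
rewrite -{2}[fcoef _ n]mulr1 -subr_eq0 -mulrBr mulf_eq0 => /orP[/eqP //|].
by rewrite subr_eq0 -(prim_order_dvd prw) (negPf ndv).
Qed.

Definition conj_distinct s := forall i, s = fscale (w ^+ i) s -> (e %| i)%N.

Lemma conj_eq s i j : conj_distinct s -> (i < e)%N -> (j < e)%N ->
  fscale (w ^+ i) s = fscale (w ^+ j) s -> i = j.
Proof.
move=> hs; wlog ij : i j / (i <= j)%N.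
  by move=> h ie je E; case/orP: (leq_total i j) => /h; [apply|move=> /(_ je ie (esym E))].
move=> ie je E; have : (e %| j - i)%N.
  apply: hs; have wi : w ^+ i != 0 by rewrite expf_neq0 // w_neq0.
  apply: (fsub_inj (q := 1) (phi := idfun) isT _ wi) => //.
  by rewrite fscale_comp -exprD subnKC.
by move/dvdnP => [[|k] Ek]; lia.
Qed.

Definition conj_seq s := [seq fscale (w ^+ i) s | i <- iota 0 e].

Lemma size_conj_seq s : size (conj_seq s) = e.
Proof. by rewrite size_map size_iota. Qed.

Lemma uniq_conj_seq s : conj_distinct s -> uniq (conj_seq s).
Proof.
move=> hs; rewrite map_inj_in_uniq ?iota_uniq // => i j; rewrite !mem_iota !add0n.
by move=> /= ie je; apply: conj_eq.
Qed.

Lemma root_conj_seq G s : root (pw G) s -> all (root (pw G)) (conj_seq s).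
Proof.
move=> h; apply/allP => _ /mapP[i _ ->].
by have := rmorph_root (fscale (w ^+ i)) h; rewrite conj_pw.
Qed.

Lemma pw_conj_seq G s : G \is monic -> size G = e.+1 -> conj_distinct s -> root (pw G) s ->
  pw G = \prod_(r <- conj_seq s) ('X - r%:P).
Proof.
move=> mG sG hs rs; apply: monic_roots (uniq_conj_seq hs) (root_conj_seq rs) _.
  exact: monic_map.
by rewrite size_map_monic // sG size_conj_seq.
Qed.

(** T to w T permutes the conjugates cyclically, so the product over them descends to a polynomial
    over series in x. *)
Lemma conj_poly_exists s : conj_distinct s ->
  exists G, [/\ G \is monic, size G = e.+1 & pw G = \prod_(r <- conj_seq s) ('X - r%:P)].
Proof.
move=> hs; have [|G EG] := @conj_invariant_pw (\prod_(r <- conj_seq s) ('X - r%:P)).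
  rewrite rmorph_prod /=.
  under eq_bigr => r _ do rewrite rmorphB /= map_polyX map_polyC /=.
  rewrite -(big_map (fscale w) xpredT (fun r => 'X - r%:P)) /=.
  apply: perm_big; rewrite -map_comp /conj_seq.
  have -> : [seq (fscale w \o (fun i => fscale (w ^+ i) s)) i | i <- iota 0 e]
     = [seq fscale (w ^+ i) s | i <- iota 1 e].
    by rewrite (iotaDl 1 0 e) -map_comp; apply: eq_map => i /=; rewrite fscale_comp add1n exprS.
  have -> : iota 1 e = rcons (iota 1 e.-1) e.
    by rewrite -{1}(prednK e0) -(addn1 e.-1) iotaD add1n cats1 prednK.
  have -> : iota 0 e = 0%N :: iota 1 e.-1 by rewrite -{1}(prednK e0).
  by rewrite map_rcons perm_rcons /= (prim_expr_order prw) expr0.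
have lead : forall r : fps L, fsub idfun 1 e r = 1 -> r = 1.
  by move=> r h; apply: fsub_pow_inj; rewrite rmorph1.
have inj0 : forall r : fps L, (fsub idfun 1 e r == 0) = (r == 0).
  by move=> r; rewrite -(inj_eq fsub_pow_inj) rmorph0.
have sG : size G = e.+1.
  rewrite -(size_conj_seq s) -(size_prod_XsubC (conj_seq s) id) EG size_map_poly_id0 // inj0.
  rewrite lead_coef_eq0; apply: contraTneq isT => G0.
  have := monic_prod_XsubC (conj_seq s) xpredT id; rewrite EG G0 rmorph0.
  by move/monic_neq0; rewrite eqxx.
exists G; split=> //; apply/eqP; apply: lead.
have := monic_prod_XsubC (conj_seq s) xpredT id; rewrite EG => /monicP <-.
by rewrite (lead_coef_map_inj fsub_pow_inj) ?rmorph0.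
Qed.

(** All conjugates of s are roots of G, so H divides G once x = T^e. The cofactor is invariant under
    conjugation as well, so the factorization descends to x, where G is irreducible. *)
Lemma irreducible_conj G H s : G \is monic -> irreducible_elt G -> conj_distinct s ->
  root (pw G) s -> H \is monic -> size H = e.+1 -> root (pw H) s -> G = H.
Proof.
move=> mG [_ [_ irr]] hs rG mH sH rH.
have [Q EQ] := roots_factor (uniq_conj_seq hs) (root_conj_seq rG).
rewrite -(pw_conj_seq mH sH hs rH) in EQ.
have [|Q0 EQ0] := @conj_invariant_pw Q.
  have := congr1 (map_poly (fscale w)) EQ; rewrite rmorphM /= -{1 3}[w]expr1 !conj_pw EQ.
  move=> /esym/mulIf; apply; rewrite -(rmorph0 pw) (inj_eq pw_inj); exact: monic_neq0.
have EG : G = Q0 * H by apply: pw_inj; rewrite EQ EQ0 rmorphM.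
have mQ : Q0 \is monic by apply: monic_mul_inv mH _; rewrite -EG.
case: (irr _ _ EG) => [[b /(dvd_unit_monic mQ) E]|[b /(dvd_unit_monic mH) E]].
  by rewrite EG E mul1r.
by have := e0; rewrite -ltnS -sH E size_poly1.
Qed.

Lemma inter_mult_conj G H s t : G \is monic -> H \is monic ->
  pw G = \prod_(r <- conj_seq s) ('X - r%:P) -> pw H = \prod_(r <- conj_seq t) ('X - r%:P) ->
  conj_distinct s -> conj_distinct t -> (forall i, s != fscale (w ^+ i) t) ->
  inter_mult G H = conj_contact e w s t.
Proof.
move=> mG mH EG EH hs ht st.
have st' i j : fscale (w ^+ i) s != fscale (w ^+ j) t.
  apply: contra_neq (st (j + i * e.-1)%N) => E.
  have -> : s = fscale (w ^+ (i * e.-1)) (fscale (w ^+ i) s).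
    rewrite fscale_comp -exprD addnC -mulnS prednK // mulnC exprM (prim_expr_order prw).
    by rewrite expr1n fscale1.
  by rewrite E fscale_comp -exprD addnC.
have tobig (u : fps L) : \prod_(r <- conj_seq u) ('X - r%:P)
    = \prod_(i < e) ('X - (fscale (w ^+ i) u)%:P).
  by rewrite big_map -(big_mkord xpredT (fun i => 'X - (fscale (w ^+ i) u)%:P)) /index_iota subn0.
have injc u : conj_distinct u -> {in gtn e &, injective (fun i => fscale (w ^+ i) u)}.
  by move=> hu i j; rewrite !inE => ie je; apply: conj_eq.
have := resultant_prod (injc _ hs) (injc _ ht) (fun i j _ _ => st' i j).
move=> /(_ (pw G) (pw H)); rewrite -!tobig => /(_ EG EH).
rewrite -resultant_map ?(monicP mG) ?(monicP mH) ?rmorph1 ?oner_neq0 // => /(congr1 (@fps_val _)).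
rewrite fps_val_pow // fps_val_prod => [|j]; last first.
  by apply/prodf_neq0 => i _; rewrite subr_eq0 eq_sym.
under eq_bigr => j _.
  rewrite fps_val_prod; last by move=> i; rewrite subr_eq0 eq_sym.
  over.
rewrite exchange_big /=.
pose F n := fps_val (s - fscale (w ^+ n) t).
have per n : F (n + e)%N = F n by rewrite /F exprD (prim_expr_order prw) mulr1.
(* Scaling T by w^i preserves valuations, so the distances from the i-th conjugate of s are a cyclic
   rearrangement of those from s. *)
have cyc (i : 'I_e) :
    (\sum_(j < e) fps_val (fscale (w ^+ j) t - fscale (w ^+ i) s)%R)%N = conj_contact e w s t.
  rewrite /conj_contact -[RHS](sum_periodic (e - i) per); apply: eq_bigr => j _.
  have wi : (w ^+ i) != 0 by rewrite expf_neq0.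
  rewrite fps_valBC -[RHS](fps_val_scale _ wi) rmorphB /= fscale_comp -exprD.
  by rewrite addnCA subnKC ?(ltnW (ltn_ord i)) // exprD (prim_expr_order prw) mulr1.
rewrite (eq_bigr (fun=> conj_contact e w s t)) => [|i _]; last exact: cyc.
rewrite sum_nat_const card_ord => /eqP; rewrite eqn_pmul2l // => /eqP //.
Qed.

End Conjugates.

Lemma inter_set_nth (L : fieldType) (Fs : seq {poly fps L}) i : uniq Fs -> (i < size Fs)%N ->
  inter_set Fs i = [seq inter_mult (nth 0 Fs i) G | G <- Fs & G != nth 0 Fs i].
Proof.
move=> uF iF; rewrite /inter_set.
have <- : [seq nth 0 Fs j | j <- iota 0 (size Fs) & j != i] = [seq G <- Fs | G != nth 0 Fs i].
  transitivity [seq G <- mkseq (nth 0 Fs) (size Fs) | G != nth 0 Fs i]; last by rewrite mkseq_nth.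
  rewrite /mkseq filter_map; congr (map _ _).
  apply: eq_in_filter => j; rewrite mem_iota => /andP[_ jF] /=.
  by rewrite nth_uniq.
by rewrite -map_comp.
Qed.

Lemma monic_prod_seq (A : comNzRingType) (ps : seq {poly A}) :
  {in ps, forall p, p \is monic} -> \prod_(p <- ps) p \is monic.
Proof. by move=> h; rewrite big_seq; apply: rpred_prod. Qed.

(* The conjugates of each representative make up one irreducible factor. *)
Lemma branches_factors (L : fieldType) e (w : L) (F : {poly fps L}) bs ks Rep Fs :
  e.-primitive_root w -> F \is monic -> size F = (e * size Rep).+1 ->
  branches e w (map_poly (fsub idfun 1 e) F) bs ks Rep -> irr_factors F Fs ->
  [/\ size Fs = size Rep, forall G, G \in Fs -> size G = e.+1,
    forall G, G \in Fs -> has_char_exps G (e :: bs)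
  & forall i, (i < size Fs)%N -> perm_eq (inter_set Fs i) ks].
Proof.
move=> prw mF sF [uR rR sep cR kR] [uF /allP mFs irr EF].
have e0 := prim_order_gt0 prw.
have hs s : s \in Rep -> conj_distinct e w s by move=> Rs i E; case: (sep s s Rs Rs i E).
have /choice[gs hgs] : forall s, exists G, s \in Rep ->
    [/\ G \is monic, size G = e.+1 & map_poly (fsub idfun 1 e) G = \prod_(r <- conj_seq e w s) ('X - r%:P)].
  move=> s; case: (boolP (s \in Rep)) => Rs; last by exists 0.
  by have [G hG] := conj_poly_exists prw (hs s Rs); exists G.
have rgs s r : s \in Rep ->
    root (map_poly (fsub idfun 1 e) (gs s)) r = (r \in conj_seq e w s).
  by move=> Rs; have [_ _ ->] := hgs s Rs; rewrite root_prod_XsubC.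
have self s : s \in conj_seq e w s.
  by apply/mapP; exists 0%N; rewrite ?mem_iota ?expr0 ?fscale1.
have conjE s t : s \in Rep -> t \in Rep -> s \in conj_seq e w t -> s = t.
  by move=> Rs Rt /mapP[i _ /(sep _ _ Rs Rt)[]].
have injg : {in Rep &, injective gs}.
  by move=> s t Rs Rt E; apply: conjE => //; rewrite -rgs // -E rgs.
have sub s : s \in Rep -> gs s \in Fs.
  move=> Rs; have := rR s Rs; rewrite -EF rmorph_prod rootE horner_prod.
  rewrite prodf_seq_eq0 => /hasP[G GF] /= rG.
  have [m1 s1 _] := hgs s Rs.
  have <- // : G = gs s.
  apply: (irreducible_conj prw (mFs G GF) (irr G GF) (hs s Rs) _ m1 s1) => //.
  by rewrite rgs.
have ug : uniq (map gs Rep) by rewrite map_inj_in_uniq.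
(* The conjugate polynomials already exhaust the degree of F, so any further factor in [Fs] would be
   a unit. *)
have pF : perm_eq Fs (map gs Rep).
  have p1 : perm_eq [seq G <- Fs | G \in map gs Rep] (map gs Rep).
    apply: uniq_perm => [| |G]; rewrite ?filter_uniq // mem_filter andb_idr //.
    by move=> /mapP[s Rs ->]; apply: sub.
  have /permPl p2 := perm_filterC (mem (map gs Rep)) Fs.
  have p3 : perm_eq (map gs Rep ++ [seq G <- Fs | G \notin map gs Rep]) Fs.
    apply: perm_trans p2; rewrite perm_cat2r perm_sym; exact: p1.
  have mg : \prod_(G <- map gs Rep) G \is monic.
    by apply: monic_prod_seq => _ /mapP[s Rs ->]; have [] := hgs s Rs.
  have sg : size (\prod_(G <- map gs Rep) G) = size F.
    rewrite sF big_map; elim: (Rep) hgs {p1 p2 p3 mg ug sub injg conjE rgs hs sF uR rR sep cR kR} => [|s R IH] hg.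
      by rewrite big_nil size_poly1 muln0.
    have [m1 s1 _] := hg s (mem_head _ _).
    have hg' t : t \in R -> _ := fun h => hg t (mem_behead (s := s :: R) h).
    have IH' := IH hg'.
    rewrite big_cons size_monicM //; first by rewrite s1 IH' /= mulnS; lia.
    by rewrite -size_poly_gt0 IH'.
  case Er : [seq G <- Fs | G \notin map gs Rep] => [|G r].
    by rewrite perm_sym; move: p3; rewrite Er cats0.
  have GF : G \in Fs.
    have : G \in [seq G <- Fs | G \notin map gs Rep] by rewrite Er mem_head.
    by rewrite mem_filter => /andP[].
  have EF' : F = \prod_(G <- map gs Rep) G * \prod_(G <- G :: r) G.
    by rewrite -EF -(perm_big _ p3) big_cat Er.
  have mr : \prod_(G <- G :: r) G \is monic.
    apply: monic_prod_seq => H; rewrite -Er mem_filter => /andP[_]; exact: mFs.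
  have : size F = (size F + size (\prod_(G <- G :: r) G)%R)%N.-1.
    by rewrite {1}EF' size_monicM ?monic_neq0 // sg.
  rewrite sF addSn /= => /eqP; rewrite -addn1 eqn_add2l => /eqP/esym/(monic_size1 mr).
  rewrite big_cons => E; case: (irr G GF) => _ [[]].
  by exists (\prod_(G <- r) G).
have mem G : G \in Fs -> exists2 s, s \in Rep & G = gs s.
  by rewrite (perm_mem pF) => /mapP.
split.
- by rewrite (perm_size pF) size_map.
- by move=> G /mem[s Rs ->]; have [] := hgs s Rs.
- move=> G /mem[s Rs ->]; have [m1 s1 E1] := hgs s Rs.
  (* All parametrizations of the factor are conjugates of s, and T to w^i T keeps the support. *)
  have param S : puiseux_param (gs s) S <-> S \in conj_seq e w s.
    by rewrite -rgs // /puiseux_param s1 /= fsubE //; split=> [/rootP|/rootP].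
  split; first by exists s; apply/param.
  move=> S /param/mapP[i _ ->]; rewrite s1 /=; apply/is_char_expsP.
  have wi : w ^+ i != 0.
    rewrite expf_neq0 //; apply: contra_eq_neq (prim_expr_order prw) => ->.
    by rewrite expr0n gtn_eqF // eq_sym oner_neq0.
  rewrite -[bs]map_id -(eq_map (add0n)).
  apply: char_exps_shift (cR s Rs) => // j _.
  by rewrite add0n fcoef_scale mulf_eq0 expf_eq0 (negPf wi) andbF orbF.
move=> i iF; rewrite inter_set_nth //.
have [s Rs ->] := mem _ (mem_nth 0 iF).
apply: perm_trans (kR s Rs).
apply: perm_trans (perm_map _ (perm_filter _ pF)) _.
rewrite filter_map -map_comp.
have -> : [seq x <- Rep | preim gs (fun u => u != gs s) x] = [seq x <- Rep | x != s].
  by apply: eq_in_filter => u Ru /=; rewrite (inj_in_eq injg).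
rewrite (_ : map _ _ = [seq conj_contact e w s t | t <- Rep & t != s]) //.
apply/eq_in_map => t; rewrite mem_filter => /andP[ts Rt] /=.
have [m1 _ E1] := hgs s Rs; have [m2 _ E2] := hgs t Rt.
apply: inter_mult_conj (hs s Rs) (hs t Rt) _ => // k.
by apply: contra_neq ts => /(sep _ _ Rs Rt)[].
Qed.

Lemma closed_prim_root (L : closedFieldType) n : n%:R != 0 :> L -> exists w : L, n.-primitive_root w.
Proof.
move=> n0; have n_gt0 : (0 < n)%N by case: n n0 => //; rewrite eqxx.
have [rs Ers] := closed_field_poly_normal ('X^n - 1 : {poly L}).
have lc : lead_coef ('X^n - 1 : {poly L}) = 1 by apply/eqP; rewrite -monicE monicXnsubC.
rewrite lc scale1r in Ers.
have urs : uniq rs by rewrite -separable_prod_XsubC -Ers separable_Xn_sub_1.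
have srs : size rs = n.
  have := congr1 (fun p : {poly L} => size p) Ers.
  by rewrite size_XnsubC // size_prod_XsubC => -[].
have all1 : all n.-unity_root rs.
  by apply/allP => x xr; rewrite -[n.-unity_root x]/(root ('X^n - 1) x) Ers root_prod_XsubC.
have := has_prim_root n_gt0 all1 urs; rewrite srs => /(_ (leqnn _))/hasP[w _ h].
by exists w.
Qed.

Lemma natr_neq0_lt_pchar (K : fieldType) d : (forall p, p \in [pchar K] -> (d < p)%N) ->
  forall n, (0 < n <= d)%N -> n%:R != 0 :> K.
Proof.
move=> char n /andP[n0 nd]; apply/negP => /eqP h.
have [p pK] := natf0_pchar n0 (introT eqP h).
have : (p %| n)%N by rewrite (dvdn_pcharf pK) h.
by move/(dvdn_leq n0) => pn; have := char p pK; rewrite ltnNge (leq_trans pn).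
Qed.

Lemma branches_shift (L : fieldType) e (w : L) (H H' : {poly fps L}) bs ks Rep (c : fps L) :
  e.-primitive_root w -> (forall n, ~~ (e %| n)%N -> fcoef c n = 0) ->
  branches e w H bs ks Rep -> {in Rep, forall r, root H' (r - c)} ->
  branches e w H' bs ks [seq r - c | r <- Rep].
Proof.
move=> prw hc [uR _ sep cR kR] hr.
have cc i : fscale (w ^+ i) c = c.
  apply: fps_ext => n; rewrite fcoef_scale.
  case: (boolP (e %| n)%N) => [/dvdnP[k ->]|/hc ->]; last by rewrite mul0r.
  by rewrite mulnC -exprM mulnCA exprM (prim_expr_order prw) expr1n mulr1.
have inj : injective (fun r : fps L => r - c) by apply: addIr.
split.
- by rewrite map_inj_uniq.
- by move=> _ /mapP[r Rr ->]; apply: hr.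
- move=> _ _ /mapP[s Rs ->] /mapP[t Rt ->] i; rewrite rmorphB /= cc => /inj.
  by move=> /(sep _ _ Rs Rt)[->].
- move=> _ /mapP[r Rr ->]; rewrite -[bs]map_id -(eq_map (add0n)).
  apply: char_exps_shift (cR r Rr) => // j ndv.
  by rewrite add0n fcoefB hc // subr0.
move=> _ /mapP[s Rs ->]; apply: perm_trans (kR s Rs).
rewrite filter_map -map_comp.
have -> : [seq x <- Rep | preim (fun r => r - c) (fun t => t != s - c) x] = [seq x <- Rep | x != s].
  by apply: eq_in_filter => u Ru /=; rewrite (inj_eq inj).
rewrite (_ : map _ _ = [seq conj_contact e w s t | t <- Rep & t != s]) //.
apply: eq_map => t /=; apply: eq_bigr => i _; congr fps_val.
by rewrite rmorphB /= cc opprB addrA subrK.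
Qed.

Lemma map_fps_map (R S : comNzRingType) (phi : {rmorphism R -> S}) e (F : {poly fps R}) : (0 < e)%N ->
  map_poly (fsub idfun 1 e) (map_poly (fps_map phi) F) = map_poly (fsub phi 1 e) F.
Proof.
move=> e0; rewrite fps_map_fsub map_fsub_comp // mul1n !expr1n mulr1.
by congr map_poly.
Qed.

Lemma success_structure (K : fieldType) d (F : {poly fps K}) (L : closedFieldType)
    (iota : {rmorphism K -> L}) Fs ds :
  (forall p, p \in [pchar K] -> (d < p)%N) -> (0 < d)%N -> F \is monic -> size F = d.+1 ->
  algebraic_over iota -> irr_factors (map_poly (fps_map iota) F) Fs -> pi_success F ds ->
  [/\ size Fs = f_tot ds, (forall G, G \in Fs -> size G = (e_tot ds).+1),
      (forall G, G \in Fs -> has_char_exps G (char_exps_list ds))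
    & (forall i, (i < size Fs)%N -> perm_eq (inter_set Fs i) (inter_list ds))].
Proof.
move=> char d0 mF sF alg irr run.
have charL n : (0 < n <= d)%N -> n%:R != 0 :> L.
  by move=> hn; rewrite -(rmorph_nat iota) fmorph_eq0 (natr_neq0_lt_pchar char).
have [mT sT] := tschirnhausen_monic (fun x : K => x) mF.
have [|||pos sds hbr] := run_branches alg run erefl _ mT _ (phi := iota) _ => //.
- by move=> n; rewrite sT sF ltnS; apply: charL.
- by rewrite sT sF.
have e0 := e_tot_gt0 pos; have f0 := f_tot_gt0 pos.
have ef : d = (e_tot ds * f_tot ds)%N by move: sds; rewrite sT sF => -[].
have [w prw] : exists w : L, (e_tot ds).-primitive_root w.
  by apply: closed_prim_root; apply: charL; rewrite e0 ef leq_pmulr.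
have [Rep [sR br]] := hbr w prw.
pose c := tsch_shift (fun x : K => x) iota (e_tot ds) F.
have br' : branches (e_tot ds) w (map_poly (fsub idfun 1 (e_tot ds)) (map_poly (fps_map iota) F))
    (char_exps_rec ds) (inter_rec ds) [seq r - c | r <- Rep].
  apply: (branches_shift prw _ br) => [n|r Rr]; first exact: tsch_shift_coef.
  rewrite map_fps_map //; have [_ h _ _ _] := br.
  by move: (h r Rr); rewrite root_tschirnhausen.
have mF' : map_poly (fps_map iota) F \is monic by rewrite fps_map_fsub; apply: monic_map.
have sF' : size (map_poly (fps_map iota) F) = (e_tot ds * size [seq r - c | r <- Rep]).+1.
  by rewrite fps_map_fsub size_map_monic // sF size_map sR ef.
rewrite char_exps_listE // inter_listE //.
by have := branches_factors prw mF' sF' br' irr; rewrite size_map sR.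
Qed.

(** * Rings detected by their morphisms to L *)

Lemma quotient_exists (A : comNzRingType) (P : {poly A}) : P \is monic -> (1 < size P)%N ->
  exists (A' : comNzRingType) (iota : {rmorphism A -> A'}) (z : A'), is_quotient_by iota z P.
Proof.
(* The quotient type is taken modulo [mk_monic P], which is P itself only for a monic P of positive
   degree. *)
move=> mP sP; have EP : mk_monic P = P by rewrite /mk_monic sP mP.
exists {poly %/ P}, (qpolyC P), 'qX.
have qC a : qpolyC P a = in_qpoly P a%:P.
  apply: val_inj; rewrite /= Pdiv.CommonRing.rmodp_small // EP (leq_ltn_trans _ sP) //.
  exact: size_polyC_leq1.
have ev (r : {poly A}) : (map_poly (qpolyC P) r).['qX] = in_qpoly P r.
  rewrite -{2}[r]coefK poly_def rmorph_sum (@horner_coef_wide _ (size r)) ?size_poly //.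
  by apply: eq_bigr => i _; rewrite coef_map /= qC -mul_polyC in_qpolyM (rmorphXn (in_qpoly P)).
split=> [|w|r1 r2 s1 s2].
- by rewrite ev; apply: val_inj; rewrite /= EP (Pdiv.RingMonic.rmodpp mP).
- exists (val w); split; first by have := size_mk_monic w; rewrite [in X in (_ < X)%N]EP.
  by rewrite ev; apply: val_inj; rewrite /= Pdiv.CommonRing.rmodp_small ?size_mk_monic.
rewrite !ev => /(congr1 val) /=.
by rewrite !Pdiv.CommonRing.rmodp_small ?EP.
Qed.

Section GoodRing.
Variables (K : fieldType) (L : closedFieldType) (iotaL : {rmorphism K -> L}).

Definition over (A : comNzRingType) (kappa : K -> A) (phi : A -> L) :=
  forall x, phi (kappa x) = iotaL x.

(* Finite products of fields are used through their morphisms to L, which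
   detect zero and units. *)
Definition good_ring (A : comNzRingType) (kappa : K -> A) :=
  (forall a : A, (forall phi : {rmorphism A -> L}, over kappa phi -> phi a = 0) -> a = 0)
  /\ (forall a : A, (forall phi : {rmorphism A -> L}, over kappa phi -> phi a != 0) -> is_unit a).

Lemma good_base : good_ring (fun x : K => x).
Proof.
split=> [a /(_ iotaL (fun=> erefl)) /eqP|a /(_ iotaL (fun=> erefl))].
  by rewrite fmorph_eq0 => /eqP.
by rewrite fmorph_eq0 => na; exists a^-1; rewrite mulfV.
Qed.

Variables (A : comNzRingType) (kappa : K -> A).
Hypothesis gA : good_ring kappa.

Lemma good_eq a b : (forall phi : {rmorphism A -> L}, over kappa phi -> phi a = phi b) -> a = b.
Proof.
by move=> h; apply/subr0_eq/(proj1 gA) => phi /h E; rewrite rmorphB E subrr.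
Qed.

Lemma good_poly_eq (p q : {poly A}) :
  (forall phi : {rmorphism A -> L}, over kappa phi -> map_poly phi p = map_poly phi q) -> p = q.
Proof.
by move=> h; apply/polyP => i; apply: good_eq => phi /h /(congr1 (fun r : {poly L} => r`_i)); rewrite !coef_map.
Qed.

Lemma good_over : exists phi : {rmorphism A -> L}, over kappa phi.
Proof.
apply: contrapT => h; have /eqP[] := oner_neq0 A; apply: (proj1 gA) => phi hphi.
by case: h; exists phi.
Qed.

Variable P : {poly A}.
Hypotheses (mP : P \is monic) (sP : (1 < size P)%N).

(** A resultant lies in the ideal of its two polynomials. It is a unit as soon as no phi sends it to
    0, which holds when no phi creates a common root. *)
Lemma bezout_of_roots (r : {poly A}) :
  (forall phi : {rmorphism A -> L}, over kappa phi ->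
     forall rho, root (map_poly phi P) rho -> ~~ root (map_poly phi r) rho) ->
  exists u v, u * P + v * r = 1.
Proof.
(* Unlike r, the polynomial r' is monic, so that its resultant with P commutes with every phi. *)
move=> nr; pose r' := P * 'X^(size r) + r.
have mPX : P * 'X^(size r) \is monic by rewrite monicMl ?monicXn.
have lt : (size r < size (P * 'X^(size r))%R)%N.
  by rewrite size_Mmonic ?monicXn ?monic_neq0 // size_polyXn; move: sP; lia.
have mr' : r' \is monic by rewrite monicE /r' lead_coefDl // -monicE.
have sr' : (1 < size r')%N.
  by rewrite /r' size_polyDl // size_Mmonic ?monicXn ?monic_neq0 // size_polyXn; move: sP; lia.
have [[u v] /= _ E] := resultant_in_ideal sP sr'.
have [b Eb] : is_unit (resultant P r').
  apply: (proj2 gA) => phi hphi.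
  rewrite resultant_map ?(monicP mP) ?(monicP mr') ?rmorph1 ?oner_neq0 //.
  rewrite resultant_eq0 -leqNgt leqNgt; apply/negP => /ltn_eqF/negbT; rewrite eq_sym.
  case/closed_rootP => rho; rewrite root_gcd => /andP[r1].
  rewrite rmorphD rmorphM /= /root hornerD hornerM (rootP r1) mul0r add0r.
  by apply/negP; apply: nr.
exists (b%:P * (u + v * 'X^(size r))), (b%:P * v).
rewrite -[RHS]/(1%:P) -Eb polyCM E /r'; ring.
Qed.

Hypothesis sepP : forall phi : {rmorphism A -> L}, over kappa phi ->
  exists rs, uniq rs /\ map_poly phi P = \prod_(r <- rs) ('X - r%:P).

(** The fields in [sqfree_over] are arbitrary images of A, with no link to L. A Bezout identity
    between P and its derivative over A itself passes to all of them. *)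
Lemma sqfree_of_roots : sqfree_over P.
Proof.
have [u [v E]] : exists u v, u * P + v * P^`() = 1.
  apply: bezout_of_roots => phi /sepP[rs [urs Ers]] rho hr; rewrite -deriv_map.
  have : separable_poly (map_poly phi P) by rewrite Ers separable_prod_XsubC.
  by rewrite unlock => /coprimep_root -/(_ _ hr).
move=> k pi _ b c nb Eb; apply: nb.
exists (map_poly pi u * b * c + map_poly pi v * (b^`() * c *+ 2 + b * c^`())).
have := congr1 (map_poly pi) E; rewrite rmorphD !rmorphM rmorph1 /= -deriv_map Eb !derivM => <-.
ring.
Qed.

(** An element is the value at z of some r of degree less than deg P. If every morphism kills it,
    each image of r has deg P distinct roots, so r = 0; if none does, r and P generate the unit
    ideal. *)
Lemma good_quotient (A' : comNzRingType) (iota : {rmorphism A -> A'}) (z : A') :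
  is_quotient_by iota z P -> good_ring (iota \o kappa).
Proof.
move=> hq; have [hz hr _] := hq.
have lift (phi : {rmorphism A -> L}) rho : over kappa phi -> root (map_poly phi P) rho ->
    exists psi : {rmorphism A' -> L}, over (iota \o kappa) psi /\
      forall r : {poly A}, psi (map_poly iota r).[z] = (map_poly phi r).[rho].
  move=> hphi hrho; have [psi [h1 h2]] := quotient_morphism mP hq hrho.
  exists psi; split=> [x|r]; first by rewrite /= h1 hphi.
  rewrite -horner_map -map_poly_comp /= h2; congr (_.[_]).
  by apply: eq_map_poly => a /=.
split=> w hw; have [r [sr Er]] := hr w.
  rewrite Er (_ : r = 0) ?rmorph0 ?horner0 //; apply: good_poly_eq => phi hphi.
  rewrite rmorph0; have [rs [urs Ers]] := sepP hphi.
  apply: contraTeq isT => nz; have : all (root (map_poly phi r)) rs.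
    apply/allP => rho hrho; have [|psi [o1 o2]] := lift phi rho hphi.
      by rewrite Ers root_prod_XsubC.
    by rewrite /root -o2 -Er hw.
  move/(max_poly_roots nz)/(_ urs); rewrite ltnNge; apply: contraNN => _.
  have := congr1 (fun p : {poly L} => size p) Ers; rewrite size_map_monic // size_prod_XsubC => sPE.
  by apply: leq_trans (size_poly _ _) _; rewrite -ltnS -sPE.
have [phi hphi rho hrho|u [v E]] := bezout_of_roots (r := r).
  have [psi [o1 o2]] := lift phi rho hphi hrho.
  by rewrite /root -o2 -Er hw.
exists (map_poly iota v).[z]; have := congr1 (fun p => (map_poly iota p).[z]) E.
by rewrite rmorphD !rmorphM rmorph1 /= hornerD !hornerM hz mulr0 add0r hornerC -Er mulrC.
Qed.

End GoodRing.

(** * Approximate roots and Hensel's lemma *)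

Section ApproxRoot.
Variable A : comNzRingType.

(** S is the cofactor of P - Q in P^n - Q^n; its n terms are monic of the same degree. *)
Lemma sum_pow_lead (P Q : {poly A}) l n : P \is monic -> Q \is monic ->
  size P = l.+1 -> size Q = l.+1 ->
  let S := \sum_(i < n) P ^+ (n.-1 - i) * Q ^+ i in
  (size S <= (l * n.-1).+1)%N /\ S`_(l * n.-1) = n%:R.
Proof.
move=> mP mQ sP sQ S.
have sT (i : 'I_n) : size (P ^+ (n.-1 - i) * Q ^+ i) = (l * n.-1).+1.
  rewrite size_monicM ?monic_exp ?monic_neq0 ?monic_exp //.
  rewrite !size_monic_exp // sP sQ addSn /= addnS -mulnDr subnK //.
  by move: (nat_of_ord i) (ltn_ord i) => k; case: (n).
split; first by apply: leq_trans (size_sum _ _ _) _; apply/bigmax_leqP => i _; rewrite sT.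
rewrite coef_sum -[n in RHS]card_ord -sum1_card natr_sum; apply: eq_bigr => i _.
have m : P ^+ (n.-1 - i) * Q ^+ i \is monic by rewrite monicMl ?monic_exp.
by rewrite -[(l * n.-1)%N]/((l * n.-1).+1.-1) -(sT i) -lead_coefE (monicP m).
Qed.

(** P is corrected from the top down: adding (c / n) X^(l-k-1) changes the coefficient of X^(l
    n-k-1) in P^n by exactly c and leaves the higher ones alone. *)
Lemma approx_root (b : {poly A}) l n (nu : A) : (0 < n)%N -> n%:R * nu = 1 ->
  b \is monic -> size b = (l * n).+1 ->
  exists P, [/\ P \is monic, size P = l.+1 & (size (b - P ^+ n)%R <= l * n.-1)%N].
Proof.
move=> n0 hnu mb sb.
suff H k : (k <= l)%N -> exists P, [/\ P \is monic, size P = l.+1 & (size (b - P ^+ n)%R <= l * n - k)%N].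
  by have [P [h1 h2 h3]] := H l (leqnn _); exists P; split; rewrite // -subn1 mulnBr muln1.
elim: k => [_|k IH kl].
  exists 'X^l; split; rewrite ?monicXn ?size_polyXn // subn0 -exprM.
  apply/leq_sizeP => j; rewrite leq_eqVlt coefB coefXn => /predU1P[<-|lt].
    by rewrite eqxx -[(l * n)%N]/((l * n).+1.-1) -sb -lead_coefE (monicP mb) subrr.
  by rewrite (gtn_eqF lt) subr0 nth_default // sb.
have [P [mP sP hP]] := IH (ltnW kl).
pose c := (b - P ^+ n)`_(l * n - k.+1).
pose D := (c * nu) *: 'X^(l - k.+1) : {poly A}.
have sD : (size D < size P)%N.
  by rewrite (leq_ltn_trans (size_scale_leq _ _)) // size_polyXn sP; lia.
have mPD : P + D \is monic by rewrite monicE lead_coefDl // -monicE.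
have sPD : size (P + D) = l.+1 by rewrite size_polyDl.
exists (P + D); split=> //.
have := subrXX (P + D) P n; rewrite addrAC subrr add0r => E.
have [sS cS] := sum_pow_lead n mPD mP sPD sP; set S := \sum_(i < n) _ in E sS cS.
have -> : b - (P + D) ^+ n = (b - P ^+ n) - D * S by rewrite -E; ring.
have lE : (l * n = l * n.-1 + l)%N by rewrite -mulnSr prednK.
apply/leq_sizeP => j hj; rewrite coefB /D -scalerAl coefZ coefXnM.
have -> : (j < l - k.+1)%N = false by apply/negbTE; rewrite -leqNgt; move: hj; rewrite lE; move: (l * n.-1)%N => ?; lia.
move: hj; rewrite leq_eqVlt => /predU1P[<-|hj].
  have -> : (l * n - k.+1 - (l - k.+1) = l * n.-1)%N by rewrite lE; move: (l * n.-1)%N => ?; lia.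
  by rewrite cS -[c * nu * _]mulrA [nu * _]mulrC hnu mulr1 subrr.
rewrite [(b - _)`_j]nth_default; last by apply: leq_trans hP _; lia.
rewrite [S`_ _]nth_default ?mulr0 ?subrr //; apply: leq_trans sS _; move: hj; rewrite lE; move: (l * n.-1)%N => ?; lia.
Qed.

End ApproxRoot.

(** The cofactor of Q - P has degree l (n-1) because n is not zero, so a non-zero Q - P would make
    the difference of the powers too large. *)
Lemma approx_root_uniq (L : fieldType) (P Q : {poly L}) l n : n%:R != 0 :> L ->
  P \is monic -> Q \is monic -> size P = l.+1 -> size Q = l.+1 ->
  (size (Q ^+ n - P ^+ n)%R <= l * n.-1)%N -> P = Q.
Proof.
move=> n0 mP mQ sP sQ; rewrite subrXX.
have [sS cS] := sum_pow_lead n mQ mP sQ sP; set S := \sum_(i < n) _ in sS cS *.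
have nS : S != 0 by apply: contra_neq n0 => S0; rewrite -cS S0 coef0.
case: (eqVneq (Q - P) 0) => [/subr0_eq //|nQP].
have : (l * n.-1 < size S)%N.
  by rewrite ltnNge; apply: contra n0 => h; rewrite -cS nth_default.
rewrite size_mul //; move: nQP; rewrite -size_poly_gt0; move: (l * n.-1)%N => k h1 h2 h3.
move: h1 h3; case: (size (Q - P)) => [|a] // _; rewrite addSn /=.
by rewrite leqNgt (leq_trans h2 (leq_addl _ _)).
Qed.

(** Recursion on the full history, as needed for the convolution in Hensel's lemma. *)
Lemma course_of_values (T : Type) (step : seq T -> T) :
  exists p : nat -> T, forall k, p k = step (mkseq p k).
Proof.
pose fix hist k := if k is k'.+1 then rcons (hist k') (step (hist k')) else [::].
exists (fun k => step (hist k)) => k; congr step.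
by elim: k => //= k IH; rewrite mkseqS -IH.
Qed.

Section Hensel.
Variable A : comNzRingType.
Implicit Types (V G U : {poly fps A}) (u w : {poly A}).

Definition slice k V : {poly A} := map_poly (fun f : fps A => fcoef f k) V.

Lemma coef_slice k V i : (slice k V)`_i = fcoef V`_i k.
Proof. by rewrite coef_map_id0. Qed.

Lemma slice_inj V G : (forall k, slice k V = slice k G) -> V = G.
Proof.
move=> h; apply/polyP => i; apply: fps_ext => k.
by rewrite -!coef_slice h.
Qed.

Lemma sliceM k U G : slice k (U * G) = \sum_(j < k.+1) slice j U * slice (k - j) G.
Proof.
apply/polyP => i; rewrite coef_slice coefM fcoef_sum coef_sum.
under [RHS]eq_bigr => j _ do rewrite coefM.
rewrite [RHS]exchange_big /=; apply: eq_bigr => l _; rewrite fcoefM.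
by apply: eq_bigr => j _; rewrite !coef_slice.
Qed.

Lemma inverse_mod_Xn u n : is_unit u`_0 -> exists b : {poly A},
  forall i, (i < n)%N -> (u * b)`_i = (i == 0)%:R.
Proof.
case=> c hc; elim: n => [|n [b hb]]; first by exists 0.
pose a := ((n == 0)%:R - (u * b)`_n) * c.
exists (b + a *: 'X^n) => i; rewrite ltnS mulrDr coefD -scalerAr coefZ coefMXn.
case: ltngtP => // [lt|->] _; first by rewrite mulr0 addr0 hb.
by rewrite subnn /a -mulrA [c * _]mulrC hc mulr1 addrC subrK.
Qed.

(** The linear equation behind each Hensel step. Over a ring, u and X^n are made comaximal by
    inverting u modulo X^n; truncating g below degree n then gives both degree bounds. *)
Lemma hensel_solve u n N : is_unit u`_0 -> (n <= N)%N -> (size u <= (N - n).+1)%N ->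
  forall w, (size w <= N)%N -> exists gh : {poly A} * {poly A},
    [/\ (size gh.1 <= n)%N, (size gh.2 <= N - n)%N & u * gh.1 + gh.2 * 'X^n = w].
Proof.
move=> hu nN su w sw; have [b hb] := inverse_mod_Xn n hu.
pose g := take_poly n (b * w); exists (g, drop_poly n (w - u * g)) => /=.
have sg : (size g <= n)%N by apply: size_take_poly.
split=> //.
  rewrite size_drop_poly leq_subLR subnKC //.
  apply: leq_trans (size_polyD _ _) _; rewrite geq_max sw size_polyN.
  apply: leq_trans (size_polyMleq _ _) _.
  case: (size u) su => [_|k su]; first by rewrite (leq_trans (leq_pred _)) // (leq_trans sg).
  by rewrite addSn /= -(subnK nN) leq_add.
have {2}-> : w = u * g + (w - u * g) by rewrite addrC subrK.
congr (_ + _); rewrite -{2}[w - u * g](poly_take_drop n) [take_poly _ _](_ : _ = 0) ?add0r //.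
apply/polyP => i; rewrite coef_take_poly coef0; case: ifP => // ltin.
have -> : (w - u * g)`_i = w`_i - (u * (b * w))`_i.
  rewrite coefB; congr (_ - _); apply: coefM_eqr => j ji.
  by rewrite coef_take_poly (leq_ltn_trans ji).
have -> : (u * (b * w))`_i = (1 * w)`_i.
  rewrite mulrA; apply: coefM_eql => j ji.
  by rewrite hb ?(leq_ltn_trans ji) // coefC; case: j {ji}.
by rewrite mul1r subrr.
Qed.

(** The factors are built by powers of x. In V = U G the coefficient of x^k is an equation linear in
    the new coefficients of U and G, whose right-hand side involves only earlier ones. *)
Lemma hensel V n N u : V \is monic -> size V = N.+1 -> (n <= N)%N ->
  u \is monic -> size u = (N - n).+1 -> is_unit u`_0 -> slice 0 V = u * 'X^n ->
  exists U G, [/\ V = U * G, slice 0 U = u, slice 0 G = 'X^n, G \is monic & size G = n.+1].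
Proof.
move=> mV sV nN mu su hu V0.
have /choice[sol hsol] : forall w, exists gh : {poly A} * {poly A}, (size w <= N)%N ->
    [/\ (size gh.1 <= n)%N, (size gh.2 <= N - n)%N & u * gh.1 + gh.2 * 'X^n = w].
  move=> w; case: (leqP (size w) N) => sw; last by exists (0, 0).
  by have [|gh hgh] := hensel_solve hu nN _ sw; [rewrite su | exists gh].
(* A pair holds the coefficient of x^j in G first, then the one in U. [rest] is the coefficient of
   x^k in V minus the products of intermediate terms, those with 0 < j < k. *)
pose rest (s : seq ({poly A} * {poly A})) :=
  slice (size s) V - \sum_(1 <= j < size s) (nth (0, 0) s j).2 * (nth (0, 0) s (size s - j)).1.
have [p hp] := course_of_values (fun s => if nilp s then ('X^n, u) else sol (rest s)).
have p0 : p 0%N = ('X^n, u) by rewrite hp.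
pose R k := slice k V - \sum_(1 <= j < k) (p j).2 * (p (k - j)%N).1.
have pS k : (0 < k)%N -> p k = sol (R k).
  move=> k0; rewrite hp /nilp size_mkseq gtn_eqF //; congr sol.
  rewrite /rest size_mkseq /R; congr (_ - _); apply: eq_big_nat => j /andP[j1 jk].
  rewrite !nth_mkseq //; lia.
have sVk k : (0 < k)%N -> (size (slice k V) <= N)%N.
  move=> k0; apply/leq_sizeP => j; rewrite leq_eqVlt coef_slice => /predU1P[<-|h].
    by rewrite -[N]/(N.+1.-1) -sV -lead_coefE (monicP mV) fcoef1 gtn_eqF.
  by rewrite nth_default ?sV.
have hk k : (0 < k)%N -> [/\ (size (p k).1 <= n)%N, (size (p k).2 <= N - n)%N &
    u * (p k).1 + (p k).2 * 'X^n = R k].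
  elim/ltn_ind: k => k IH k0; rewrite (pS k k0); apply: hsol.
  apply: leq_trans (size_polyD _ _) _; rewrite geq_max sVk // size_polyN.
  apply: leq_trans (size_sum _ _ _) _; apply/bigmax_leqP_seq => j; rewrite mem_index_iota => /andP[j1 jk] _.
  have [_ h2 _] := IH j jk j1; have [|//|h1 _ _] := IH (k - j)%N; [lia|lia|].
  apply: leq_trans (size_polyMleq _ _) _; apply: leq_trans (leq_pred _) _.
  by rewrite -[X in (_ <= X)%N](subnK nN) leq_add.
pose G := \poly_(i < n.+1) Fps (fun k => (p k).1`_i).
pose U := \poly_(i < (N - n).+1) Fps (fun k => (p k).2`_i).
have sG k : slice k G = (p k).1.
  apply/polyP => i; rewrite coef_slice coef_poly; case: ltnP => [_|h]; rewrite ?fcoefE //.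
  rewrite ?fcoef0 nth_default //; case: k => [|k]; first by rewrite p0 /= size_polyXn.
  by have [h1 _ _] := hk k.+1 isT; apply: leq_trans h1 (ltnW h).
have sU k : slice k U = (p k).2.
  apply/polyP => i; rewrite coef_slice coef_poly; case: ltnP => [_|h]; rewrite ?fcoefE //.
  rewrite ?fcoef0 nth_default //; case: k => [|k]; first by rewrite p0 /= su.
  by have [_ h1 _] := hk k.+1 isT; apply: leq_trans h1 (ltnW h).
have Gn : G`_n = 1.
  apply: fps_ext => k; rewrite coef_poly ltnSn fcoefE fcoef1; case: k => [|k].
    by rewrite p0 /= coefXn eqxx.
  by have [h1 _ _] := hk k.+1 isT; rewrite nth_default.
have szG : size G = n.+1 by apply: size_poly_eq; rewrite -[n in n.+1.-1]/n; move: Gn; rewrite coef_poly ltnSn => ->; rewrite oner_neq0.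
exists U, G; split=> //.
- apply: slice_inj => k; rewrite sliceM; under eq_bigr => j _ do rewrite sU sG.
  case: k => [|k]; first by rewrite V0 big_ord_recl big_ord0 addr0 p0 /=.
  have [_ _ Ek] := hk k.+1 isT; have : slice k.+1 V = R k.+1 + \sum_(1 <= j < k.+1) (p j).2 * (p (k.+1 - j)%N).1.
    by rewrite /R subrK.
  rewrite -Ek => ->; rewrite -(big_mkord xpredT (fun j => (p j).2 * (p (k.+1 - j)%N).1)).
  rewrite [RHS]big_nat_recr //= [X in _ = X + _]big_ltn // subn0 subnn p0 /= addrAC.
  by congr (_ + _).
- by rewrite sU p0.
- by rewrite sG p0.
by rewrite monicE lead_coefE szG /= Gn.
Qed.

End Hensel.

(** * Lower edges of balanced root lists *)

(** Homogeneity in the roots, written without dividing by c, since c will be a power of T. *)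
Lemma coef_prod_scale (R : comNzRingType) (c : R) (rs : seq R) i :
  (\prod_(r <- rs) ('X - (c * r)%:P))`_i * c ^+ i
    = c ^+ (size rs) * (\prod_(r <- rs) ('X - r%:P))`_i.
Proof.
elim: rs i => [|r rs IH] i; first by rewrite !big_nil coef1 expr0 mul1r; case: i => [|i] /=; rewrite ?mul1r ?mul0r.
rewrite !big_cons [in LHS]mulrBl coefB coefXM coefCM [in LHS]mulrBl.
rewrite [in RHS]mulrBl coefB coefXM coefCM mulrBr /= exprS; congr (_ - _).
  case: i => [|i] /=; first by rewrite mul0r mulr0.
  by rewrite exprS mulrCA IH mulrA.
by rewrite -mulrA IH mulrACA.
Qed.

Lemma comp_poly_scaleX (R : comNzRingType) (p : {poly R}) (c : R) :
  p \Po (c%:P * 'X) = \poly_(i < size p) (p`_i * c ^+ i).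
Proof.
rewrite comp_polyE poly_def; apply: eq_bigr => i _.
by rewrite exprMn -rmorphXn mul_polyC scalerA.
Qed.

Section PowerPolynomial.
Variables (L : fieldType) (q N' : nat) (ze : L) (cs : seq L).
Hypotheses (prz : q.-primitive_root ze) (hcount : {in cs, forall c, count_mem c cs = N'}).
Hypotheses (cs0 : (1 < q)%N -> {in cs, forall c, c != 0}) (csz : {in cs, forall c, ze * c \in cs}).
Let q0 : (0 < q)%N := prim_order_gt0 prz.
Notation rs := (undup [seq c ^+ q | c <- cs]).

Lemma root_of_unity_orbit c c' : c \in cs -> c' ^+ q = c ^+ q -> c' \in cs.
Proof.
move=> hc E; have closed k : ze ^+ k * c \in cs.
  by elim: k => [|k IH]; rewrite ?expr0 ?mul1r // exprS -mulrA csz.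
move: (cs0); case: (ltngtP q 1) q0 => [|q1 _ /(_ isT _ hc) nc|q1 _ _]; [lia| |]; last first.
  by move: E; rewrite q1 !expr1 => ->.
have : (c' / c) ^+ q = 1 by rewrite exprMn E exprVn divff ?expf_neq0.
by case/(prim_rootP prz) => i Ei; rewrite -(divfK nc c') Ei.
Qed.

(** The distinct elements of cs split into orbits under multiplication by ze, one for each q-th
    power r, and an orbit contributes X^q - r. For q > 1 the orbits have full size because 0 does
    not occur. *)
Lemma prod_XsubC_power :
  \prod_(c <- cs) ('X - c%:P) = ((\prod_(r <- rs) ('X - r%:P)) \Po 'X^q) ^+ N' /\
  size cs = (q * size rs * N')%N.
Proof.
have hrs r : exists c, r \in rs -> c \in cs /\ c ^+ q = r.
  case: (boolP (r \in rs)) => [|_]; last by exists 0.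
  by rewrite mem_undup => /mapP[c hc ->]; exists c.
have [cf hcf] := choice hrs.
pose orb r := [seq ze ^+ k * cf r | k <- iota 0 q].
have zq k : (ze ^+ k) ^+ q = 1 by rewrite exprAC (prim_expr_order prz) expr1n.
have orbq r x : r \in rs -> x \in orb r -> x ^+ q = r.
  by move=> /hcf[_ E] /mapP[k _ ->]; rewrite exprMn zq mul1r.
have uorb r : r \in rs -> uniq (orb r).
  move=> /hcf[hc _]; rewrite map_inj_in_uniq ?iota_uniq // => i j.
  rewrite !mem_iota !add0n /= => iq jq.
  move: (cs0); case: (ltngtP q 1) q0 => [|q1 _ /(_ isT _ hc) nc|q1 _ _]; [lia| |lia].
  by move/(mulIf nc) => /eqP; rewrite (eq_prim_root_expr prz) !modn_small // => /eqP.
have perm : perm_eq (undup cs) (flatten (map orb rs)).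
  apply: uniq_perm; rewrite ?undup_uniq //.
    apply: uniq_flatten_map; rewrite ?undup_uniq // => r r' hr hr' x.
    by move=> /(orbq r _ hr) <- /(orbq r' _ hr').
  move=> x; rewrite mem_undup; apply/idP/flatten_mapP => [hx|[r hr hx]]; last first.
    have [hc E] := hcf r hr; apply: (root_of_unity_orbit hc).
    by rewrite (orbq r) // E.
  have hr : x ^+ q \in rs by rewrite mem_undup; apply/mapP; exists x.
  exists (x ^+ q) => //; have [hc E] := hcf _ hr.
  move: (cs0); case: (ltngtP q 1) q0 => [|q1 _ /(_ isT _ hc) nc|q1 _ _]; [lia| |]; last first.
    apply/mapP; exists 0%N; first by rewrite mem_iota q1.
    by move: E; rewrite q1 !expr1 expr0 mul1r => ->.
  have nx : x ^+ q != 0 by rewrite -E expf_neq0.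
  have : (x / cf (x ^+ q)) ^+ q = 1 by rewrite exprMn exprVn E divff.
  case/(prim_rootP prz) => i Ei; apply/mapP; exists (val i); first by rewrite mem_iota /= ltn_ord.
  by rewrite -Ei divfK.
have porb r : r \in rs -> \prod_(x <- orb r) ('X - x%:P) = 'X^q - r%:P.
  move=> hr; apply/esym/monic_roots; rewrite ?monicXnsubC ?uorb //.
    by apply/allP => x /(orbq r _ hr) E; rewrite rootE !hornerE E subrr.
  by rewrite size_XnsubC // size_map size_iota.
have Eu : \prod_(c <- undup cs) ('X - c%:P) = (\prod_(r <- rs) ('X - r%:P)) \Po 'X^q.
  rewrite (perm_big _ perm) big_flatten big_map /=.
  rewrite (rmorph_prod (comp_poly 'X^q)) big_seq [RHS]big_seq; apply: eq_bigr => r hr.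
  by rewrite porb //= comp_polyB comp_polyX comp_polyC.
have count_flat (T : Type) (s : seq L) (f : L -> seq T) k : {in s, forall x, size (f x) = k} ->
    size (flatten (map f s)) = (size s * k)%N.
  elim: s => //= x s IH h; rewrite size_cat h ?mem_head // IH ?mulSn // => y ys.
  by apply: h; rewrite inE ys orbT.
split.
  rewrite -Eu -prodrXl -[LHS]big_undup_iterop_count /= big_seq [RHS]big_seq.
  by apply: eq_bigr => c; rewrite mem_undup => hc; rewrite hcount.
have -> : size cs = (size (undup cs) * N')%N.
  rewrite -(count_flat _ _ (fun c => nseq N' c)); last by move=> c _; rewrite size_nseq.
  apply: perm_size; apply/permP => a; rewrite count_flatten -map_comp sumnE big_map.
  under eq_bigr => c _ do rewrite /= count_nseq.
  rewrite -sum1_count -[LHS]big_undup_iterop_count big_mkcond /= big_seq [RHS]big_seq.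
  apply: eq_bigr => c; rewrite mem_undup => hc; rewrite hcount //.
  by rewrite Monoid.iteropE iter_addn_0; case: (a c); rewrite ?mul1n ?mul0n.
have -> : size (undup cs) = (size rs * q)%N.
  rewrite (perm_size perm); apply: count_flat => r _.
  by rewrite size_map size_iota.
by rewrite [(size rs * q)%N]mulnC.
Qed.

End PowerPolynomial.

Section RootList.
Variables (L : fieldType) (e : nat) (D : nat -> nat) (M : nat -> nat -> Prop).

(* What being balanced says about the roots themselves; in this form it passes from H_k to H_{k+1}. *)
Definition balanced_roots (R : seq (fps L)) : Prop :=
  [/\ uniq R, \sum_(r <- R) r = 0,
    {in R, forall a v, count (fun b => (b != a) && (fps_val (a - b) == v)) R = D v}
  & {in R, forall a dd n, (dd %| e)%N -> (first_not_div dd n (fcoef a) <-> M dd n)}].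

Variables (R : seq (fps L)) (m0 : nat).
Hypotheses (bR : balanced_roots R) (nR : (size R)%:R != 0 :> L).
Hypotheses (Dm0 : (0 < D m0)%N) (Dlt : forall v, (v < m0)%N -> D v = 0%N).

Lemma dist_ge a b : a \in R -> b \in R -> a != b -> (m0 <= fps_val (a - b)%R)%N.
Proof.
move=> aR bR' ab; have [_ _ hD _] := bR; rewrite leqNgt; apply/negP => lt.
have := hD a aR (fps_val (a - b)); rewrite Dlt // => /eqP; rewrite -leqn0 leqNgt -has_count.
by case/negP; apply/hasP; exists b; rewrite // eqxx andbT eq_sym.
Qed.

(** As the roots sum to zero, r times their number is the sum of the differences r - b, all of
    valuation at least m0. This is the purpose of the Tschirnhausen shift. *)
Lemma root_low r i : r \in R -> (i < m0)%N -> fcoef r i = 0.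
Proof.
move=> rR im; have [_ s0 _ _] := bR.
have E : \sum_(b <- R) (r - b) = r *+ size R.
  by rewrite big_split /= sumrN s0 subr0 big_const_seq count_predT iter_addr_0.
have := congr1 (fun f => fcoef f i) E; rewrite fcoef_sum big_seq big1 => [|b hb].
  move/esym; have -> : fcoef (r *+ size R) i = fcoef r i * (size R)%:R.
    by rewrite -[r *+ _]mulr_natl -(rmorph_nat (@fpsC L)) fcoefCM mulrC.
  by move/eqP; rewrite mulf_eq0 (negPf nR) orbF => /eqP.
case: (eqVneq r b) => [->|rb]; first by rewrite subrr fcoef0.
by rewrite fps_val_lt // (leq_trans im) // dist_ge.
Qed.

Lemma dist_eq a b : a \in R -> b \in R ->
  (b != a) && (fps_val (a - b) == m0) = (fcoef b m0 != fcoef a m0).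
Proof.
move=> aR bR'; case: (eqVneq b a) => [->|ba] /=; first by rewrite eqxx.
have ab : a - b != 0 by rewrite subr_eq0 eq_sym.
have ge : (m0 <= fps_val (a - b)%R)%N by rewrite dist_ge // eq_sym.
apply/idP/idP => [/eqP E|ne].
  by have := fps_val_nz ab; rewrite E fcoefB subr_eq0 eq_sym.
by rewrite eqn_leq ge andbT fps_val_le // fcoefB subr_eq0 eq_sym.
Qed.

(** The origin of N': the roots that share the coefficient of a at T^m0 are those not at distance
    m0, a itself included. *)
Lemma count_lead a : a \in R -> count (fun b => fcoef b m0 == fcoef a m0) R = (size R - D m0)%N.
Proof.
move=> aR; have [_ _ hD _] := bR; rewrite -(hD a aR m0).
rewrite -(count_predC (fun b => fcoef b m0 == fcoef a m0) R).
set u := count _ R; set v := count (predC _) R.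
have <- : v = count (fun b => (b != a) && (fps_val (a - b) == m0)) R.
  by apply: eq_in_count => b hb; rewrite dist_eq.
by rewrite addnK.
Qed.

Lemma exists_lead_neq : (0 < size R)%N ->
  exists a b, [/\ a \in R, b \in R & fcoef b m0 != fcoef a m0].
Proof.
move=> R0; have [_ _ hD _] := bR; have aR := mem_nth 0 R0.
have := hD _ aR m0; set a := nth 0 R 0 in aR * => h.
have : has (fun b => (b != a) && (fps_val (a - b) == m0)) R by rewrite has_count h.
by case/hasP => b hb; rewrite dist_eq // => ne; exists a, b.
Qed.

(** Two roots differ at T^m0, so one of them has a non-zero coefficient there, and m0 is its first
    exponent not divisible by e. By the condition on [M] the same holds for every root. *)
Lemma lead_neq0 : (0 < size R)%N -> ~~ (e %| m0)%N -> {in R, forall r, fcoef r m0 != 0}.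
Proof.
move=> R0 em r rR; have [_ _ _ hM] := bR.
have [r0 [hr0 nz]] : exists r0, r0 \in R /\ fcoef r0 m0 != 0.
  have [a [b [aR bR' ne]]] := exists_lead_neq R0.
  case: (eqVneq (fcoef b m0) 0) => [b0|nb]; last by exists b.
  by exists a; split=> //; rewrite eq_sym -b0.
have : first_not_div e m0 (fcoef r0).
  by split=> // i im; rewrite (root_low hr0 im) eqxx.
by rewrite (hM r0 hr0 e m0 (dvdnn e)) -(hM r rR e m0 (dvdnn e)) => -[].
Qed.

End RootList.

Lemma first_not_div_shift (L : nmodType) dd m0 (a a' : nat -> L) n :
  (dd %| m0)%N -> (forall i, (i < m0)%N -> a i = 0) ->
  (forall j, ~~ (dd %| j)%N -> (a' j != 0) = (a (m0 + j)%N != 0)) ->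
  first_not_div dd n a' <-> first_not_div dd (m0 + n) a.
Proof.
move=> dm lo h; split=> -[h1 h2 h3].
  split; rewrite ?dvdn_addr //; first by rewrite -h.
  move=> i ilt; case: (ltnP i m0) => [/lo ->|le]; first by rewrite eqxx.
  rewrite -(subnKC le) dvdn_addr //; case: (boolP (dd %| i - m0)%N) => // nd; rewrite -h // => nz.
  by case/negP: nd; apply: (h3 _ _ nz); rewrite ltn_subLR.
have nd : ~~ (dd %| n)%N by move: h2; rewrite dvdn_addr.
split; rewrite ?h // => i ilt nz; apply: contraT => ndi.
by move: (h3 (m0 + i)%N); rewrite ltn_add2l -h // dvdn_addr // (negPf ndi) => /(_ ilt nz).
Qed.

Lemma tschirnhausen_roots (K : fieldType) (L : fieldType) (A : comNzRingType)
    (kappa : K -> A) (phi : {rmorphism A -> L}) (iotaL : {rmorphism K -> L}) e (G : {poly fps A}) R N :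
  (forall x, phi (kappa x) = iotaL x) -> (0 < e)%N -> (0 < N)%N -> N%:R != 0 :> K ->
  size G = N.+1 -> map_poly (fsub phi 1 e) G = \prod_(r <- R) ('X - r%:P) -> size R = N ->
  let R' := [seq r + tsch_shift kappa phi e G | r <- R] in
  map_poly (fsub phi 1 e) (tschirnhausen kappa G) = \prod_(r <- R') ('X - r%:P) /\
  \sum_(r <- R') r = 0.
Proof.
move=> hk e0 N0 nN sG EG sR R'; split.
  rewrite map_tschirnhausen EG (rmorph_prod (comp_poly _)) /R' big_map; apply: eq_bigr => r _ /=.
  by rewrite comp_polyB comp_polyX comp_polyC rmorphD opprD addrA addrAC.
rewrite /R' big_map big_split /= big_const_seq count_predT iter_addr_0 sR.
have hR : fsub phi 1 e G`_N.-1 = - \sum_(r <- R) r.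
  by rewrite -coefPn_prod_XsubC ?sR -?lt0n // -EG coef_map.
rewrite /tsch_shift sG (rmorphM (fsub phi 1 e)) /= fsubC hk fmorphV rmorph_nat -mulrnAl -[_ *+ N]mulr_natl.
rewrite -(rmorph_nat (@fpsC L)) -rmorphM /= divff; last by rewrite -(rmorph_nat iotaL) fmorph_eq0.
by rewrite rmorph1 mul1r hR subrr.
Qed.

Section Homogenization.
Variables (A : comNzRingType) (m : nat).
Implicit Types p : {poly A}.

(** p(y / x^m) x^(m n). The degree n is given separately from the size of p, so that products add
    degrees even when leading coefficients multiply to zero. *)
Definition homog n p : {poly fps A} := \poly_(k < n.+1) (fpsC p`_k * fpsX ^+ (m * (n - k))).

Lemma homogM n n' p p' : (size p <= n.+1)%N -> (size p' <= n'.+1)%N ->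
  homog n p * homog n' p' = homog (n + n') (p * p').
Proof.
move=> sp sp'; apply/polyP => k; rewrite coefM coef_poly.
have E (j : 'I_k.+1) : (homog n p)`_j * (homog n' p')`_(k - j) =
    fpsC (p`_j * p'`_(k - j)) * fpsX ^+ (m * (n + n' - k)).
  rewrite !coef_poly !ltnS rmorphM; case: leqP => [jn|jn]; last first.
    by rewrite [p`_j]nth_default ?rmorph0 ?mul0r // (leq_trans sp).
  case: leqP => [jn'|jn']; last first.
    by rewrite [p'`_ _]nth_default ?rmorph0 ?mulr0 ?mul0r // (leq_trans sp').
  rewrite mulrACA -exprD -mulnDr; congr (_ * fpsX ^+ (m * _)).
  by have := ltn_ord j; lia.
under eq_bigr => j _ do rewrite E.
rewrite -mulr_suml -rmorph_sum -coefM; case: ltnP => // h.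
rewrite nth_default ?rmorph0 ?mul0r //; apply: leq_trans (size_polyMleq _ _) _.
by apply: leq_trans h; rewrite -!subn1 leq_subLR add1n -addSn -addnS leq_add.
Qed.

Lemma homogX l p n : (size p <= l.+1)%N -> homog l p ^+ n = homog (l * n) (p ^+ n).
Proof.
move=> sp; elim: n => [|n IH].
  rewrite !expr0 muln0; apply/polyP => i; rewrite coef_poly !coef1.
  case: i => [|k]; last by rewrite ltnS ltn0.
  by rewrite ltnSn subnn muln0 expr0 mulr1 rmorph_nat.
rewrite exprS IH homogM //; first by rewrite -exprS mulnS.
elim: n {IH} => [|n IH]; first by rewrite expr0 size_poly1.
rewrite exprS (leq_trans (size_polyMleq _ _)) // mulnS; move: IH sp; lia.
Qed.

Lemma edge_polyE p q l : size p = l.+1 -> edge_poly p q m = homog l p \Po 'X^q.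
Proof.
move=> sp; rewrite /edge_poly /homog sp /= poly_def (raddf_sum (comp_poly _)).
by apply: eq_bigr => k _ /=; rewrite comp_polyZ comp_Xn_poly -exprM mul_polyC.
Qed.

End Homogenization.

Lemma bezout_exists q m : (0 < q)%N -> coprime q m -> exists s t, (q * s = m * t + 1)%N /\ (t < q)%N.
Proof.
move=> q0 /eqP cop; have [t tq] := Bezoutl m q0; rewrite cop => /dvdnP[s Es].
by exists s, t; split=> //; rewrite mulnC -Es addnC mulnC.
Qed.

Lemma size_roots (A : comNzRingType) (L : fieldType) (phi : {rmorphism A -> L}) (H : {poly fps A})
    e N R : H \is monic -> size H = N.+1 ->
  map_poly (fsub phi 1 e) H = \prod_(r <- R) ('X - r%:P) -> size R = N.
Proof.
move=> mH sH E; have := congr1 (fun p : {poly fps L} => size p) E.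
by rewrite size_map_monic // size_prod_XsubC sH => -[].
Qed.

Section LowerEdge.
Variables (L : fieldType) (A : comNzRingType) (phi : {rmorphism A -> L}).
Variables (H : {poly fps A}) (q m e' : nat) (R : seq (fps L)).
Hypotheses (q0 : (0 < q)%N) (e'0 : (0 < e')%N).
Hypothesis EH : map_poly (fsub phi 1 (q * e')) H = \prod_(r <- R) ('X - r%:P).
Hypothesis low : {in R, forall r i, (i < m * e')%N -> fcoef r i = 0}.

(** Write each root as T^(m e') r'. With N roots, the coefficient of y^i is T^(m e' (N - i)) times
    that of the product of the y - r'. It vanishes below the line q j + m i = m N, and on the line
    only the constant terms of the r' matter. *)
Lemma edge_coef i j :
  phi (fcoef H`_i j) = if (q * j + m * i < m * size R)%N then 0
    else fcoef (\prod_(r <- R) ('X - (fshift (m * e') r)%:P))`_i ((q * j + m * i - m * size R) * e').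
Proof.
have E := coef_prod_scale (fpsX ^+ (m * e')) [seq fshift (m * e') r | r <- R] i.
rewrite !big_map size_map in E.
have EH' : \prod_(r <- R) ('X - (fpsX ^+ (m * e') * fshift (m * e') r)%:P) = map_poly (fsub phi 1 (q * e')) H.
  by rewrite EH big_seq [RHS]big_seq; apply: eq_bigr => r hr; rewrite fshiftK //; apply: low.
rewrite EH' coef_map mulrC -!exprM /= in E.
(* This is the exponent of T in x^j T^(m e' i), where x = T^(q e'). *)
have := congr1 (fun f => fcoef f ((q * j + m * i) * e')) E.
have qe0 : (0 < q * e')%N by rewrite muln_gt0 q0.
rewrite !fcoef_Xn_mul.
have -> : ((q * j + m * i) * e' < m * e' * i)%N = false by apply/negbTE; rewrite -leqNgt; nia.
have -> : ((q * j + m * i) * e' - m * e' * i = j * (q * e'))%N by nia.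
rewrite fcoef_fsub // dvdn_mull // mulnK // expr1n mulr1 => ->.
have -> : (m * e' * size R = m * size R * e')%N by lia.
by rewrite ltn_pmul2r // mulnBl.
Qed.

Lemma edge_below i j : (q * j + m * i < m * size R)%N -> phi (fcoef H`_i j) = 0.
Proof. by move=> h; rewrite edge_coef h. Qed.

Lemma edge_on i j : (q * j + m * i = m * size R)%N ->
  phi (fcoef H`_i j) = (\prod_(c <- [seq fcoef r (m * e') | r <- R]) ('X - c%:P))`_i.
Proof.
move=> h; rewrite edge_coef h ltnn subnn mul0n -[fcoef _ 0]/(ev0 _) -coef_map.
rewrite (rmorph_prod (map_poly (@ev0 L))) big_map; apply: (congr1 (fun p : {poly L} => p`_i)); apply: eq_bigr => r _.
by rewrite rmorphB /= map_polyX map_polyC /= /ev0 fcoefE add0n.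
Qed.

End LowerEdge.

Section Step.
Variables (K : fieldType) (L : closedFieldType) (iotaL : {rmorphism K -> L}).
Variables (A : comNzRingType) (kappa : {rmorphism K -> A}) (H : {poly fps A}) (N : nat).
Variables (q m e' : nat) (D : nat -> nat) (M : nat -> nat -> Prop) (w : L).
Hypotheses (gA : good_ring iotaL kappa) (mH : H \is monic) (sH : size H = N.+1) (N1 : (1 < N)%N).
Hypothesis char : forall n, (0 < n <= N)%N -> n%:R != 0 :> K.
Hypotheses (prw : (q * e').-primitive_root w) (cop : coprime q m).
Notation roots_of phi R := (map_poly (fsub phi 1 (q * e')) H = \prod_(r <- R) ('X - r%:P)).
Hypothesis inv : forall phi : {rmorphism A -> L}, over iotaL kappa phi ->
  exists R, roots_of phi R /\ balanced_roots (q * e') D M R.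
Hypotheses (Dm0 : (0 < D (m * e'))%N) (Dlt : forall v, (v < m * e')%N -> D v = 0%N).

Let qe0 : (0 < q * e')%N := prim_order_gt0 prw.
Let q0 : (0 < q)%N.
Proof. by move: qe0; rewrite muln_gt0 => /andP[]. Qed.
Let e'0 : (0 < e')%N.
Proof. by move: qe0; rewrite muln_gt0 => /andP[]. Qed.
Notation N' := (N - D (m * e'))%N.

Lemma charL n : (0 < n <= N)%N -> n%:R != 0 :> L.
Proof. by move=> h; rewrite -(rmorph_nat iotaL) fmorph_eq0 char. Qed.

Lemma roots_low (phi : {rmorphism A -> L}) R : roots_of phi R -> balanced_roots (q * e') D M R ->
  {in R, forall r i, (i < m * e')%N -> fcoef r i = 0}.
Proof.
move=> E bR r rR i; apply: (root_low bR) => //.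
by rewrite (size_roots mH sH E) charL // leqnn (ltnW N1).
Qed.

Lemma edge_structure (phi : {rmorphism A -> L}) R : roots_of phi R -> balanced_roots (q * e') D M R ->
  let cs := [seq fcoef r (m * e') | r <- R] in
  let rs := undup [seq c ^+ q | c <- cs] in
  [/\ \prod_(c <- cs) ('X - c%:P) = ((\prod_(r <- rs) ('X - r%:P)) \Po 'X^q) ^+ N',
      N = (q * size rs * N')%N,
      (1 < q)%N -> 0 \notin rs,
      forall c, c ^+ q \in rs -> count_mem c cs = N'
    & exists2 c, c \in cs & c != 0].
Proof.
move=> E bR cs rs; have sR := size_roots mH sH E.
have R0 : (0 < size R)%N by rewrite sR ltnW.
have nR : (size R)%:R != 0 :> L by rewrite sR charL // leqnn (ltnW N1).
have hcount : {in cs, forall c, count_mem c cs = N'}.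
  move=> _ /mapP[a aR ->]; rewrite count_map -sR -(count_lead bR Dlt aR).
  by apply: eq_count => b.
have prz : q.-primitive_root (w ^+ (m * e')).
  have := exp_prim_root prw (m * e'); rewrite -muln_gcdl gcdnC (eqP cop) mul1n mulnK //.
(* T to w T permutes the roots and multiplies their coefficient at T^(m e') by w^(m e'). *)
have csz : {in cs, forall c, w ^+ (m * e') * c \in cs}.
  move=> _ /mapP[r rR ->]; apply/mapP; exists (fscale w r); last by rewrite fcoef_scale mulrC.
  rewrite -root_prod_XsubC -E.
  have := rmorph_root (fscale w) (_ : root (map_poly (fsub phi 1 (q * e')) H) r).
  rewrite map_fscale_fsub // mul1r (prim_expr_order prw); apply.
  by rewrite E root_prod_XsubC.
have cs0 : (1 < q)%N -> {in cs, forall c, c != 0}.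
  move=> q1 _ /mapP[r rR ->]; apply: (lead_neq0 bR nR Dm0 Dlt R0) => //.
  rewrite dvdn_pmul2r //; apply/negP => qm; move: cop; rewrite /coprime (gcdn_idPl qm).
  by rewrite gtn_eqF.
have [h1 h2] := prod_XsubC_power prz hcount cs0 csz.
split=> //.
- by rewrite -h2 size_map sR.
- move=> q1; rewrite mem_undup; apply/mapP => -[c /(cs0 q1) nc /esym/eqP].
  by rewrite expf_eq0 (negPf nc) andbF.
- move=> c; rewrite mem_undup => /mapP[c' hc' Ec]; apply: hcount.
  exact: (root_of_unity_orbit prz cs0 csz hc').
have [a [b [aR bR' ne]]] := exists_lead_neq bR Dm0 Dlt R0.
case: (eqVneq (fcoef b (m * e')) 0) => [b0|nb]; last first.
  by exists (fcoef b (m * e')) => //; apply/mapP; exists b.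
by exists (fcoef a (m * e')); [apply/mapP; exists a | rewrite eq_sym -b0].
Qed.

Lemma below_edge i j : (q * j + m * i < m * N)%N -> fcoef H`_i j = 0.
Proof.
move=> h; apply: (proj1 gA) => phi hphi; have [R [E bR]] := inv hphi.
by apply: (edge_below q0 e'0 E (roots_low E bR)); rewrite (size_roots mH sH E).
Qed.

Lemma step_poly : exists P l,
  [/\ P \is monic, size P = l.+1, (0 < l)%N, N = (q * l * N')%N & pseudo_degenerated H q m P N'] /\
  forall (phi : {rmorphism A -> L}) R, over iotaL kappa phi ->
    roots_of phi R -> balanced_roots (q * e') D M R ->
    exists rs, [/\ uniq rs, map_poly phi P = \prod_(r <- rs) ('X - r%:P), (1 < q)%N -> 0 \notin rs &
      forall c, c ^+ q \in rs -> count_mem c [seq fcoef r (m * e') | r <- R] = N'].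
Proof.
(* Any one morphism gives l; since N = q l N', all the others have the same number of distinct q-th
   powers. *)
have [phi0 hphi0] := good_over gA; have [R0 [E0 bR0]] := inv hphi0.
have /= := edge_structure E0 bR0; set cs0 := map _ R0; set rs0 := undup _.
case=> F1 F2 F3 F4 [c0 hc0 nc0].
set l := size rs0 in F2.
have [l0 N'0] : (0 < l /\ 0 < N')%N by have := ltnW N1; rewrite {1}F2 !muln_gt0 => /andP[/andP[]].
have sl (phi : {rmorphism A -> L}) R : roots_of phi R -> balanced_roots (q * e') D M R ->
    size (undup [seq c ^+ q | c <- [seq fcoef r (m * e') | r <- R]]) = l.
  move=> E bR; have [_ h _ _ _] := edge_structure E bR.
  by apply/eqP; rewrite -(eqn_pmul2l q0) -(eqn_pmul2r N'0) -h -F2.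
(* The boundary polynomial in the variable Z = y^q / x^m: the point of the edge with abscissa q k
   has ordinate m (l N' - k). *)
pose b := \poly_(k < (l * N').+1) fcoef H`_(q * k) (m * (l * N' - k)).
have bphi (phi : {rmorphism A -> L}) R : over iotaL kappa phi -> roots_of phi R ->
    balanced_roots (q * e') D M R ->
    map_poly phi b = (\prod_(r <- undup [seq c ^+ q | c <- [seq fcoef r (m * e') | r <- R]]) ('X - r%:P)) ^+ N'.
  move=> hphi E bR; have [h1 h2 _ _ _] := edge_structure E bR.
  set Q := \prod_(r <- undup _) _ in h1 *.
  have mQ : Q \is monic by apply: monic_prod_XsubC.
  have sQ : size (Q ^+ N') = (l * N').+1.
    by rewrite size_monic_exp // /Q size_prod_XsubC (sl phi R).
  apply/polyP => k; rewrite coef_map /= coef_poly; case: ltnP => hk; last first.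
    by rewrite rmorph0 nth_default ?sQ.
  rewrite (edge_on q0 e'0 E (roots_low E bR)); last first.
    by rewrite (size_roots mH sH E) [in RHS]F2 [(m * (q * k))%N]mulnCA -mulnDr -mulnDr subnK // -mulnA mulnCA.
  rewrite h1 -(rmorphXn (comp_poly 'X^q)) /= coef_comp_poly_Xn // dvdn_mulr // mulKn //.
have hb : b`_(l * N') = 1.
  rewrite coef_poly ltnSn subnn muln0 mulnA -F2 -[N]/(N.+1.-1) -sH -lead_coefE (monicP mH).
  by rewrite fcoef1.
have sb : size b = (l * N').+1.
  by apply: size_poly_eq; move: hb; rewrite coef_poly ltnSn /= => ->; rewrite oner_neq0.
have mb : b \is monic by rewrite monicE lead_coefE sb /= hb.
have nu : N'%:R * kappa (N'%:R)^-1 = 1.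
  rewrite -(rmorph_nat kappa) -rmorphM divff ?rmorph1 // char // N'0 leq_subr //.
(* Under each phi, b is an N'-th power, and uniqueness of approximate roots identifies the image of
   P with its root. That b = P^N' exactly is then tested by the morphisms. *)
have [P [mP sP hP]] := approx_root N'0 nu mb sb.
have Pphi (phi : {rmorphism A -> L}) R : over iotaL kappa phi -> roots_of phi R ->
    balanced_roots (q * e') D M R ->
    map_poly phi P = \prod_(r <- undup [seq c ^+ q | c <- [seq fcoef r (m * e') | r <- R]]) ('X - r%:P).
  move=> hphi E bR; apply: (approx_root_uniq (l := l) (n := N')).
  - by rewrite charL // N'0 leq_subr.
  - exact: monic_map.
  - exact: monic_prod_XsubC.
  - by rewrite size_map_monic.
  - by rewrite size_prod_XsubC (sl phi R).
  rewrite -(bphi phi R) // -rmorphXn -rmorphB /=.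
  by apply: leq_trans (size_poly _ _) hP.
have bP : b = P ^+ N'.
  apply: (good_poly_eq gA) => phi hphi; have [R [E bR]] := inv hphi.
  by rewrite rmorphXn /= (bphi phi R) // (Pphi phi R).
have data (phi : {rmorphism A -> L}) R : over iotaL kappa phi ->
    roots_of phi R -> balanced_roots (q * e') D M R ->
    exists rs, [/\ uniq rs, map_poly phi P = \prod_(r <- rs) ('X - r%:P), (1 < q)%N -> 0 \notin rs &
      forall c, c ^+ q \in rs -> count_mem c [seq fcoef r (m * e') | r <- R] = N'].
  move=> hphi E bR; have [_ _ h3 h4 _] := edge_structure E bR.
  by eexists; split; [apply: undup_uniq | apply: Pphi| apply: h3 | apply: h4].
exists P, l; split=> //; split=> //; split=> //.
- rewrite /lower_edge sH /=; split=> //; split=> //; right; split.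
    (* If only the top coefficient of b survived, its image would have 0 as only root, whereas c0^q
       is a non-zero one. *)
    have [k hk nz] : exists2 k, (k < l * N')%N & b`_k != 0.
      apply: contrapT => no.
      have Eb : map_poly phi0 b = 'X^(l * N').
        apply/polyP => k; rewrite coef_map coefXn /=; case: ltngtP => [lt|gt|->] /=.
        - suff -> : b`_k = 0 by rewrite rmorph0.
          by apply/eqP/negPn/negP => nz; apply: no; exists k.
        - by rewrite nth_default ?sb // rmorph0.
        rewrite -[(l * N')%N]/((l * N').+1.-1) -sb -lead_coefE (monicP mb) rmorph1 //.
      have := Eb; rewrite (bphi phi0 R0) // -/cs0 -/rs0 => /(congr1 (fun p : {poly L} => p.[c0 ^+ q])).
      rewrite hornerXn horner_exp (rootP _) ?expr0n ?(gtn_eqF N'0); last first.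
        by rewrite root_prod_XsubC mem_undup; apply/mapP; exists c0.
      by rewrite mulr0n => /esym/eqP; rewrite -exprM expf_eq0 (negPf nc0) andbF.
    have hkq : (q * k < N)%N by rewrite F2 -mulnA ltn_pmul2l.
    have EN : (m * (N - q * k) = m * (l * N' - k) * q)%N.
      by rewrite [in LHS]F2 -mulnA -mulnBr; lia.
    move: nz; rewrite coef_poly ltnS (ltnW hk) => nz.
    exists (q * k)%N; split=> //; first exact: fps_nz nz.
    rewrite EN; congr (_ * _)%N; apply: fps_val_eq => // j hj; apply: below_edge.
    have -> : (m * N = m * (N - q * k) + m * (q * k))%N by rewrite -mulnDr subnK // ltnW.
    by rewrite EN ltn_add2r mulnC ltn_pmul2r.
  move=> i iN nz; rewrite leqNgt; apply/negP => lt.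
  have := fps_val_nz nz; rewrite below_edge ?eqxx //.
  have -> : (m * N = m * (N - i) + m * i)%N by rewrite -mulnDr subnK // ltnW.
  by rewrite ltn_add2r mulnC.
- apply: (sqfree_of_roots gA mP); first by rewrite sP.
  move=> phi hphi; have [R [E bR]] := inv hphi.
  by have [rs [h1 h2 _ _]] := data phi R hphi E bR; exists rs.
- move=> q1; apply: (proj2 gA) => phi hphi; have [R [E bR]] := inv hphi.
  have [rs [_ h2 h3 _]] := data phi R hphi E bR.
  have := h3 q1; rewrite -root_prod_XsubC -h2 rootE horner_coef0 coef_map /=.
  by [].
rewrite (edge_polyE _ _ sP) -rmorphXn /= homogX ?sP // -bP.
apply/polyP => i; rewrite coef_comp_poly_Xn // !coef_poly sH /=.
(* On the line q j + m i = m N, where q divides N and is coprime to m, q divides i. *)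
case: (boolP (q %| i)%N) => [/dvdnP[k ->]|ndv]; last first.
  case: ltnP => // iN; apply: fps_ext => j; rewrite fcoefE fcoef0; case: eqP => // E.
  case/negP: ndv; rewrite -(Gauss_dvdr _ cop).
  have : (q %| m * N)%N by rewrite F2 -!mulnA mulnCA dvdn_mulr.
  by rewrite -E dvdn_addr // dvdn_mulr.
rewrite mulnK // ltnS [X in (_ <= X)%N]F2 [(k * q)%N]mulnC -!mulnA leq_pmul2l // ltnS.
case: leqP => hk //; apply: fps_ext => j; rewrite fcoefE fcoefCM.
rewrite -[fpsX ^+ _]mulr1 fcoef_Xn_mul fcoef1.
have -> : (q * j + m * (q * k) == m * N)%N = (j == m * (l * N' - k))%N.
  have -> : (m * N = q * (m * (l * N' - k)) + m * (q * k))%N by rewrite [in LHS]F2; nia.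
  by rewrite eqn_add2r eqn_pmul2l.
case: (ltngtP j (m * (l * N' - k))) => [_|h|->]; rewrite ?mulr0 //.
  by rewrite subn_eq0 leqNgt h mulr0.
by rewrite subnn eqxx mulr1.
Qed.

End Step.

(** * One step of the procedure *)

Lemma prod_const_seq (R : comNzRingType) (I : Type) (s : seq I) (p : pred I) (x : R) :
  \prod_(i <- s | p i) x = x ^+ count p s.
Proof.
elim: s => [|i s IH]; first by rewrite big_nil expr0.
by rewrite big_cons IH /=; case: (p i); rewrite ?exprS.
Qed.

(* The root of G below the root r of H_k; this inverts lift_branch. *)
Definition recentred (L : fieldType) m0 (lam c : L) (r : fps L) : fps L :=
  fshift m0 (fscale lam r) - fpsC c.

Lemma fcoef_recentred (L : fieldType) m0 (lam c : L) r n :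
  fcoef (recentred m0 lam c r) n = fcoef r (n + m0) * lam ^+ (n + m0) - (if n == 0%N then c else 0).
Proof. by rewrite fcoefB fcoefE fcoef_scale. Qed.

(** The substitution turns each factor y - r of H into T^(m e') times y minus the recentred root;
    these powers of T cancel against the power of x in front of V. *)
Lemma recentred_roots (A A' : comNzRingType) (L : fieldType) (iota : {rmorphism A -> A'})
    (phi : {rmorphism A' -> L}) (z : A') (H : {poly fps A}) (V : {poly fps A'}) q m s t e' (lam : L) R :
  (0 < q)%N -> (0 < e')%N ->
  (map_poly (fsub iota (z ^+ t) q) H) \Po ((fpsX ^+ m)%:P * ('X + (fpsC (z ^+ s))%:P))
    = (fpsX ^+ (m * size R))%:P * V ->
  map_poly (fsub (phi \o iota) 1 (q * e')) H = \prod_(r <- R) ('X - r%:P) ->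
  {in R, forall r i, (i < m * e')%N -> fcoef r i = 0} ->
  lam ^+ (q * e') = phi z ^+ t ->
  map_poly (fsub phi 1 e') V = \prod_(r <- R) ('X - (recentred (m * e') lam (phi z ^+ s) r)%:P).
Proof.
move=> q0 e0 EW EH low hlam.
have := congr1 (map_poly (fsub phi 1 e')) EW; rewrite map_comp_poly map_fsub_comp // expr1n mulr1.
rewrite (rmorphXn phi) /= -hlam -[lam ^+ _]mul1r -map_fscale_fsub ?muln_gt0 ?q0 // EH.
rewrite (rmorphM (map_poly (fsub phi 1 e'))) [map_poly _ (_ * V)]rmorphM rmorphD /= map_polyX !map_polyC /=.
rewrite fsubC !(rmorphXn (fsub phi 1 e')) /= fsubX // rmorph1 mul1r -!exprM (rmorphXn phi) /=.
rewrite (rmorph_prod (map_poly (fscale lam))) (rmorph_prod (comp_poly _)).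
have -> : \prod_(r <- R) (comp_poly ((fpsX ^+ (e' * m))%:P * ('X + (fpsC (phi z ^+ s))%:P))
      (map_poly (fscale lam) ('X - r%:P)))
   = \prod_(r <- R) ((fpsX ^+ (e' * m))%:P * ('X - (recentred (m * e') lam (phi z ^+ s) r)%:P)).
  rewrite big_seq [RHS]big_seq; apply: eq_bigr => r hr.
  rewrite rmorphB /= map_polyX map_polyC /= comp_polyB comp_polyX comp_polyC.
  have {1}<- : fpsX ^+ (e' * m) * fshift (m * e') (fscale lam r) = fscale lam r.
    rewrite mulnC fshiftK // => i hi; rewrite fcoef_scale (low r hr) ?mul0r //.
  rewrite /recentred polyCB polyCM; ring.
rewrite big_split /= prod_const_seq count_predT -polyC_exp -exprM -mulnA.
move/mulfI => /(_ _)/esym; apply; rewrite polyC_eq0 expf_neq0 //.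
by apply: (@fps_nz _ _ 1); rewrite /fpsX fcoefE oner_neq0.
Qed.

Section StepQuotient.
Variables (K : fieldType) (L : closedFieldType) (iotaL : {rmorphism K -> L}).
Variables (A : comNzRingType) (kappa : {rmorphism K -> A}) (H : {poly fps A}) (N : nat).
Variables (q m e' : nat) (D : nat -> nat) (M : nat -> nat -> Prop) (w : L).
Hypotheses (gA : good_ring iotaL kappa) (mH : H \is monic) (sH : size H = N.+1) (N1 : (1 < N)%N).
Hypothesis char : forall n, (0 < n <= N)%N -> n%:R != 0 :> K.
Hypotheses (prw : (q * e').-primitive_root w) (cop : coprime q m).
Hypothesis inv : forall phi : {rmorphism A -> L}, over iotaL kappa phi ->
  exists R, map_poly (fsub phi 1 (q * e')) H = \prod_(r <- R) ('X - r%:P) /\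
    balanced_roots (q * e') D M R.
Hypothesis Dlt : forall v, (v < m * e')%N -> D v = 0%N.
Notation N' := (N - D (m * e'))%N.
Variables (A' : comNzRingType) (iota : {rmorphism A -> A'}) (z : A') (P : {poly A}) (s t : nat).
Hypotheses (N'0 : (0 < N')%N) (hz : (map_poly iota P).[z] = 0).
Hypothesis hP : forall (phi : {rmorphism A -> L}) R, over iotaL kappa phi ->
    map_poly (fsub phi 1 (q * e')) H = \prod_(r <- R) ('X - r%:P) -> balanced_roots (q * e') D M R ->
    exists rs, [/\ uniq rs, map_poly phi P = \prod_(r <- rs) ('X - r%:P), (1 < q)%N -> 0 \notin rs &
      forall c, c ^+ q \in rs -> count_mem c [seq fcoef r (m * e') | r <- R] = N'].
Hypotheses (gA' : good_ring iotaL (iota \o kappa)).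
Hypotheses (bez : (q * s = m * t + 1)%N) (ltq : (t < q)%N).

Let qe0 : (0 < q * e')%N := prim_order_gt0 prw.
Let q0 : (0 < q)%N.
Proof. by move: qe0; rewrite muln_gt0 => /andP[]. Qed.
Let e'0 : (0 < e')%N.
Proof. by move: qe0; rewrite muln_gt0 => /andP[]. Qed.

(** c0 is a q-th root of psi z. Rescaled by lam it becomes psi z^s, so the N' roots with this
    leading coefficient are those whose recentred series has no constant term. *)
Lemma local_data (psi : {rmorphism A' -> L}) : over iotaL (iota \o kappa) psi ->
  exists R lam c0, [/\ map_poly (fsub (psi \o iota) 1 (q * e')) H = \prod_(r <- R) ('X - r%:P),
    balanced_roots (q * e') D M R, lam != 0, lam ^+ (q * e') = psi z ^+ t
    & [/\ size R = N, {in R, forall r i, (i < m * e')%N -> fcoef r i = 0},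
      count (fun r => fcoef r (m * e') == c0) R = N'
      & forall c, (c * lam ^+ (m * e') - psi z ^+ s == 0) = (c == c0)]].
Proof.
move=> hpsi; pose phi : {rmorphism A -> L} := psi \o iota.
have hphi : over iotaL kappa phi by move=> x; apply: hpsi.
have [R [E bR]] := inv hphi; have [rs [urs Ers rs0 hcount]] := hP hphi E bR.
have hrho : psi z \in rs.
  rewrite -root_prod_XsubC -Ers /root /phi map_poly_comp horner_map hz rmorph0 eqxx //.
have nrho : (1 < q)%N -> psi z != 0 by move=> /rs0; apply: contraNneq => <-.
have [lam hlam] := closed_nth_root (psi z ^+ t) qe0.
have lam0 := bezout_root_neq0 qe0 ltq hlam nrho.
have sR := size_roots mH sH E.
pose c0 := psi z ^+ s * lam^-1 ^+ (m * e').
exists R, lam, c0; split=> //; split=> //.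
- exact: (roots_low iotaL mH sH N1 char Dlt E bR).
- rewrite -(hcount c0); first by rewrite count_map; apply: eq_count.
  (* Lifting the zero series with c' = 0 computes c0^q = psi z. *)
  have h0 : fcoef (0 - 0 : fps L) 0 = 0 by rewrite subr0.
  have := lift_lead_pow q0 e'0 cop prw bez ltq hlam nrho h0.
  by rewrite lift_lead // => ->.
move=> c; rewrite subr_eq0 /c0 exprVn; apply/eqP/eqP => [<-|->].
  by rewrite mulfK // expf_neq0.
by rewrite divfK // expf_neq0.
Qed.

Let Hz := map_poly (fsub iota (z ^+ t) q) H.
(** H(z^t x^q, x^m y) divided by x^(m N). The shift is a true division because H has no term below
    its edge. *)
Definition blowup0 := \poly_(i < N.+1) fshift (m * N) (Hz`_i * fpsX ^+ m ^+ i).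
Definition blowup := blowup0 \Po ('X + (fpsC (z ^+ s))%:P).

Lemma blowupE : Hz \Po ((fpsX ^+ m)%:P * ('X + (fpsC (z ^+ s))%:P)) = (fpsX ^+ (m * N))%:P * blowup.
Proof.
have sHz : size Hz = N.+1 by rewrite size_map_monic.
have -> : Hz \Po ((fpsX ^+ m)%:P * ('X + (fpsC (z ^+ s))%:P))
    = (Hz \Po ((fpsX ^+ m)%:P * 'X)) \Po ('X + (fpsC (z ^+ s))%:P).
  by rewrite -comp_polyA comp_polyM comp_polyC comp_polyX.
have -> : Hz \Po ((fpsX ^+ m)%:P * 'X) = (fpsX ^+ (m * N))%:P * blowup0.
  rewrite comp_poly_scaleX sHz; apply/polyP => i; rewrite coefCM !coef_poly.
  case: ltnP => // _; last by rewrite mulr0.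
  rewrite fshiftK // => k hk; rewrite mulrC -exprM fcoef_Xn_mul; case: ltnP => // ik.
  case: ifP => _; last by rewrite fcoef0.
  rewrite fcoef_fsub //; case: ifP => // /dvdnP[j Ej].
  rewrite (below_edge gA mH sH N1 char prw inv Dlt) ?rmorph0 ?mul0r // Ej mulnK //.
  by rewrite mulnC -Ej subnK.
by rewrite comp_polyM comp_polyC.
Qed.

Lemma blowup_monic : blowup \is monic /\ size blowup = N.+1.
Proof.
have mHz : Hz \is monic by apply: monic_map.
have sHz : size Hz = N.+1 by rewrite size_map_monic.
have lead : blowup0`_N = 1.
  rewrite coef_poly ltnSn -[X in Hz`_X]/(N.+1.-1) -sHz -lead_coefE (monicP mHz) mul1r -exprM.
  apply: (@fpsXn_inj _ (m * N)); rewrite /= fshiftK ?mulr1 // => i hi.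
  by rewrite -[fpsX ^+ _]mulr1 fcoef_Xn_mul hi.
have s0 : size blowup0 = N.+1.
  by apply: size_poly_eq; move: lead; rewrite coef_poly ltnSn /= => ->; rewrite oner_neq0.
have m0 : blowup0 \is monic by rewrite monicE lead_coefE s0 /= lead.
by have := monic_comp_XaddC (fpsC (z ^+ s)) m0; rewrite s0.
Qed.

(** At T = 0 each morphism sees N' recentred roots vanish and the others not. The morphisms detect
    zeros and units, so the factor X^N' and the invertibility of u at 0 hold over A' itself. *)
Lemma blowup_slice : exists u : {poly A'},
  [/\ u \is monic, size u = (N - N').+1, is_unit u`_0 & slice 0 blowup = u * 'X^N'].
Proof.
have [mV sV] := blowup_monic.
have N'N : (N' <= N)%N by apply: leq_subr.
have ev (psi : {rmorphism A' -> L}) : over iotaL (iota \o kappa) psi ->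
    exists Q : {poly L}, map_poly psi (slice 0 blowup) = Q * 'X^N' /\ Q`_0 != 0.
  move=> hpsi; have [R [lam [c0 [E bR lam0 hlam [sR low hcount hc0]]]]] := local_data hpsi.
  have := recentred_roots q0 e'0 _ E low hlam; rewrite sR => /(_ _ _ blowupE) EV.
  have -> : map_poly psi (slice 0 blowup) = map_poly (@ev0 L) (map_poly (fsub psi 1 e') blowup).
    apply/polyP => i; rewrite !coef_map /= coef_slice /ev0 fcoef_fsub // dvdn0 div0n.
    by rewrite expr0 mulr1.
  rewrite EV (rmorph_prod (map_poly (@ev0 L))) /=.
  have Er r : map_poly (@ev0 L) ('X - (recentred (m * e') lam (psi z ^+ s) r)%:P)
     = 'X - (fcoef r (m * e') * lam ^+ (m * e') - psi z ^+ s)%:P.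
    by rewrite rmorphB /= map_polyX map_polyC /= /ev0 fcoef_recentred add0n.
  under eq_bigr do rewrite Er.
  rewrite (bigID (fun r => fcoef r (m * e') == c0)) /=.
  exists (\prod_(r <- R | fcoef r (m * e') != c0)
     ('X - (fcoef r (m * e') * lam ^+ (m * e') - psi z ^+ s)%:P)); split.
    rewrite mulrC; congr (_ * _); rewrite -hcount.
    rewrite (eq_bigr (fun=> 'X)); last first.
      by move=> r; rewrite -hc0 => /eqP ->; rewrite subr0.
    by rewrite prod_const_seq.
  rewrite -horner_coef0 horner_prod prodf_seq_neq0.
  apply/allP => r _; apply/implyP => nr.
  by rewrite hornerXsubC sub0r oppr_eq0 hc0.
have low i : (i < N')%N -> (slice 0 blowup)`_i = 0.
  move=> hi; apply: (proj1 gA') => psi /ev[Q [E _]].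
  by rewrite -coef_map E coefMXn hi.
have s0 : size (slice 0 blowup) = N.+1.
  rewrite /slice -sV; apply: size_map_poly_id0.
  by rewrite (monicP mV) fcoef1 oner_neq0.
have m0 : slice 0 blowup \is monic.
  by rewrite monicE lead_coefE s0 coef_slice -[N.+1.-1]/(N.+1.-1) -sV -lead_coefE (monicP mV).
exists (drop_poly N' (slice 0 blowup)).
have E : slice 0 blowup = drop_poly N' (slice 0 blowup) * 'X^N'.
  rewrite -{1}[slice 0 blowup](poly_take_drop N') [take_poly _ _](_ : _ = 0) ?add0r //.
  by apply/polyP => i; rewrite coef_take_poly coef0; case: ltnP => // /low.
have sd : size (drop_poly N' (slice 0 blowup)) = (N - N').+1 by rewrite size_drop_poly s0 subSn.
split=> //.
  by rewrite monicE lead_coefE sd coef_drop_poly /= subnK // -[N in _`_N]/(N.+1.-1) -s0 -lead_coefE (monicP m0).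
rewrite coef_drop_poly add0n; apply: (proj2 gA') => psi /ev[Q [EQ nQ]].
by rewrite -coef_map EQ coefMXn ltnn subnn.
Qed.

(** The roots of G come from the roots of H with one common coefficient at T^(m e'). Their distances
    and first exponents decrease by m e', which gives the new [D] and [M]; the Tschirnhausen shift
    by a series in T^(e') preserves both. *)
Lemma step_quotient : exists U G : {poly fps A'},
  [/\ (map_poly (fps_subst iota (z ^+ t) q) H) \Po ((fpsX ^+ m)%:P * ('X + (fpsC (z ^+ s))%:P))
       = (fpsX ^+ (m * N))%:P * U * G,
     is_unit (fcoef U`_0 0), weierstrass G N' &
   forall psi : {rmorphism A' -> L}, over iotaL (iota \o kappa) psi ->
     exists R', map_poly (fsub psi 1 e') (tschirnhausen (iota \o kappa) G) = \prod_(r <- R') ('X - r%:P) /\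
     balanced_roots e' (fun v => if v == 0%N then 0%N else D (m * e' + v)%N)
       (fun dd n => M dd (m * e' + n)%N) R'].
Proof.
have [mV sV] := blowup_monic; have [u [mu su uu Eu]] := blowup_slice.
have N'N : (N' <= N)%N by apply: leq_subr.
have [U [G [EV U0 G0 mG sG]]] := hensel mV sV N'N mu su uu Eu.
exists U, G; split.
- by rewrite fsubE // blowupE EV mulrA.
- by rewrite -coef_slice U0.
- by split=> // i hi; rewrite -coef_slice G0 coefXn ltn_eqF.
move=> psi hpsi; have [R [lam [c0 [E bR lam0 hlam [sR low hcount hc0]]]]] := local_data hpsi.
have := recentred_roots q0 e'0 _ E low hlam; rewrite sR => /(_ _ _ blowupE) EV'.
have [uR _ hD hM] := bR.
pose C := [seq r <- R | fcoef r (m * e') == c0].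
pose f := recentred (m * e') lam (psi z ^+ s).
have fB r1 r2 : f r1 - f r2 = fshift (m * e') (fscale lam (r1 - r2)).
  by apply: fps_ext => n; rewrite fcoefB !fcoef_recentred fcoefE fcoef_scale fcoefB; ring.
have sinj : injective (fsub (idfun : L -> L) lam 1) by apply: fsub_inj.
have fval r1 r2 : r1 \in R -> r2 \in R -> r1 != r2 ->
    fps_val (r1 - r2) = (m * e' + fps_val (f r1 - f r2)%R)%N.
  move=> h1 h2 ne; rewrite fB -(fps_val_scale _ lam0) -fps_val_Xn.
    rewrite fshiftK // => i hi; rewrite fcoef_scale fcoefB (low _ h1) // (low _ h2) //.
    by rewrite subrr mul0r.
  have nz : fscale lam (r1 - r2) != 0.
    by rewrite -(rmorph0 (fscale lam)) (inj_eq sinj) subr_eq0.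
  apply: contra_neq nz => h; rewrite -(@fshiftK _ (m * e') (fscale lam (r1 - r2))) ?h ?mulr0 //.
  move=> i hi; rewrite fcoef_scale fcoefB (low _ h1) // (low _ h2) //.
  by rewrite subrr mul0r.
have finj : {in R &, injective f}.
  move=> r1 r2 h1 h2 Ef; apply/eqP/negPn/negP => ne.
  have : fscale lam (r1 - r2) = 0.
    rewrite -(@fshiftK _ (m * e') (fscale lam (r1 - r2))) -?fB ?Ef ?subrr ?mulr0 //.
    move=> i hi; rewrite fcoef_scale fcoefB (low _ h1) // (low _ h2) //.
    by rewrite subrr mul0r.
  rewrite -(rmorph0 (fscale lam)) => /sinj /eqP.
  by rewrite subr_eq0 (negPf ne).
have CR r : r \in C -> r \in R by rewrite mem_filter => /andP[].
have Clead r : r \in C -> fcoef r (m * e') = c0 by rewrite mem_filter => /andP[/eqP].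
have uC : uniq C by rewrite filter_uniq.
have sC : size C = N' by rewrite size_filter.
(* Roots with coefficient c0 recentre to roots of U G without constant term. They are not roots of
   U, which has an invertible value at x = y = 0, so they are roots of G, and their number is its
   degree. *)
have EG : map_poly (fsub psi 1 e') G = \prod_(r <- [seq f r | r <- C]) ('X - r%:P).
  apply: monic_roots; rewrite ?monic_map ?size_map_monic ?size_map ?sC ?sG //.
    by rewrite map_inj_in_uniq // => r1 r2 /CR h1 /CR h2; apply: finj.
  apply/allP => _ /mapP[r rC ->].
  have : root (map_poly (fsub psi 1 e') blowup) (f r).
    by rewrite EV' -(big_map f xpredT (fun x => 'X - x%:P)) root_prod_XsubC map_f // CR.
  rewrite EV rmorphM rootM => /orP[|//] /(rmorph_root (@ev0 L)).
  rewrite -map_poly_comp /=.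
  have -> : ev0 (f r) = 0.
    by rewrite /ev0 fcoef_recentred add0n; apply/eqP; rewrite hc0 Clead.
  rewrite rootE horner_coef0 coef_map /= /ev0 fcoef_fsub // dvdn0 div0n expr0 mulr1.
  rewrite -coef_slice U0; have [b Eb] := uu => /eqP h.
  have := congr1 psi Eb; rewrite rmorphM h mul0r rmorph1 => /eqP.
  by rewrite eq_sym oner_eq0.
have N'K : N'%:R != 0 :> K by rewrite char // N'0.
have := tschirnhausen_roots hpsi e'0 N'0 N'K sG EG; rewrite size_map sC => /(_ erefl).
set c := tsch_shift _ _ _ _; set R' := map _ _ => -[ER' SR'].
have memR' x : x \in R' -> exists2 r, r \in C & x = f r + c.
  by case/mapP => _ /mapP[r rC ->] ->; exists r.
exists R'; split=> //; split=> //.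
- rewrite map_inj_uniq; last exact: addIr.
  by rewrite map_inj_in_uniq // => r1 r2 /CR h1 /CR h2; apply: finj.
- move=> _ /memR'[a aC ->] v; have aR := CR a aC.
  rewrite /R' -map_comp count_map.
  transitivity (count (fun b => (b != a) && (fps_val (a - b) == (m * e' + v)%N)) C).
    apply: eq_in_count => b bC /=; have bR' := CR b bC.
    rewrite (inj_eq (@addIr _ c)) (inj_in_eq finj) //.
    case: (eqVneq b a) => //= ne; rewrite (fval a b) // 1?eq_sym // eqn_add2l.
    by rewrite (_ : f a + c - (f b + c) = f a - f b) // opprD addrACA subrr addr0.
  (* The roots kept agree at T^(m e'), so none of them are at distance m e' from each other; a root
     further than that from a is kept automatically. *)
  rewrite count_filter; cbv beta; case: (eqVneq v 0%N) => [->|v0].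
    rewrite addn0; apply/eqP; rewrite -leqn0 leqNgt -has_count; apply/hasPn => b bR' /=.
    rewrite -(Clead a aC) (dist_eq bR Dlt) //; by apply/negP => /andP[/negP h1 h2]; apply: h1.
  rewrite -(hD a aR); apply: eq_in_count => b bR' /=.
  rewrite andb_idr // => /andP[ne /eqP Ev].
  apply: contraT; rewrite -(Clead a aC) -(dist_eq bR Dlt aR bR') Ev.
  by rewrite -[X in (_ + v)%N == X]addn0 eqn_add2l (negPf v0) andbF.
move=> _ /memR'[a aC ->] dd n de; have aR := CR a aC.
rewrite -(hM a aR dd (m * e' + n)%N); last exact: dvdn_mull.
apply: first_not_div_shift => [||j ndj]; first exact: dvdn_mull.
  exact: low.
have nej : ~~ (e' %| j)%N by apply: contra ndj; apply: dvdn_trans.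
rewrite fcoefD tsch_shift_coef // addr0 fcoef_recentred ifF ?subr0.
  by rewrite addnC mulf_eq0 expf_eq0 (negPf lam0) andbF orbF.
by case: j nej {ndj} => //; rewrite dvdn0.
Qed.

End StepQuotient.

(** * From balanced factors to a run *)

Lemma balanced_run (K : fieldType) (L : closedFieldType) (iotaL : {rmorphism K -> L}) N :
  forall (A : comNzRingType) (kappa : {rmorphism K -> A}) (H : {poly fps A}) e D M (w : L),
  good_ring iotaL kappa -> H \is monic -> size H = N.+1 -> (0 < N)%N ->
  (forall n, (0 < n <= N)%N -> n%:R != 0 :> K) -> e.-primitive_root w ->
  (forall phi : {rmorphism A -> L}, over iotaL kappa phi ->
     exists R, map_poly (fsub phi 1 e) H = \prod_(r <- R) ('X - r%:P) /\ balanced_roots e D M R) ->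
  exists ds, pi_run kappa H ds 1.
Proof.
elim/ltn_ind: N => N IH A kappa H e D M w gA mH sH N0 char prw inv.
case: (ltngtP N 1) N0 => [|N1 _|N1 _]; [lia| |]; last first.
  by exists [::]; apply: pi_stop_one; rewrite sH N1.
have exD : exists v, (0 < D v)%N.
  have [phi hphi] := good_over gA; have [R [E [uR _ hD _]]] := inv phi hphi.
  have sR := size_roots mH sH E.
  have ne : nth 0 R 1 != nth 0 R 0 by rewrite nth_uniq ?sR // ltnW.
  exists (fps_val (nth 0 R 0 - nth 0 R 1)).
  rewrite -(hD (nth 0 R 0)) ?mem_nth ?sR ?(ltnW N1) // -has_count; apply/hasP.
  by exists (nth 0 R 1); rewrite ?mem_nth ?sR // ne eqxx.
case: (ex_minnP exD) => m0 Dm0 min0.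
have Dlt v : (v < m0)%N -> D v = 0%N.
  by move=> lt; apply/eqP; rewrite -leqn0 leqNgt; apply/negP => /min0; rewrite leqNgt lt.
have e0 := prim_order_gt0 prw.
(* With x = T^e the edge has slope -m0/e, and e' = gcd(e, m0) brings the fraction to lowest
   terms. *)
have [q [m [e' [Ee Em cop]]]] : exists q m e', [/\ e = (q * e')%N, m0 = (m * e')%N & coprime q m].
  exists (e %/ gcdn e m0)%N, (m0 %/ gcdn e m0)%N, (gcdn e m0).
  have g0 : (0 < gcdn e m0)%N by rewrite gcdn_gt0 e0.
  split; rewrite ?divnK ?dvdn_gcdl ?dvdn_gcdr // /coprime -(eqn_pmul2r g0) muln_gcdl mul1n.
  by rewrite !divnK ?dvdn_gcdl ?dvdn_gcdr.
subst e m0.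
have q0 : (0 < q)%N by move: e0; rewrite muln_gt0 => /andP[].
have [P [l [[mP sP l0 EN pd] hP]]] := step_poly gA mH sH N1 char prw cop inv Dm0 Dlt.
set N' := (N - D (m * e'))%N in EN pd hP.
have N'0 : (0 < N')%N by move: N1; rewrite EN => /ltnW; rewrite !muln_gt0 => /andP[].
have N'N : (N' < N)%N.
  rewrite ltn_neqAle leq_subr andbT; apply/eqP => E; move: Dm0.
  have : (D (m * e') <= N)%N by rewrite leqNgt; apply/negP => lt; move: N'0; rewrite /N'; lia.
  by rewrite /N' in E; lia.
have [s [t [bez ltq]]] := bezout_exists q0 cop.
have sP1 : (1 < size P)%N by rewrite sP.
have [A' [iota [z hq]]] := quotient_exists mP sP1.
have sepP (phi : {rmorphism A -> L}) : over iotaL kappa phi ->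
    exists rs, uniq rs /\ map_poly phi P = \prod_(r <- rs) ('X - r%:P).
  move=> hphi; have [R [E bR]] := inv phi hphi.
  by have [rs [h1 h2 _ _]] := hP phi R hphi E bR; exists rs.
have gA' := good_quotient gA mP sP1 sepP hq.
have hz : (map_poly iota P).[z] = 0 by case: hq.
have [U [G [EW uU wG inv']]] :=
  step_quotient gA mH sH N1 char prw cop inv Dlt N'0 hz hP gA' bez ltq.
pose kappa' : {rmorphism K -> A'} := iota \o kappa.
have [mG sG _] := wG.
have [mT sT] := tschirnhausen_monic kappa' mG.
have prw' : e'.-primitive_root (w ^+ q).
  by have := exp_prim_root prw q; rewrite gcdnMr mulKn.
have [||ds run] := IH N' N'N A' kappa' (tschirnhausen kappa' G) e' _ _ (w ^+ q) gA' mT _ N'0 _ prw' inv'.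
- by rewrite sT sG.
- by move=> n /andP[n0 nN]; apply: char; rewrite n0 (leq_trans nN) // ltnW.
exists ((q, m, (size P).-1, N') :: ds).
apply: (pi_step _ pd hq bez ltq EW uU wG run).
by rewrite sH eqSS gtn_eqF.
Qed.

(** * Distances between conjugate roots *)

Section ConjugateDistances.
Variables (L : fieldType) (e : nat) (w : L) (bs : seq nat).
Hypothesis prw : e.-primitive_root w.
Let e0 : (0 < e)%N := prim_order_gt0 prw.
Notation pw := (map_poly (fsub idfun 1 e)).

(** If w^i fixes a, then e divides i n for every n in the support, in particular for the
    characteristic exponents, whose gcd with e is 1. *)
Lemma char_exps_conj (a : fps L) : char_exps_from e (fcoef a) bs -> conj_distinct e w a.
Proof.
move=> ha i Ea; have nz n : fcoef a n != 0 -> (e %| i * n)%N.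
  move=> an; rewrite (prim_order_dvd prw) exprM.
  have := congr1 (fun f => fcoef f n) Ea; rewrite fcoef_scale => /eqP.
  by rewrite -{1}[fcoef a n]mulr1 (inj_eq (mulfI an)) eq_sym.
suff gen g : char_exps_from g (fcoef a) bs -> (e %| i * g)%N -> (e %| i)%N.
  by apply: (gen e ha); rewrite dvdn_mull.
elim: bs g => [|b bs' IH] g /=; first by move=> -> ; rewrite muln1.
case=> ab _ _ h4 ig; apply: (IH (gcdn g b) h4).
by rewrite muln_gcdr dvdn_gcd ig nz.
Qed.

(* Since w ^ (k * n) = 1 exactly when e %/ gcdn e k divides n, this is the distance from a branch to its
   k-th conjugate. *)
Definition conj_dist k := nth 0%N bs (find (fun b => ~~ (e %/ gcdn e k %| b)%N) bs).

Lemma conj_distP (a : fps L) k : char_exps_from e (fcoef a) bs -> (0 < k < e)%N ->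
  fps_val (a - fscale (w ^+ k) a) = conj_dist k.
Proof.
move=> ha /andP[k0 ke]; set dd := (e %/ gcdn e k)%N.
have g0 : (0 < gcdn e k)%N by rewrite gcdn_gt0 e0.
have dde : (dd %| e)%N by apply/dvdnP; exists (gcdn e k); rewrite mulnC divnK ?dvdn_gcdl.
have dvdE n : (e %| k * n)%N = (dd %| n)%N.
  have Ee : e = (dd * gcdn e k)%N by rewrite divnK ?dvdn_gcdl.
  have Ek : k = (k %/ gcdn e k * gcdn e k)%N by rewrite divnK ?dvdn_gcdr.
  rewrite {1}Ee [X in (_ %| X * n)%N]Ek mulnAC dvdn_pmul2r //.
  rewrite Gauss_dvdr // /coprime -(eqn_pmul2r g0) muln_gcdl mul1n.
  by rewrite !divnK ?dvdn_gcdl ?dvdn_gcdr.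
have dd1 : dd != 1%N.
  apply/eqP => E; have := dvdE 1%N; rewrite E dvd1n muln1 => /(dvdn_leq k0).
  by rewrite leqNgt ke.
have [_ [h1 h2 h3]] := char_exps_first ha dde dd1.
have w1 n : (w ^+ k ^+ n == 1) = (dd %| n)%N by rewrite -exprM -(prim_order_dvd prw) dvdE.
apply: fps_val_eq => [i hi|]; rewrite fcoefB fcoef_scale -[X in X - _]mulr1 -mulrBr.
  case: (eqVneq (fcoef a i) 0) => [->|/(h3 _ hi) hd]; first by rewrite mul0r.
  by rewrite (eqP (_ : w ^+ k ^+ i == 1)) ?w1 // subrr mulr0.
by rewrite mulf_neq0 // subr_eq0 eq_sym w1.
Qed.

Lemma conj_seq_cons a : conj_seq e w a = a :: [seq fscale (w ^+ k) a | k <- iota 1 e.-1].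
Proof. by rewrite /conj_seq -{1}(prednK e0) /= expr0 fscale1. Qed.

Lemma count_self a v : char_exps_from e (fcoef a) bs ->
  count (fun b => (b != a) && (fps_val (a - b) == v)) (conj_seq e w a)
  = count (fun k => conj_dist k == v) (iota 1 e.-1).
Proof.
move=> ha; rewrite conj_seq_cons /= eqxx /= add0n count_map; apply: eq_in_count => k.
rewrite mem_iota add1n prednK // => hk /=; rewrite (conj_distP ha hk).
suff -> : fscale (w ^+ k) a != a by [].
case/andP: hk => k0 ke; apply/eqP => /esym/(char_exps_conj ha) /(dvdn_leq k0).
by rewrite leqNgt ke.
Qed.

(* The intersection multiplicity of two branches whose closest roots are at distance c: by the
   ultrametric inequality the other conjugates are at distance minn c (conj_dist k). *)
Definition contact_sum c := (c + \sum_(k <- iota 1 e.-1) minn c (conj_dist k))%N.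
Definition contact_count c v :=
  ((c == v) + count (fun k => minn c (conj_dist k) == v) (iota 1 e.-1))%N.

(** An intersection multiplicity thus determines the contact c, and through [contact_count] all
    distances from a root of one branch to the roots of the other. *)
Lemma contact_sum_inj : injective contact_sum.
Proof.
have mono c c' : (c < c')%N -> (contact_sum c < contact_sum c')%N.
  move=> lt; rewrite /contact_sum -addSn leq_add //.
  by apply: leq_sum => k _; rewrite leq_min !geq_min (ltnW lt) leqnn /= ?orbT.
by move=> c c' E; case: (ltngtP c c') => // /mono; rewrite E ltnn.
Qed.

Lemma contact_exists (a b : fps L) : char_exps_from e (fcoef a) bs ->
  char_exps_from e (fcoef b) bs -> (forall i, a != fscale (w ^+ i) b) ->
  exists c, conj_contact e w a b = contact_sum c /\
    forall v, count (fun x => (x != a) && (fps_val (a - x) == v)) (conj_seq e w b) = contact_count c v.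
Proof.
move=> ha hb ne.
pose F k := fps_val (a - fscale (w ^+ k) b).
(* The conjugate of b closest to a; the distances to the others follow from it. *)
have [k0 kmax] : exists k0, forall k, (F k <= F k0)%N.
  have [k1 _ h1] := @arg_maxnP 'I_e (Ordinal e0) xpredT F isT.
  exists k1 => k; have -> : F k = F (k %% e)%N by rewrite /F (prim_expr_mod prw).
  exact: (h1 (Ordinal (ltn_pmod k e0)) isT).
pose b0 := fscale (w ^+ k0) b; set c := F k0 in kmax.
have wk : w ^+ k0 != 0.
  by rewrite expf_neq0 //; apply: contra_eq_neq (prim_expr_order prw) => ->;
     rewrite expr0n gtn_eqF // eq_sym oner_neq0.
have hb0 : char_exps_from e (fcoef b0) bs.
  rewrite -[bs]map_id -(eq_map (add0n)); apply: char_exps_shift hb => // j _.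
  by rewrite add0n fcoef_scale mulf_eq0 expf_eq0 (negPf wk) andbF orbF.
have Fb0 k : fscale (w ^+ k) b0 = fscale (w ^+ (k + k0)) b by rewrite fscale_comp exprD.
have dist k : (0 < k < e)%N -> F (k + k0) = minn c (conj_dist k).
  move=> hk; have Ek := conj_distP hb0 hk.
  have n1 : b0 != fscale (w ^+ k) b0.
    case/andP: (hk) => k1 ke; apply/eqP => /(char_exps_conj hb0) /(dvdn_leq k1).
    by rewrite leqNgt ke.
  have n2 : a != fscale (w ^+ k) b0 by rewrite Fb0.
  have -> : F (k + k0) = fps_val (a - fscale (w ^+ k) b0) by rewrite Fb0.
  case: (eqVneq c (conj_dist k)) => E; last first.
    by rewrite (@fps_val_min _ a b0) ?Ek // ?ne.
  (* In a tie the ultrametric inequality gives only a lower bound; the upper one is the maximality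
     of c. *)
  apply/eqP; rewrite eqn_leq -{2}Ek (@fps_val_minle _ a b0) // andbT -E minnn Fb0.
  exact: kmax.
have pb : perm_eq (conj_seq e w b) (conj_seq e w b0).
  apply: uniq_perm; rewrite ?(uniq_conj_seq prw) //; try exact: char_exps_conj.
  have mem x y : (exists k, x = fscale (w ^+ k) y) -> x \in conj_seq e w y.
    case=> k ->; apply/mapP; exists (k %% e)%N; first by rewrite mem_iota ltn_pmod.
    by rewrite (prim_expr_mod prw).
  move=> x; apply/idP/idP => /mapP[k _ ->]; apply: mem; last first.
    by exists (k + k0)%N; rewrite Fb0.
  exists (k + k0 * e.-1)%N; rewrite Fb0 -addnA -mulnSr prednK // exprD [(k0 * e)%N]mulnC exprM.
  by rewrite (prim_expr_order prw) expr1n mulr1.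
exists c; split=> [|v].
  have -> : conj_contact e w a b = (\sum_(x <- conj_seq e w b) fps_val (a - x)%R)%N.
    by rewrite /conj_contact /conj_seq big_map -(big_mkord xpredT F) /index_iota subn0.
  rewrite (perm_big _ pb) conj_seq_cons big_cons big_map /=; congr (_ + _)%N.
  rewrite big_seq [RHS]big_seq; apply: eq_bigr => k; rewrite mem_iota add1n prednK // => hk.
  by rewrite -dist // /F Fb0.
have /permP -> := pb; rewrite conj_seq_cons /= count_map.
have -> : b0 != a by rewrite eq_sym ne.
congr (_ + _)%N; apply: eq_in_count => k; rewrite mem_iota add1n prednK // => hk /=.
by rewrite -dist // /F Fb0 eq_sym ne.
Qed.

End ConjugateDistances.

Section BalancedFactors.
Variables (L : fieldType) (e : nat) (w : L) (bs : seq nat) (F : {poly fps L}) (Fs : seq {poly fps L}).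
Hypotheses (prw : e.-primitive_root w) (uF : uniq Fs).
Hypotheses (mF : {in Fs, forall G, G \is monic}) (sF : {in Fs, forall G : {poly fps L}, size G = e.+1}).
Hypothesis cF : {in Fs, forall G, has_char_exps G (e :: bs)}.
Hypothesis EF : \prod_(G <- Fs) G = F.
Hypothesis bal : forall i j, (i < size Fs)%N -> (j < size Fs)%N ->
  perm_eq (inter_set Fs i) (inter_set Fs j).
Let e0 : (0 < e)%N := prim_order_gt0 prw.
Notation pw := (map_poly (fsub idfun 1 e)).

Lemma param_root G S : G \in Fs -> puiseux_param G S <-> root (pw G) S.
Proof.
by move=> GF; rewrite /puiseux_param sF //= fsubE //; split=> /rootP.
Qed.

Lemma root_char_exps G S : G \in Fs -> root (pw G) S -> char_exps_from e (fcoef S) bs.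
Proof.
move=> GF /(param_root _ GF) hS; have [_ /(_ S hS)] := cF GF.
by rewrite sF //= => /is_char_expsP.
Qed.

Lemma factor_roots : exists root_of : {poly fps L} -> fps L, forall G, G \in Fs -> root (pw G) (root_of G).
Proof.
have /choice[f hf] : forall G, exists S, G \in Fs -> root (pw G) S.
  move=> G; case: (boolP (G \in Fs)) => GF; last by exists 0.
  by have [[S /(param_root _ GF) hS] _] := cF GF; exists S.
by exists f.
Qed.

Lemma pw_factor G S : G \in Fs -> root (pw G) S -> pw G = \prod_(r <- conj_seq e w S) ('X - r%:P).
Proof.
move=> GF hS; apply: (pw_conj_seq prw (mF GF) (sF GF) _ hS).
exact: (char_exps_conj prw (root_char_exps GF hS)).
Qed.

Lemma factor_sep G G' S S' i : G \in Fs -> G' \in Fs -> root (pw G) S -> root (pw G') S' ->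
  S = fscale (w ^+ i) S' -> G = G'.
Proof.
move=> GF GF' hS hS' E; apply: (pw_inj prw).
rewrite (pw_factor GF hS) [RHS](@pw_factor _ S GF') // E.
by have := rmorph_root (fscale (w ^+ i)) hS'; rewrite conj_pw.
Qed.

Lemma factors_balanced_roots : exists D M (R : seq (fps L)),
  pw F = \prod_(r <- R) ('X - r%:P) /\
  [/\ uniq R, {in R, forall a v, count (fun b => (b != a) && (fps_val (a - b) == v)) R = D v}
    & {in R, forall a dd n, (dd %| e)%N -> (first_not_div dd n (fcoef a) <-> M dd n)}].
Proof.
have [f hf] := factor_roots.
pose R := flatten [seq conj_seq e w (f G) | G <- Fs].
have mem_conj G S : G \in Fs -> S \in conj_seq e w (f G) -> root (pw G) S.
  by move=> GF hS; rewrite (pw_factor GF (hf G GF)) root_prod_XsubC.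
have RP a : a \in R -> exists2 G, G \in Fs & root (pw G) a.
  by case/flatten_mapP => G GF ha; exists G => //; apply: mem_conj.
have ucs G S : G \in Fs -> root (pw G) S -> uniq (conj_seq e w S).
  by move=> GF hS; apply: (uniq_conj_seq prw); apply: (char_exps_conj prw (root_char_exps GF hS)).
have pconj G S : G \in Fs -> root (pw G) S -> perm_eq (conj_seq e w (f G)) (conj_seq e w S).
  move=> GF hS; apply: uniq_perm; rewrite ?(ucs G) ?hf // => x.
  by rewrite -!root_prod_XsubC -(pw_factor GF hS) -(pw_factor GF (hf G GF)).
pose W := conj_dist e bs.
(* [cf] inverts [contact_sum] on its image, so that [D] can be written in terms of the intersection
   set of the first factor, which is that of every factor up to order. *)
have /choice[cf hcf] : forall n, exists c, (exists c', contact_sum e bs c' = n) -> contact_sum e bs c = n.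
  move=> n; case: (pselect (exists c', contact_sum e bs c' = n)) => [[c hc]|h]; last by exists 0%N.
  by exists c.
pose Psi v n := contact_count e bs (cf n) v.
pose D v := (count (fun k => W k == v) (iota 1 e.-1) + \sum_(n <- inter_set Fs 0) Psi v n)%N.
pose M dd n := dd != 1%N /\ n = nth 0%N bs (find (fun b => ~~ (dd %| b)%N) bs).
exists D, M, R; split; last split.
- rewrite -EF rmorph_prod /R big_flatten big_map /= big_seq [RHS]big_seq.
  by apply: eq_bigr => G GF; apply: pw_factor (hf G GF).
- apply: uniq_flatten_map => // [G GF|G G' GF GF' t tG tG']; first exact: ucs (hf G GF).
  by apply: (@factor_sep _ _ t t 0%N GF GF'); rewrite ?mem_conj // expr0 fscale1.
- move=> a /RP[G GF ha] v; rewrite /R count_flatten -map_comp sumnE big_map.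
  rewrite (bigD1_seq G) //=; congr (_ + _)%N.
    have /permP -> := pconj G a GF ha.
    exact: (count_self prw v (root_char_exps GF ha)).
  have iG : (index G Fs < size Fs)%N by rewrite index_mem.
  have s0 : (0 < size Fs)%N by apply: leq_ltn_trans iG.
  rewrite -(perm_big _ (bal iG s0)) inter_set_nth // nth_index // big_map big_filter.
  rewrite big_seq_cond [RHS]big_seq_cond; apply: eq_bigr => G' /andP[GF' ne].
  have hS' := hf G' GF'.
  have nconj i : a != fscale (w ^+ i) (f G').
    by apply: contra_neq ne => Ei; rewrite (factor_sep GF GF' ha hS' Ei).
  have [c [Ec hc]] := contact_exists prw (root_char_exps GF ha) (root_char_exps GF' hS') nconj.
  rewrite hc /Psi.
  have -> : inter_mult G G' = contact_sum e bs c.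
    rewrite -Ec; apply: (inter_mult_conj prw (mF GF) (mF GF') (pw_factor GF ha) (pw_factor GF' hS')) => //.
      exact: (char_exps_conj prw (root_char_exps GF ha)).
    exact: (char_exps_conj prw (root_char_exps GF' hS')).
  congr contact_count; apply: (@contact_sum_inj e bs).
  by rewrite hcf //; exists c.
move=> a /RP[G GF ha] dd n dde; have ha' := root_char_exps GF ha.
split=> [h|[d1 ->]]; last by have [] := char_exps_first ha' dde d1.
have d1 : dd != 1%N by case: h => _ h _; apply: contraNneq h => ->; rewrite dvd1n.
split=> //; have [_ h'] := char_exps_first ha' dde d1.
exact: first_not_div_uniq h h'.
Qed.

End BalancedFactors.

Lemma balanced_pseudo_irreducible (K : fieldType) d (F : {poly fps K}) (L : closedFieldType)
    (iota : {rmorphism K -> L}) Fs :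
  (forall p, p \in [pchar K] -> (d < p)%N) -> (0 < d)%N -> F \is monic -> size F = d.+1 ->
  irr_factors (map_poly (fps_map iota) F) Fs -> balanced Fs -> pseudo_irreducible F.
Proof.
move=> char d0 mF sF [uF /allP mFs irr EF] [[cl hcl] bal].
have charK := natr_neq0_lt_pchar char.
have mF' : map_poly (fps_map iota) F \is monic by rewrite fps_map_fsub; apply: monic_map.
have sF' : size (map_poly (fps_map iota) F) = d.+1 by rewrite fps_map_fsub size_map_monic.
have s1 G : G \in Fs -> (1 < size G)%N.
  move=> GF; have [_ [nu _]] := irr G GF; rewrite ltn_neqAle size_poly_gt0 monic_neq0 ?mFs // andbT.
  apply/eqP => /esym/(monic_size1 (mFs G GF)) E; apply: nu; exists 1.
  by rewrite E mul1r.
have sle G : G \in Fs -> (size G <= d.+1)%N.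
  move=> GF; rewrite -sF' -EF.
  have mr : \prod_(H <- rem G Fs) H \is monic.
    by apply: monic_prod_seq => H /mem_rem; apply: mFs.
  rewrite (big_rem G) //=; set Q := \prod_(H <- _) _ in mr *.
  rewrite size_monicM ?mFs ?monic_neq0 //.
  by have := monic_neq0 mr; rewrite -size_poly_gt0; case: (size Q) => // n _; rewrite addnS leq_addr.
have [G0 G0F] : exists G, G \in Fs.
  case: Fs EF {uF mFs irr hcl bal s1 sle} => [|G Fs] EF; last by exists G; rewrite mem_head.
  by move: sF'; rewrite -EF big_nil size_poly1 => -[] h; rewrite -h in d0.
pose e := (size G0).-1.
have e0 : (0 < e)%N by have := s1 G0 G0F; rewrite /e; case: (size G0) => [|[]].
have ed : (e <= d)%N by have := sle G0 G0F; rewrite /e; case: (size G0).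
(* A list of characteristic exponents begins with the degree, so a common list forces a common
   degree e. *)
have clE G : G \in Fs -> exists bs, cl = (size G).-1 :: bs.
  by move=> GF; have [[S hS] /(_ S hS)[bs [-> _ _]]] := hcl G GF; exists bs.
have [bs Ecl] := clE G0 G0F.
have sG G : G \in Fs -> size G = e.+1.
  move=> GF; have [bs' E] := clE G GF; move: E; rewrite Ecl => -[h _].
  by rewrite /e h prednK // ltnW // s1.
have [w prw] : exists w : L, e.-primitive_root w.
  by apply: closed_prim_root; rewrite -(rmorph_nat iota) fmorph_eq0 charK // e0.
have cF : {in Fs, forall G, has_char_exps G (e :: bs)} by move=> G /hcl; rewrite Ecl.
have [D [M [R [ER [uR hD hM]]]]] := factors_balanced_roots prw uF mFs sG cF EF bal.
have ER' : map_poly (fsub iota 1 e) F = \prod_(r <- R) ('X - r%:P) by rewrite -ER map_fps_map.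
have sR : size R = d by apply: size_roots mF sF ER'.
have dK : d%:R != 0 :> K by rewrite charK // d0 leqnn.
have := @tschirnhausen_roots K L K (fun x => x) iota iota e F R d (fun=> erefl) e0 d0 dK sF ER' sR.
set c := tsch_shift _ _ _ _; set R' := map _ _ => -[ET ST].
have [mT sT] := tschirnhausen_monic (fun x : K => x) mF.
have bR' : balanced_roots e D M R'.
  split=> //.
  - by rewrite map_inj_uniq //; apply: addIr.
  - move=> _ /mapP[a aR ->] v; rewrite count_map -(hD a aR); apply: eq_count => b /=.
    rewrite (inj_eq (@addIr _ c)); congr (_ && (fps_val _ == v)).
    by rewrite opprD addrACA subrr addr0.
  move=> _ /mapP[a aR ->] dd n dde; rewrite -(hM a aR dd n dde).
  apply: (@first_not_div_shift _ dd 0) => // j nd.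
  rewrite fcoefD tsch_shift_coef ?addr0 //; apply: contra nd; exact: dvdn_trans.
have [ds run] : exists ds, pi_run (idfun : {rmorphism K -> K}) (tschirnhausen (fun x : K => x) F) ds 1.
  apply: (@balanced_run K L iota d K idfun _ e D M w) => //.
  - exact: good_base.
  - by rewrite sT.
  move=> phi hphi; exists R'; split=> //; rewrite -ET; congr (map_poly (fsub _ _ _) _).
  by apply: funext => x; apply: hphi.
by exists ds.
Qed.

Theorem theorem9 (K : fieldType) (d : nat) (F : {poly fps K}) :
  perfect_field K ->
  (forall p : nat, p \in [pchar K] -> (d < p)%N) ->
  (0 < d)%N ->
  F \is monic -> size F = d.+1 -> square_free F ->
  forall (L : closedFieldType) (iota : {rmorphism K -> L}),
  algebraic_over iota ->
  forall Fs : seq {poly fps L},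
  irr_factors (map_poly (fps_map iota) F) Fs ->
  (balanced Fs <-> pseudo_irreducible F) /\
  (forall ds, pi_success F ds ->
     [/\ size Fs = f_tot ds,
         (forall G, G \in Fs -> size G = (e_tot ds).+1),
         (forall G, G \in Fs -> has_char_exps G (char_exps_list ds))
       & (forall i, (i < size Fs)%N -> perm_eq (inter_set Fs i) (inter_list ds))]).
Proof.
move=> _ char d0 mF sF _ L iota alg Fs irr.
have structure ds := success_structure (ds := ds) char d0 mF sF alg irr.
split; last exact: structure.
split=> [bal|[ds /structure[_ _ hc hi]]].
  exact: balanced_pseudo_irreducible char d0 mF sF irr bal.
split; first by exists (char_exps_list ds).
move=> i j iF jF; apply: perm_trans (hi i iF) _.
by rewrite perm_sym hi.
Qed.
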